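(* Let $J\subset I_0$ and let $(e_v)_{v\in W_0^J}$ be an $A_0$-basis of $A_J$. Identify $f=\sum_{v\in W_0^J}f_ve_v\in A_J$ ($f_v\in A_0$) with the column vector $\underline f=(f_v)_{v\in W_0^J}$. Define $$m_{v,v'}=\frac1{\#W_0}\sum_{w\in W_0}w\,\frac{e_ve_{v'}^*}{\Delta_0}\in K(L)^{W_0},\qquad M=(m_{v,v'})_{v,v'\in W_0^J}.$$ Then for all $f,g\in A_J$ $$(f,g)=\mathrm{ct}\bigl(\underline f^{\mathsf T}M\,\underline g^*\,\nabla\bigr).$$
   Context: **Duality data.** $V$ is a finite-dimensional real Euclidean space with inner product $\langle\cdot,\cdot\rangle$; $\alpha^\vee=2\alpha/\langle\alpha,\alpha\rangle$ for $0\ne\alpha\in V$. Affine functions on $V$ are written $v+rc$ ($v\in V$, $r\in\mathbb R$), meaning $x\mapsto\langle v,x\rangle+r$; the gradient is $v$. For $a=v+rc$ with $v\neq0$ put $a^\vee=2a/\langle v,v\rangle$. For a reduced root system $R$: $S(R)=\{\alpha+rc:\alpha\in R,r\in\mathbb Z\}$, $S(R)^\vee=\{a^\vee:a\in S(R)\}$, $P(R)=\{\lambda\in\mathrm{span}_{\mathbb R}R:\langle\lambda,\alpha^\vee\rangle\in\mathbb Z\ \forall\alpha\in R\}$. A triple $(S,R,L)$ together with $L'$ (part of a set of duality data, $R$ spanning $V$) is an orthogonal direct sum (unions of root systems, sums of lattices) of irreducible ones, each of one of the forms, $R$ irreducible and reduced: (i) $S=S(R)$, $L=P(R)$, $L'=P(R^\vee)$;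 (ii) $S=S(R)^\vee$, $L=L'=P(R^\vee)$; (iii) $R=\{\pm2\varepsilon_i,\ \pm\varepsilon_i\pm\varepsilon_j\ (i<j)\}$ of type $C_n$, $n\ge1$, $\varepsilon_1,\dots,\varepsilon_n$ orthonormal, $S=S(R)\cup S(R)^\vee$, $L=L'=\mathbb ZR^\vee$. Fix positive roots $R^+$ with simple reflections $s_i$ ($i\in I_0$) generating the Weyl group $W_0$; $W=W_0\ltimes t(L')$ (translations by $L'$) acts on affine functions by $(wf)(x)=f(w^{-1}x)$. $S^+$ is the set of $a\in S$ positive on the fundamental alcove (the alcove of $S$ in the dominant chamber of $R^+$ having $0$ in its closure). $a\in S$ is indivisible if $a/2\notin S$; $a$ is linear if it has the form $a=v+0\cdot c$. **Coefficients.** $k:S\to\mathbb R$ is constant on $W$-orbits; $k(2a):=0$ if $2a\notin S$. $K\supset\mathbb Q$ is a field with a homomorphism $q:\mathbb R\to K^\times$ such that $q(x)$ is transcendental over $\mathbb Q$ for $x\ne0$, and an involutive automorphism $*$ with $q(x)^*=q(-x)$. $A=K[L]$ is the group algebra with basis $e(\mu)$, $e(\mu+rc):=q(r)e(\mu)$, $K(L)$ its fraction field; $*$ on $A$ also sends $e(\mu)\mapsto e(-\mu)$, and is applied entrywise to vectors. $A_0=A^{W_0}$; $W_J=\langle s_j:j\in J\rangle$; $A_J=A^{W_J}$; $W_0^J$ is the set of shortest representatives of the cosets $W_0/W_J$. **Weights.** For indivisible $a$ and a sign put $$\Delta_{\pm a}=\frac{1-e(\pm2a)}{(1-q(k(a))e(\pm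 a))(1+q(k(2a))e(\pm a))}.$$ Then $\Delta=\prod_{a\in S^+\text{ indivisible}}\Delta_a$, $\Delta_0=\prod_{a\in S^+\text{ indivisible, linear}}\Delta_{-a}\in K(L)$, $\nabla=\Delta\Delta_0$ (it is $W_0$-invariant), and $(f,g)=\mathrm{ct}(fg^*\Delta)$ for $f,g\in A$, $\mathrm{ct}$ being the constant term. Interpretation: replacing $q(x)$ by $q^x$, $0<q<1$, with positive labels, $\Delta$ and $\nabla$ are functions on the compact torus $\mathrm{Hom}(L,U(1))$ and $\mathrm{ct}$ is the integral against normalised Haar measure; after division by the common scalar $\mathrm{ct}(\Delta)$ all constant terms occurring are rational functions of the $q$- and $q^k$-parameters and are thereby defined in $K$ (for labellings $k$ where they are defined). Formulas are understood with this common normalisation. *)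

(* Defs.v *)
From HB Require Import structures.
From mathcomp Require Import all_boot all_order all_algebra.
From mathcomp Require Import finmap complex.
From mathcomp Require Import all_classical all_reals all_analysis.
(* The notations of [mpoly] clash with those of MathComp-Analysis. *)
From mathcomp.multinomials Require Import -(notations) mpoly.

Set Implicit Arguments.
Unset Strict Implicit.
Unset Printing Implicit Defensive.

Import Order.TTheory GRing.Theory Num.Theory numFieldNormedType.Exports.

Local Open Scope classical_set_scope.
Local Open Scope ring_scope.
Local Open Scope complex_scope.

Section Roots.
Context {R : realType} {V : vectType R} (ip : {dot V for idfun}).

(* The affine function [x |-> <v, x> + r] is the pair [(v, r)], with gradient
   [v]; [-a] and [a *+ 2] are computed in the product group [V * R]. *)
Definition affine : Type := (V * R)%type.
Definition aeval (a : affine) (x : V) : R := ip a.1 x + a.2.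

Definition coroot (v : V) : V := (2 / ip v v) *: v.
Definition acoroot (a : affine) : affine :=
  (coroot a.1, 2 / ip a.1 a.1 * a.2).

Definition refl (al : V) : 'End(V) :=
  linfun (fun x : V => x - ip x (coroot al) *: al).

Definition rspan (X : set V) : set V :=
  [set v | exists s : seq V, (forall x, x \in s -> X x) /\ v \in span s].
Definition zspan (X : set V) : set V :=
  [set v | exists s : seq (int * V),
     (forall t, t \in s -> X t.2) /\ v = \sum_(t <- s) t.2 *~ t.1].

Definition orthogonal_sets (X Y : set V) : Prop :=
  forall x y, X x -> Y y -> ip x y = 0.

(* Root systems in their own span, which may be a proper subspace of [V]. *)
Definition root_system (Rt : set V) : Prop :=
  [/\ finite_set Rt, ~ Rt 0,
      (forall al be, Rt al -> Rt be -> Rt (refl al be)) &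
      (forall al be, Rt al -> Rt be -> ip be (coroot al) \is a Num.int)].

Definition reduced (Rt : set V) : Prop :=
  forall al (c : R), Rt al -> Rt (c *: al) -> c = 1 \/ c = -1.

Definition irreducible (Rt : set V) : Prop :=
  Rt !=set0 /\
  forall R1 R2, Rt = R1 `|` R2 -> orthogonal_sets R1 R2 ->
    R1 = set0 \/ R2 = set0.

Definition coroots (Rt : set V) : set V := coroot @` Rt.

Definition affine_roots (Rt : set V) : set affine :=
  [set a | Rt a.1 /\ a.2 \is a Num.int].

Definition acoroots (S : set affine) : set affine := acoroot @` S.

Definition weight_lattice (Rt : set V) : set V :=
  [set la | rspan Rt la /\
            forall al, Rt al -> ip la (coroot al) \is a Num.int].

Definition typeC_roots n (eps : 'I_n -> V) : set V :=
  [set v | (exists i, v = eps i *+ 2 \/ v = - (eps i *+ 2)) \/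
           (exists i j : 'I_n, (i < j)%N /\
              [\/ v = eps i + eps j, v = eps i - eps j,
                  v = - eps i + eps j | v = - eps i - eps j])].

Definition irreducible_datum (S : set affine) (Rt L L' : set V) : Prop :=
  [/\ root_system Rt, reduced Rt, irreducible Rt &
  [\/ [/\ S = affine_roots Rt, L = weight_lattice Rt &
          L' = weight_lattice (coroots Rt)],
      [/\ S = acoroots (affine_roots Rt), L = weight_lattice (coroots Rt) &
          L' = L] |
      exists n (eps : 'I_n -> V),
        [/\ (0 < n)%N, (forall i j, ip (eps i) (eps j) = (i == j)%:R),
            Rt = typeC_roots eps,
            S = affine_roots Rt `|` acoroots (affine_roots Rt) &
            L = zspan (coroots Rt) /\ L' = L]]].

Definition sum_sets m (X : 'I_m -> set V) : set V :=
  [set v | exists l : 'I_m -> V, (forall j, X j (l j)) /\ v = \sum_j l j].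

Definition direct_sum_datum (S : set affine) (Rt L L' : set V) : Prop :=
  exists (m : nat) (Sj : 'I_m -> set affine) (Rj Lj L'j : 'I_m -> set V),
  [/\ (forall j, irreducible_datum (Sj j) (Rj j) (Lj j) (L'j j)),
      (forall i j, i != j -> orthogonal_sets (Rj i) (Rj j)),
      S = \bigcup_j Sj j, Rt = \bigcup_j Rj j &
      L = sum_sets Lj /\ L' = sum_sets L'j].

Definition positive_system (Rt Rp : set V) : Prop :=
  exists x : V, (forall al, Rt al -> ip al x != 0) /\
                Rp = [set al | Rt al /\ 0 < ip al x].

Definition Zbasis n (L : set V) (b : n.-tuple V) : Prop :=
  basis_of fullv b /\
  L = [set v | exists m : 'I_n -> int, v = \sum_i (tnth b i) *~ m i].

End Roots.

(* [dbasis] is an auxiliary Z-basis of [L], used only to write down [K(L)]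
   and the torus [Hom(L, U(1))] in coordinates. *)
Record data (R : realType) (V : vectType R) := Data {
  dip : {dot V for idfun};
  dS : set (V * R);
  dR : set V;
  dL : set V;
  dL' : set V;
  dRp : set V;
  dbasis : (\dim {:V}).-tuple V }.

Section Weyl.
Context {R : realType} {V : vectType R} (D : data V).
Local Notation ip := (dip D).
Local Notation S := (dS D).

Definition duality_data : Prop :=
  [/\ direct_sum_datum ip S (dR D) (dL D) (dL' D),
      rspan (dR D) = setT,
      positive_system ip (dR D) (dRp D) &
      Zbasis (dL D) (dbasis D)].

(* The index set [I_0]: simple reflections are indexed by simple roots. *)
Definition simple_roots : set V :=
  [set al | dRp D al /\
            ~ exists be ga, [/\ dRp D be, dRp D ga & al = be + ga]].

Definition is_word (J : set V) (s : seq V) : Prop :=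
  forall al, al \in s -> J al.
Definition word_prod (s : seq V) : 'End(V) :=
  foldr (fun al w => (refl ip al \o w)%VF) \1%VF s.

(* Reflections are involutions, so the group they generate consists of the
   products of words. *)
Definition parabolic (J : set V) : set 'End(V) :=
  [set w | exists2 s, is_word J s & w = word_prod s].
Definition W0 : set 'End(V) := parabolic simple_roots.
Definition card_W0 : nat := #|` fset_set W0|%fset.

Definition min_reps (J : set V) : set 'End(V) :=
  [set v | exists s, [/\ is_word simple_roots s, v = word_prod s &
     forall u s', parabolic J u -> is_word simple_roots s' ->
       (v \o u)%VF = word_prod s' -> (size s <= size s')%N]].

(* The action of [t(la) w], i.e. of [x |-> w x + la], on [<v, .> + r]. *)
Definition affine_act (la : V) (w : 'End(V)) (a : V * R) : V * R :=
  (w a.1, a.2 - ip (w a.1) la).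

Definition labelling (k : V * R -> R) : Prop :=
  forall la w a, dL' D la -> W0 w -> S a -> k (affine_act la w a) = k a.

(* Alcoves are the open cells cut out by the hyperplanes [a = 0], [a] in [S]. *)
Definition alcove (C : set V) : Prop :=
  exists2 x, (forall a, S a -> aeval ip a x != 0) &
    C = [set y | forall a, S a -> 0 < aeval ip a x * aeval ip a y].

Definition fundamental_alcove (C : set V) : Prop :=
  [/\ alcove C,
      (forall x al, C x -> dRp D al -> 0 < ip al x) &
      (forall eps : R, 0 < eps -> exists2 x, C x & ip x x < eps)].

Definition Spos : set (V * R) :=
  [set a | S a /\
     exists2 C, fundamental_alcove C & forall x, C x -> 0 < aeval ip a x].

Definition indivisible (a : V * R) : Prop :=
  S a /\ ~ exists2 b, S b & a = b *+ 2.

Definition k2 (k : V * R -> R) (a : V * R) : R :=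
  if `[< S (a *+ 2) >] then k (a *+ 2) else 0.

(* The coordinates of an element of [L] in the Z-basis are integers. *)
Definition zcoord (v : V) (i : 'I_(\dim {:V})) : int :=
  Num.floor (coord (dbasis D) i v).

Definition monomial (F : fieldType) (x : 'I_(\dim {:V}) -> F) (v : V) : F :=
  \prod_i x i ^ zcoord v i.

End Weyl.

Section Weights.
Context {R : realType} {V : vectType R} (D : data V) (k : V * R -> R).
Context (F : fieldType) (qF : R -> F) (eF : V -> F).

Definition eaff (a : V * R) : F := qF a.2 * eF a.1.

(* [weight_factor a b] is [Delta_b] for [b = a] or [b = - a]; both use the
   labels of [a]. *)
Definition weight_factor (a b : V * R) : F :=
  (1 - eaff (b *+ 2)) /
  ((1 - qF (k a) * eaff b) * (1 + qF (k2 D k a) * eaff b)).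

Definition Delta0 : F :=
  \big[*%R/1]_(a \in [set a | [/\ Spos D a, indivisible D a & a.2 = 0]])
    weight_factor a (- a).

(* The factors with constant term at most [N]; there are finitely many. *)
Definition Delta_partial (N : nat) : F :=
  \big[*%R/1]_(a \in [set a | [/\ Spos D a, indivisible D a & a.2 <= N%:R]])
    weight_factor a a.

End Weights.

Section Torus.
Context (R : realType) (n : nat).

(* A character, given by its values on the Z-basis of [L]. *)
Record torus := Torus {
  torus_val :> 'I_n -> R[i];
  torus_norm : forall i, `|torus_val i| = 1 }.

HB.instance Definition _ := gen_eqMixin torus.
HB.instance Definition _ := gen_choiceMixin torus.
HB.instance Definition _ :=
  isPointed.Build torus (@Torus (fun=> 1) (fun=> normr1 _)).

Lemma torus_mul_norm (x y : torus) i : `|x i * y i| = 1.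
Proof. by rewrite normrM !torus_norm mulr1. Qed.

Definition torus_mul (x y : torus) : torus :=
  Torus (torus_mul_norm x y).

(* These sets generate the Borel sigma-algebra of [U(1)^n]. *)
Definition torus_gen : set (set torus) :=
  [set A | exists i (r : R), A = [set x : torus | complex.Re (x i) <= r] \/
                             A = [set x : torus | complex.Im (x i) <= r]].

Definition borel_torus := g_sigma_algebraType torus_gen.

Definition haar (mu : {measure set borel_torus -> \bar R}) : Prop :=
  mu setT = 1%E /\
  forall (x : torus) (A : set borel_torus), measurable A ->
    mu (torus_mul x @^-1` A) = mu A.

Definition torus_integral (mu : {measure set borel_torus -> \bar R})
    (f : torus -> R[i]) : R[i] :=
  Rintegral mu setT (fun x => complex.Re (f x)) +i*
  Rintegral mu setT (fun x => complex.Im (f x)).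

End Torus.

Section Numerical.
Context {R : realType} {V : vectType R} (D : data V).
Local Notation n := (\dim {:V}).
Context (mu : {measure set (borel_torus R n) -> \bar R}).

Definition clim (u : nat -> R[i]) : R[i] :=
  (lim ((fun N => complex.Re (u N)) @ \oo)) +i* (lim ((fun N => complex.Im (u N)) @ \oo)).

Definition qnum (q0 x : R) : R[i] := (q0 `^ x)%:C.

(* For [2 a] not in [S] the factor [1 + e(a)] cancels in [weight_factor]; as
   [0 / 0 = 0], the functions below differ from the continuous ones only on the
   null set where such a factor vanishes. *)
Definition Delta_num (q0 : R) (k : V * R -> R) (x : torus R n) : R[i] :=
  clim (Delta_partial D k (qnum q0) (monomial D x)).

Definition nabla_num (q0 : R) (k : V * R -> R) (x : torus R n) : R[i] :=
  Delta_num q0 k x * Delta0 D k (qnum q0) (monomial D x).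

Definition positive_labelling (k : V * R -> R) : Prop :=
  labelling D k /\ forall a, dS D a -> 0 < k a.

End Numerical.

Section ParamPoly.
Context {R : realType} {V : vectType R}.

(* [(r, s)] stands for [q ^ (r + \sum_((m, a) <- s) m k(a))]. *)
Definition pmonomial : Type := (R * seq (int * (V * R)))%type.
Definition ppoly : Type := seq (rat * pmonomial).

Definition pexponent (k : V * R -> R) (m : pmonomial) : R :=
  m.1 + \sum_(t <- m.2) t.1%:~R * k t.2.

Definition peval (F : fieldType) (qF : R -> F) (k : V * R -> R) (p : ppoly) : F :=
  \sum_(t <- p) ratr t.1 * qF (pexponent k t.2).

Definition ppoly_over (S : set (V * R)) (p : ppoly) : Prop :=
  forall c m t, (c, m) \in p -> t \in m.2 -> S t.2.

End ParamPoly.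

Section GroupAlgebra.
Context {R : realType} {V : vectType R} (D : data V) (K : fieldType).
Local Notation n := (\dim {:V}).

(* In the Z-basis of [L], [K[L]] is the ring of Laurent polynomials in [n]
   variables, and has the same fraction field as the ring of polynomials. *)
Definition KL : fieldType := {fraction (mpoly.mpoly n K)}.

Definition KLC (c : K) : KL := FracField.tofrac (mpoly.mpolyC n c).
Definition KLe : V -> KL :=
  monomial D (fun i : 'I_n => FracField.tofrac (mpoly.mpolyX K (mpoly.mnm1 i)) : KL).

(* The extension to [K(L)] of the ring morphism sending [c] to [f c] and the
   [i]-th variable to [h i], when the latter is injective. *)
Definition KLmap (f : K -> KL) (h : 'I_n -> KL) (F : KL) : KL :=
  mpoly.mmap f h (frac (repr F)).1 / mpoly.mmap f h (frac (repr F)).2.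

Definition KLact (w : 'End(V)) : KL -> KL :=
  KLmap KLC (fun i => KLe (w (tnth (dbasis D) i))).

Definition KLstar (star : K -> K) : KL -> KL :=
  KLmap (fun c => KLC (star c)) (fun i => KLe (- tnth (dbasis D) i)).

Definition in_A (F : KL) : Prop :=
  exists s : seq (K * V), (forall t, t \in s -> dL D t.2) /\
    F = \sum_(t <- s) KLC t.1 * KLe t.2.

Definition W_invariant (W : set 'End(V)) (F : KL) : Prop :=
  forall w, W w -> KLact w F = F.

Definition A_ (J : set V) (F : KL) : Prop :=
  in_A F /\ W_invariant (parabolic D J) F.

Definition A0 : KL -> Prop := A_ (simple_roots D).

Definition coordinates (J : set V) (e : 'End(V) -> KL) (f : KL)
    (c : 'End(V) -> KL) : Prop :=
  (forall v, min_reps D J v -> A0 (c v)) /\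
  f = \sum_(v \in min_reps D J) c v * e v.

Definition A0_basis (J : set V) (e : 'End(V) -> KL) : Prop :=
  [/\ (forall v, min_reps D J v -> A_ J (e v)),
      (forall f, A_ J f -> exists c, coordinates J e f c) &
      (forall f c c', coordinates J e f c -> coordinates J e f c' ->
         forall v, min_reps D J v -> c v = c' v)].

End GroupAlgebra.

Arguments KL {R} V K.
Arguments KLC {R} V {K} c.
Arguments KLe {R V} D K v.

Section ConstantTerm.
Context {R : realType} {V : vectType R} (D : data V).
Local Notation n := (\dim {:V}).
Context (mu : {measure set (borel_torus R n) -> \bar R}).
Context (K : fieldType) (q : R -> K) (star : K -> K) (k : V * R -> R).

(* [x] is the value at [q], [k] of the rational function [P / Q] of the
   parameters which computes [ct(e(la) Theta) / ct(Delta)] for all [0 < q0 < 1]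
   and all positive labels. *)
Definition ct_value (Theta : R -> (V * R -> R) -> torus R n -> R[i])
    (la : V) (x : K) : Prop :=
  exists P Q : ppoly,
  [/\ ppoly_over (dS D) P, ppoly_over (dS D) Q,
      peval q k Q != 0, x = peval q k P / peval q k Q &
      forall (q0 : R) (k' : V * R -> R), 0 < q0 < 1 -> positive_labelling D k' ->
        peval (qnum q0) k' P * torus_integral mu (Delta_num D q0 k') =
        peval (qnum q0) k' Q *
          torus_integral mu (fun y => monomial D y la * Theta q0 k' y)].

Definition ct_defined (Theta : R -> (V * R -> R) -> torus R n -> R[i]) : Prop :=
  forall la, dL D la -> exists x, ct_value Theta la x.

(* [ct(F Theta) / ct(Delta)] for [F] in [A]; meaningful when [ct_defined]. *)
Definition ct (F : KL V K)
    (Theta : R -> (V * R -> R) -> torus R n -> R[i]) : K :=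
  xget 0 [set x | exists s : seq (K * V),
    [/\ (forall t, t \in s -> dL D t.2),
        F = \sum_(t <- s) KLC V t.1 * KLe D K t.2 &
        x = \sum_(t <- s) t.1 * xget 0 (ct_value Theta t.2)]].

Definition pairing (f g : KL V K) : K :=
  ct (f * KLstar D star g) (Delta_num D).

Definition Delta0_KL : KL V K :=
  Delta0 D k (fun r => KLC V (q r)) (KLe D K).

Definition m_entry (e : 'End(V) -> KL V K) (v v' : 'End(V)) : KL V K :=
  (card_W0 D)%:R^-1 *
  \sum_(w \in W0 D) KLact D w (e v * KLstar D star (e v') / Delta0_KL).

(* [f^T M g^*] for vectors [f], [g] indexed by [W_0^J]. *)
Definition m_form (J : set V) (e f g : 'End(V) -> KL V K) : KL V K :=
  \sum_(v \in min_reps D J) \sum_(v' \in min_reps D J)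
    f v * m_entry e v v' * KLstar D star (g v').

End ConstantTerm.

Definition coefficient_data (R : realType) (K : fieldType) (q : R -> K)
    (star : {rmorphism K -> K}) : Prop :=
  [/\ [pchar K] =i pred0,
      (forall x, q x != 0) /\ (forall x y, q (x + y) = q x * q y),
      (forall x, x != 0 -> ~ algebraicOver (ratr : rat -> K) (q x)) &
      involutive star /\ forall x, star (q x) = q (- x)].

(* Main.v *)
(* As [ct(f g^* Delta)] depends linearly on [f g^*], it suffices to show that
   [ct(e(la) Delta)] is the constant term against [nabla] of the average over
   [W0] of [e(la) / Delta0]. This average lies in [A]: its possible denominators
   [1 - e(b)], [b] a linear root with [2 b] not a root, are pairwise coprime, and
   the pole along [1 - e(b)] cancels between the terms of [w] and [s_b w]. Doing
   this over the rationals yields one finite list of monomials which expands the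
   average both in [K(L)] and at every point of the torus for every [q0] and every
   positive labelling. There [Delta = nabla / Delta0] off a null set, and both
   [nabla] and Haar measure are invariant under [W0], so integrating the expansion
   against [nabla] gives the identity numerically. It carries over to [K] because
   a polynomial in the parameters vanishing for all [0 < q0 < 1] and all positive
   labels vanishes at [q], [k], and because the integral of [nabla], which is
   positive almost everywhere, is not zero. *)

Require Import Defs.
From HB Require Import structures.
From mathcomp Require Import all_boot all_order all_algebra.
From mathcomp Require Import finmap complex.
From mathcomp Require Import all_classical all_reals all_analysis.
From mathcomp Require Import measurable_realfun.
From mathcomp Require Import ring lra zify.
From mathcomp.multinomials Require Import -(notations) mpoly.

Set Implicit Arguments.
Unset Strict Implicit.
Unset Printing Implicit Defensive.

Import Order.TTheory GRing.Theory Num.Theory.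

Local Open Scope classical_set_scope.
Local Open Scope ring_scope.

(** * Reflections and the weight lattice *)

(** Three features of the statement shape the argument. The field [K] and the complex numbers have
    only the rationals in common, and [ct_value] admits only rational functions of the parameters.
    So whatever the two sides share is recorded as finite lists with rational coefficients and
    formal labels, not as elements of one of the fields. Next, in [1 / Delta0] the factor of [a] has
    denominator [1 - e(-2a)] if [2a] is a root, and [1 - e(-a)] otherwise, because then [k(2a) = 0].
    Hence no exponent of a denominator is twice another one, and this is what makes denominators
    with non-opposite exponents coprime. Finally, constant terms are normalised by the integral of
    [Delta], a complex function whose integral is not visibly non-zero. It is not cancelled
    directly: the value attached to [nabla] itself, which [ct_defined] supplies for [la = 0], links
    that integral to the integral of [nabla], and the latter can be cancelled. *)

Section InnerProduct.
Context {R : realType} {V : vectType R} (ip : {dot V for idfun}).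

Lemma ipC u v : ip u v = ip v u.
Proof. by rewrite (hermC ip) expr0 mul1r. Qed.
Lemma ipDl u v w : ip (u + v) w = ip u w + ip v w.
Proof. exact: linearDl. Qed.
Lemma ipDr u v w : ip u (v + w) = ip u v + ip u w.
Proof. exact: linearDr. Qed.
Lemma ipNl u w : ip (- u) w = - ip u w.
Proof. exact: linearNl. Qed.
Lemma ipNr u w : ip u (- w) = - ip u w.
Proof. exact: linearNr. Qed.
Lemma ipBl u v w : ip (u - v) w = ip u w - ip v w.
Proof. by rewrite ipDl ipNl. Qed.
Lemma ipBr u v w : ip u (v - w) = ip u v - ip u w.
Proof. by rewrite ipDr ipNr. Qed.
Lemma ipZl c u w : ip (c *: u) w = c * ip u w.
Proof. exact: linearZl_LR. Qed.
Lemma ipZr c u w : ip u (c *: w) = c * ip u w.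
Proof. by rewrite ipC ipZl ipC. Qed.
Lemma ip0l w : ip 0 w = 0.
Proof. exact: linear0l. Qed.
Lemma ip0r w : ip w 0 = 0.
Proof. by rewrite ipC ip0l. Qed.
Lemma ip_suml I (s : seq I) (F : I -> V) w :
  ip (\sum_(i <- s) F i) w = \sum_(i <- s) ip (F i) w.
Proof.
by elim: s => [|i s IH]; rewrite ?big_nil ?ip0l // !big_cons ipDl IH.
Qed.
Lemma ip_gt0 v : v != 0 -> 0 < ip v v.
Proof. exact: neq0_dnorm_gt0. Qed.

Lemma ip_neq0 v : v != 0 -> ip v v != 0.
Proof. by move=> /ip_gt0 h; rewrite gt_eqF. Qed.

Definition reflfun (al x : V) : V := x - ip x (coroot ip al) *: al.

Lemma reflfun_linear al : linear (reflfun al).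
Proof.
move=> c x y; rewrite /reflfun ipDl ipZl scalerDl opprD addrACA scalerBr.
by rewrite scalerA.
Qed.
HB.instance Definition _ al :=
  GRing.isLinear.Build R V V *:%R (reflfun al) (reflfun_linear al).

Lemma reflE al x : refl ip al x = x - ip x (coroot ip al) *: al.
Proof. exact: (lfunE (reflfun al)). Qed.

Lemma corootZ c v : c != 0 -> coroot ip (c *: v) = c^-1 *: coroot ip v.
Proof.
move=> c0; rewrite /coroot ipZl ipZr !scalerA.
have [->|v0] := eqVneq v 0; first by rewrite !scaler0.
have h := ip_neq0 v0; congr (_ *: v); field; by rewrite h c0.
Qed.

Lemma ip_coroot_self v : v != 0 -> ip v (coroot ip v) = 2.
Proof. by move=> v0; rewrite ipZr divfK // ip_neq0. Qed.

Lemma reflZ c v : c != 0 -> refl ip (c *: v) = refl ip v.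
Proof.
move=> c0; apply/lfunP => x; rewrite !reflE corootZ // ipZr scalerA.
by rewrite mulrAC mulVf // mul1r.
Qed.

Lemma reflN v : refl ip (- v) = refl ip v.
Proof. by rewrite -scaleN1r reflZ // oppr_eq0 oner_eq0. Qed.

Lemma corootK v : v != 0 -> coroot ip (coroot ip v) = v.
Proof.
move=> v0; rewrite {2}/coroot corootZ ?mulf_neq0 ?invr_eq0 ?ip_neq0 //.
by rewrite scalerA mulVf ?scale1r // mulf_neq0 ?invr_eq0 ?ip_neq0.
Qed.

Lemma refl_self v : v != 0 -> refl ip v v = - v.
Proof. by move=> v0; rewrite reflE ip_coroot_self // scaler_nat mulr2n opprD addNKr. Qed.

Lemma reflK v : cancel (refl ip v) (refl ip v).
Proof.
have [->|v0] := eqVneq v 0; first by move=> x; rewrite !reflE !scaler0 !subr0.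
move=> x; rewrite !reflE ipBl ipZl ip_coroot_self // -!addrA -opprD -scalerDl.
set c := ip x _; have -> : c + (c - c * 2) = 0 by ring.
by rewrite scale0r subr0.
Qed.

Lemma refl_isom v x y : ip (refl ip v x) (refl ip v y) = ip x y.
Proof.
have [->|v0] := eqVneq v 0; first by rewrite !reflE !scaler0 !subr0.
have h := ip_neq0 v0; rewrite !reflE !(ipBl, ipBr, ipZl, ipZr) (ipC v y).
by field.
Qed.

Lemma refl_orth v x : ip x v = 0 -> refl ip v x = x.
Proof. by move=> h; rewrite reflE ipZr h mulr0 scale0r subr0. Qed.

End InnerProduct.

Section Lattice.
Context {R : realType} {V : vectType R} (D : data V).
Hypothesis HD : duality_data D.
Local Notation ip := (dip D).
Local Notation L := (dL D).
Local Notation n := (\dim {:V}).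
Local Notation bas := (dbasis D).

Lemma coord_lattice (m : 'I_n -> int) i :
  coord bas i (\sum_j (tnth bas j) *~ m j) = (m i)%:~R.
Proof.
have [_ _ _ [bP _]] := HD; have frb := basis_free bP.
rewrite linear_sum (bigD1 i) //= big1 ?addr0.
  by rewrite -scaler_int linearZ /= (tnth_nth 0) coord_free // eqxx mulr1.
move=> j ji; rewrite -scaler_int linearZ /= (tnth_nth 0) coord_free //.
by rewrite (negPf ji) mulr0.
Qed.

Lemma LP v : L v <-> exists m : 'I_n -> int, v = \sum_i (tnth bas i) *~ m i.
Proof. by have [_ _ _ [_ ->]] := HD. Qed.

Lemma zcoordE (m : 'I_n -> int) :
  zcoord D (\sum_j (tnth bas j) *~ m j) = m.
Proof. by apply/funext => i; rewrite /zcoord coord_lattice intrKfloor. Qed.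

Lemma L_zcoord v : L v -> v = \sum_i (tnth bas i) *~ zcoord D v i.
Proof. by move=> /LP [m ->]; rewrite zcoordE. Qed.

Lemma LD u v : L u -> L v -> L (u + v).
Proof.
move=> /LP [m ->] /LP [p ->]; apply/LP; exists (fun i => m i + p i).
by rewrite -big_split; apply: eq_bigr => i _; rewrite mulrzDr.
Qed.
Lemma LN u : L u -> L (- u).
Proof.
move=> /LP [m ->]; apply/LP; exists (fun i => - m i).
by rewrite -sumrN; apply: eq_bigr => i _; rewrite mulrNz.
Qed.
Lemma L0 : L 0.
Proof. by apply/LP; exists (fun _ => 0); rewrite big1. Qed.
Lemma LB u v : L u -> L v -> L (u - v).
Proof. by move=> Lu Lv; apply/LD/LN. Qed.
Lemma Lz u (m : int) : L u -> L (u *~ m).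
Proof.
move=> /LP [p ->]; apply/LP; exists (fun i => p i * m).
by rewrite mulrz_suml; apply: eq_bigr => i _; rewrite mulrzA.
Qed.
Lemma Lmn u (m : nat) : L u -> L (u *+ m).
Proof. by move=> h; rewrite pmulrn; apply: Lz. Qed.
Lemma LZint u c : c \is a Num.int -> L u -> L (c *: u).
Proof. by move=> /intrP [m ->] h; rewrite scaler_int; apply: Lz. Qed.
Lemma L_sum I (s : seq I) (F : I -> V) : (forall i, L (F i)) -> L (\sum_(i <- s) F i).
Proof. by move=> h; apply: big_ind => //; [exact: L0|exact: LD]. Qed.
Lemma L_basis i : L (tnth bas i).
Proof.
apply/LP; exists (fun j => (j == i)%:R).
rewrite (bigD1 i) //= eqxx big1 ?addr0 // => j /negPf ->.
by rewrite mulr0z.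
Qed.

Lemma zcoordD u v i : L u -> L v -> zcoord D (u + v) i = zcoord D u i + zcoord D v i.
Proof.
move=> /LP [m ->] /LP [p ->]; rewrite !zcoordE.
rewrite -big_split /=.
under eq_bigr do rewrite -mulrzDr.
by rewrite zcoordE.
Qed.

Lemma zcoord0 i : zcoord D 0 i = 0.
Proof. by apply: (@addrI _ (zcoord D 0 i)); rewrite -zcoordD ?addr0 //; exact: L0. Qed.

Lemma zcoord_inj u v : L u -> L v -> (forall i, zcoord D u i = zcoord D v i) -> u = v.
Proof. by move=> Lu Lv h; rewrite (L_zcoord Lu) (L_zcoord Lv); apply: eq_bigr => i _; rewrite h. Qed.

Section Monomial.
Context (F : fieldType) (x : 'I_n -> F).
Hypothesis x0 : forall i, x i != 0.

Lemma monomialD u v : L u -> L v -> monomial D x (u + v) = monomial D x u * monomial D x v.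
Proof.
move=> Lu Lv; rewrite /monomial -big_split; apply: eq_bigr => i _.
by rewrite zcoordD // expfzDr.
Qed.
Lemma monomial0 : monomial D x 0 = 1.
Proof. by rewrite /monomial big1 // => i _; rewrite zcoord0 expr0z. Qed.
Lemma monomial_neq0 u : monomial D x u != 0.
Proof. by apply/prodf_neq0 => i _; rewrite expfz_neq0. Qed.
Lemma monomialN u : L u -> monomial D x (- u) = (monomial D x u)^-1.
Proof.
move=> Lu; apply: (mulfI (monomial_neq0 u)).
by rewrite -monomialD ?subrr ?monomial0 ?divff ?monomial_neq0 //; exact: LN.
Qed.
Lemma monomialz u (m : int) : L u -> monomial D x (u *~ m) = monomial D x u ^ m.
Proof.
move=> Lu; have mX (p : nat) : monomial D x (u *+ p) = monomial D x u ^+ p.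
  elim: p => [|p IH]; first by rewrite monomial0.
  by rewrite mulrS monomialD ?IH ?exprS //; exact: Lmn.
case: m => p; first by rewrite -pmulrn mX.
by rewrite NegzE mulrNz -pmulrn monomialN ?mX; [|exact: Lmn].
Qed.
Lemma monomial_sum I (s : seq I) (u : I -> V) (m : I -> int) : (forall i, L (u i)) ->
  monomial D x (\sum_(i <- s) u i *~ m i) = \prod_(i <- s) monomial D x (u i) ^ m i.
Proof.
move=> Lu; elim: s => [|i s IH]; first by rewrite !big_nil monomial0.
rewrite !big_cons monomialD ?IH ?monomialz //; first exact: Lz.
by apply: L_sum => j; exact: Lz.
Qed.
End Monomial.
End Lattice.

(** * Roots of a duality datum *)

Section IrreducibleDatum.
Context {R : realType} {V : vectType R} (ip : {dot V for idfun}).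

Lemma rspan_orth (X : set V) v y :
  rspan X v -> (forall x, X x -> ip x y = 0) -> ip v y = 0.
Proof.
move=> [s [sX vs]] h; have := vs; rewrite -[s]/(val (in_tuple s)) => /coord_span ->.
rewrite ip_suml big1 // => i _; rewrite ipZl h ?mulr0 //.
by apply: sX; rewrite mem_nth.
Qed.

Lemma rspan_sub (X : set V) x : X x -> rspan X x.
Proof.
move=> Xx; exists [:: x]; split; last by rewrite memv_span ?mem_head.
by move=> y; rewrite inE => /eqP ->.
Qed.

Lemma zspan_sub (X : set V) x (m : int) : X x -> zspan X (x *~ m).
Proof.
move=> Xx; exists [:: (m, x)]; split; last by rewrite big_seq1.
by move=> y; rewrite inE => /eqP ->.
Qed.

Lemma zspan_ind (X : set V) (P : V -> Prop) :
  P 0 -> (forall u v, P u -> P v -> P (u + v)) ->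
  (forall x (m : int), X x -> P (x *~ m)) -> forall v, zspan X v -> P v.
Proof.
move=> P0 PD PX v [s [sX ->]]; elim: s sX => [|t s IH] sX; rewrite ?big_nil //.
rewrite big_cons; apply: PD; first by apply: PX; apply: sX; rewrite mem_head.
by apply: IH => u us; apply: sX; rewrite inE us orbT.
Qed.

(** With [eps] orthonormal, roots of squared length 2 are their own coroots and [2 eps_i] has coroot
    [eps_i]. Hence every root is an integral multiple of its coroot and coroots pair integrally with
    each other; the lattice spanned by the coroots requires both. *)
Lemma typeC_norm n (eps : 'I_n -> V) al :
  (forall i j, ip (eps i) (eps j) = (i == j)%:R) -> typeC_roots eps al ->
  (ip al al = 4 \/ ip al al = 2) /\
  exists i j (x y : int), coroot ip al = eps i *~ x + eps j *~ y.
Proof.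
move=> ho.
have short (i j : 'I_n) (x y : int) be : (i < j)%N -> x ^+ 2 = 1 -> y ^+ 2 = 1 ->
    be = eps i *~ x + eps j *~ y ->
    (ip be be = 4 \/ ip be be = 2) /\ exists i j (x y : int), coroot ip be = eps i *~ x + eps j *~ y.
  move=> ij hx hy ->.
  have hX : (x%:~R : R) ^+ 2 = 1 by rewrite -rmorphXn hx.
  have hY : (y%:~R : R) ^+ 2 = 1 by rewrite -rmorphXn hy.
  have h : ip (eps i *~ x + eps j *~ y) (eps i *~ x + eps j *~ y) = 2.
    rewrite -[eps i *~ x]scaler_int -[eps j *~ y]scaler_int !(ipDl, ipDr, ipZl, ipZr) !ho !eqxx [j == i]eq_sym.
    have -> : (i == j) = false by apply/negbTE; rewrite neq_ltn ij.
    by rewrite !mulr0 addr0 add0r !mulr1 -!expr2 hX hY.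
  split; [by right|exists i, j, x, y; by rewrite {1}/coroot h divff ?scale1r ?pnatr_eq0].
case=> [[i0]|[i [j [ij]]]]; last first.
  by case=> e; [apply: (short i j 1 1)|apply: (short i j 1 (-1))|apply: (short i j (-1) 1)
    |apply: (short i j (-1) (-1))]; rewrite // e ?mulrN1z ?mulr1z.
have h1 : ip (eps i0) (eps i0) = 1 by rewrite ho eqxx.
have hc : coroot ip (eps i0 *+ 2) = eps i0.
  by rewrite -scaler_nat corootZ ?pnatr_eq0 // /coroot h1 divr1 scalerA mulVf ?scale1r ?pnatr_eq0.
have hn : ip (eps i0 *+ 2) (eps i0 *+ 2) = 4.
  by rewrite mulr2n !(ipDl, ipDr) h1; ring.
case=> ->; split; rewrite ?ipNl ?ipNr ?opprK ?hn; try by left.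
  by exists i0, i0, 1, 0; rewrite mulr0z addr0 mulr1z.
exists i0, i0, (-1), 0; rewrite mulr0z addr0 mulrN1z -scaleN1r corootZ ?oppr_eq0 ?oner_eq0 //.
by rewrite hc invrN invr1 scaleN1r.
Qed.

Lemma coroots_orth (Rt : set V) y :
  (forall x, Rt x -> ip x y = 0) -> forall x, coroots ip Rt x -> ip x y = 0.
Proof. by move=> h x [al ral <-]; rewrite ipZl h ?mulr0. Qed.

Lemma refl_corootE al be : ip (refl ip al be) (refl ip al be) = ip be be ->
  coroot ip (refl ip al be) = refl ip al (coroot ip be).
Proof. by move=> h; rewrite /coroot h linearZ. Qed.

Variables (S : set (V * R)) (Rt L L' : set V).
Hypothesis HI : irreducible_datum ip S Rt L L'.

Let rs : root_system ip Rt. Proof. by case: HI. Qed.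
Let rt0 : forall al, Rt al -> al != 0.
Proof. by case: rs => _ h _ _ al ral; apply/eqP => e; apply: h; rewrite -e. Qed.

(** A form shared by the three families: the constant term is an integer times the very factor that
    carries a root to the gradient. The later finiteness and discreteness arguments rest on it. *)
Lemma irred_affine_root a : S a ->
  exists al (m : int), Rt al /\
   (a = (al, m%:~R) \/ a = (coroot ip al, 2 / ip al al * m%:~R)).
Proof.
have H1 b : affine_roots Rt b -> exists (al : V) (m : int), Rt al /\
   (b = (al, m%:~R) \/ b = (coroot ip al, 2 / ip al al * m%:~R)).
  by case: b => v r [/= rv /intrP [m ->]]; exists v, m; split => //; left.
have H2 b : acoroots ip (affine_roots Rt) b -> exists (al : V) (m : int), Rt al /\
   (b = (al, m%:~R) \/ b = (coroot ip al, 2 / ip al al * m%:~R)).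
  by case=> -[v r] [/= rv /intrP [m ->]] <-; exists v, m; split => //; right.
case: HI => _ _ _ [[-> _ _]|[-> _ _]|[n [eps [_ _ _ -> _]]]]; [exact: H1|exact: H2|].
by case; [exact: H1|exact: H2].
Qed.

Lemma irred_gradient a : S a -> exists al c, [/\ Rt al, 0 < c & a.1 = c *: al].
Proof.
move=> /irred_affine_root [al [m [ral [->|->]]]] /=.
  by exists al, 1; rewrite scale1r.
exists al, (2 / ip al al); split => //; by rewrite divr_gt0 // ip_gt0 ?rt0.
Qed.

Lemma irred_refl a al : S a -> Rt al -> S (refl ip al a.1, a.2).
Proof.
move=> Sa ral; case: rs => _ _ hr _.
have H1 : affine_roots Rt a -> affine_roots Rt (refl ip al a.1, a.2).
  by case=> h1 h2; split => //=; apply: hr.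
have H2 : acoroots ip (affine_roots Rt) a ->
    acoroots ip (affine_roots Rt) (refl ip al a.1, a.2).
  case=> -[v r] [/= rv hm] <-; exists (refl ip al v, r); first by split => //=; apply: hr.
  by rewrite /acoroot /= refl_corootE ?refl_isom.
case: HI Sa => _ _ _ [[-> _ _]|[-> _ _]|[n [eps [_ _ _ -> _]]]]; [exact: H1|exact: H2|].
by case; [left; exact: H1|right; exact: H2].
Qed.

Lemma irred_L_orth la y : L la -> (forall x, Rt x -> ip x y = 0) -> ip la y = 0.
Proof.
move=> + h.
case: HI => _ _ _ [[_ -> _]|[_ -> _]|[n [eps [_ _ _ _ [-> _]]]]].
- by case=> hs _; apply: rspan_orth hs _.
- by case=> hs _; apply: rspan_orth hs _; apply: coroots_orth.
move=> hla; apply: (@zspan_ind _ (fun la => ip la y = 0) _ _ _ _ hla) => [|u v hu hv|x m /(coroots_orth h) hx].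
- by rewrite ip0l.
- by rewrite ipDl hu hv addr0.
by rewrite -scaler_int ipZl hx mulr0.
Qed.

Lemma irred_gradient_L a : S a -> L a.1.
Proof.
case: (rs) => _ _ _ hi.
case: HI => _ _ _ [[-> -> _]|[-> -> _]|[n [eps [_ ho Re -> [-> _]]]]].
- by case=> ra _; split; [exact: rspan_sub|move=> al ral; apply: hi].
- case=> -[v r] [/= rv hm] <- /=; split; first by apply: rspan_sub; exists v.
  move=> _ [be rbe <-]; rewrite corootK ?rt0 // ipC.
  exact: hi.
case=> [[rv _]|[[v r] [/= rv _] <-]] /=; last first.
  by rewrite -[coroot ip v]mulr1z; apply: zspan_sub; exists v.
(* A root is half its squared length times its coroot; in type C this factor is 1 or 2. *)
have ca : a.1 = (ip a.1 a.1 / 2) *: coroot ip a.1.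
  have h := ip_neq0 ip (rt0 rv); rewrite scalerA -[LHS]scale1r; congr (_ *: _).
  by field.
have [c ec] : exists c : int, ip a.1 a.1 / 2 = c%:~R.
  have := rv; rewrite Re => /(typeC_norm ho) [[->|->] _]; [exists 2|exists 1]; lra.
rewrite ca ec scaler_int; apply: zspan_sub.
by exists a.1.
Qed.

Lemma irred_integral a la : S a -> L la -> ip la (coroot ip a.1) \is a Num.int.
Proof.
case: (rs) => _ _ _ hi.
case: HI => _ _ _ [[-> -> _]|[-> -> _]|[n [eps [_ ho Re -> [-> _]]]]].
- by case=> ra _ [_]; apply.
- case=> -[v r] [/= rv hm] <- /= [_ hl].
  by apply: hl; exists v.
move=> Sa hla; pose P (u : V) := is_true (ip u (coroot ip a.1) \is a Num.int).
apply: (@zspan_ind _ P _ _ _ _ hla) => [|u v hu hv|x0 m [be rbe <-]].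
- by rewrite /P ip0l rpred0.
- by rewrite /P ipDl rpredD.
rewrite /P -scaler_int ipZl rpredM ?intr_int //.
case: Sa => [[rv _]|[[v r] [/= rv _] <-]] /=; last by rewrite corootK ?rt0 // ipC hi.
have hbe : typeC_roots eps be by rewrite -Re.
have hav : typeC_roots eps a.1 by rewrite -Re.
clear m; have [_ [i [j [m [y ->]]]]] := typeC_norm ho hbe.
have [_ [i' [j' [x' [y' ->]]]]] := typeC_norm ho hav.
have hI (c d : int) p q : ip (eps p *~ c) (eps q *~ d) \is a Num.int.
  by rewrite -[eps p *~ c]scaler_int -[eps q *~ d]scaler_int ipZl ipZr ho; rewrite rpredM ?intr_int // rpredM ?intr_int ?natr_int.
rewrite ipDl; apply: rpredD; rewrite ipDr; apply: rpredD; exact: hI.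
Qed.

Lemma irred_linear_root al : Rt al -> exists2 c, 0 < c & S (c *: al, 0).
Proof.
move=> ral; have al0 := rt0 ral.
have H1 : affine_roots Rt (1 *: al, 0) by rewrite scale1r; split => //=; rewrite rpred0.
have H2 : acoroots ip (affine_roots Rt) ((2 / ip al al) *: al, 0).
  by exists (al, 0); rewrite /acoroot /= ?mulr0 //; split => //=; rewrite rpred0.
have c0 : 0 < 2 / ip al al by rewrite divr_gt0 // ip_gt0.
case: HI => _ _ _ [[-> _ _]|[-> _ _]|[n [eps [_ _ _ -> _]]]].
- by exists 1.
- by exists (2 / ip al al).
by exists 1 => //; left.
Qed.

Lemma irred_L'0 : L' 0.
Proof.
have W (X : set V) : weight_lattice ip X 0.
  by split; [exists [::]; split => //; rewrite mem0v|move=> al _; rewrite ip0l rpred0].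
case: HI => _ _ _ [[_ _ ->]|[_ -> ->]|[n [eps [_ _ _ _ [-> ->]]]]].
- exact: W.
- exact: W.
by exists [::]; rewrite big_nil.
Qed.

End IrreducibleDatum.

Section RootFacts.
Context {R : realType} {V : vectType R} (D : data V).
Hypothesis HD : duality_data D.
Local Notation ip := (dip D).
Local Notation L := (dL D).
Local Notation S := (dS D).
Local Notation Rt := (dR D).

Lemma roots_finite : finite_set Rt.
Proof.
have [[m [Sj [Rj [Lj [L'j [hI ho hS -> _]]]]]] _ _ _] := HD.
apply: bigcup_finite => // j _.
by have [[]] := hI j.
Qed.

Lemma root_neq0 al : Rt al -> al != 0.
Proof.
have [[m [Sj [Rj [Lj [L'j [hI ho hS -> _]]]]]] _ _ _] := HD.
move=> [j _ raj]; apply/eqP => e.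
by have [[_ h _ _] _ _ _] := hI j; apply: h; rewrite -e.
Qed.

Lemma root_refl al be : Rt al -> Rt be -> Rt (refl ip al be).
Proof.
have [[m [Sj [Rj [Lj [L'j [hI ho hS -> _]]]]]] _ _ _] := HD.
move=> [i _ rai] [j _ rbj]; have [ij|ij] := eqVneq i j.
  exists j => //; have [[_ _ h _] _ _ _] := hI j.
  by apply: h; rewrite // -ij.
by exists j => //; rewrite refl_orth // ipC; exact: (ho i j).
Qed.

Lemma root_int al be : Rt al -> Rt be -> ip be (coroot ip al) \is a Num.int.
Proof.
have [[m [Sj [Rj [Lj [L'j [hI ho hS -> _]]]]]] _ _ _] := HD.
move=> [i _ rai] [j _ rbj]; have [ij|ij] := eqVneq i j.
  have [[_ _ _ h] _ _ _] := hI j.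
  by apply: h; rewrite // -ij.
by rewrite ipZr [ip be al]ipC (ho i j ij _ _ rai rbj) mulr0 rpred0.
Qed.

Lemma root_reduced al (c : R) : Rt al -> Rt (c *: al) -> c = 1 \/ c = -1.
Proof.
move=> ral rcal; have al0 := root_neq0 ral; have cal0 := root_neq0 rcal.
have [[m [Sj [Rj [Lj [L'j [hI ho hS hR _]]]]]] _ _ _] := HD.
move: ral rcal; rewrite hR.
move=> [i _ rai] [j _ rbj]; have [ij|ij] := eqVneq i j.
  by have [_ h _ _] := hI j; apply: (h al); rewrite // -ij.
have := ho i j ij _ _ rai rbj; rewrite ipZr => /eqP; rewrite mulf_eq0 (negPf (ip_neq0 ip al0)) orbF.
by move=> /eqP c0; rewrite c0 scale0r eqxx in cal0.
Qed.

Lemma S_affine_root a : S a -> exists al (m : int), Rt al /\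
   (a = (al, m%:~R) \/ a = (coroot ip al, 2 / ip al al * m%:~R)).
Proof.
have [[m [Sj [Rj [Lj [L'j [hI ho -> -> _]]]]]] _ _ _] := HD.
move=> [j _ Sa]; have [al [p [ral h]]] := irred_affine_root (hI j) Sa.
by exists al, p; split => //; exists j.
Qed.

Lemma S_gradient a : S a -> exists al c, [/\ Rt al, 0 < c & a.1 = c *: al].
Proof.
have [[m [Sj [Rj [Lj [L'j [hI ho -> -> _]]]]]] _ _ _] := HD.
move=> [j _ Sa]; have [al [p [ral h1 h2]]] := irred_gradient (hI j) Sa.
by exists al, p; split => //; exists j.
Qed.

Lemma S_neq0 a : S a -> a.1 != 0.
Proof.
move=> /S_gradient [al [c [ral c0 ->]]].
by rewrite scaler_eq0 negb_or gt_eqF ?root_neq0.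
Qed.

Lemma S_refl_root a al : S a -> Rt al -> S (refl ip al a.1, a.2).
Proof.
have [[m [Sj [Rj [Lj [L'j [hI ho -> -> _]]]]]] _ _ _] := HD.
move=> [j _ Saj] [i _ rai]; exists j => //.
have [ij|ij] := eqVneq i j.
  by apply: (irred_refl (hI j)); rewrite // -ij.
have [be [c [rbe _ e]]] := irred_gradient (hI j) Saj.
rewrite refl_orth -?surjective_pairing // e ipZl ipC (ho i j ij _ _ rai rbe) mulr0 //.
Qed.

Lemma S_L a : S a -> L a.1.
Proof.
have lat0 := L0 HD; have latD := LD HD.
have [[m [Sj [Rj [Lj [L'j [hI ho -> hR [hL _]]]]]]] _ _ _] := HD.
move=> [j _ Saj]; have h := irred_gradient_L (hI j) Saj.
have [m0 hm0] : sum_sets Lj 0 by rewrite -hL.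
have L0j i : Lj i 0.
  case: (hI i) => _ _ _ [[_ -> _]|[_ -> _]|[p [eps [_ _ _ _ [-> _]]]]].
  - by split; [exists [::]; split => //; rewrite mem0v|move=> al _; rewrite ip0l rpred0].
  - by split; [exists [::]; split => //; rewrite mem0v|move=> al _; rewrite ip0l rpred0].
  by exists [::]; rewrite big_nil.
rewrite hL; exists (fun i => if i == j then a.1 else 0); split.
  by move=> i; case: eqP => [->|].
by rewrite (bigD1 j) //= eqxx big1 ?addr0 // => i /negPf ->.
Qed.

Lemma S_int a la : S a -> L la -> ip la (coroot ip a.1) \is a Num.int.
Proof.
have [[m [Sj [Rj [Lj [L'j [hI ho -> hR [-> _]]]]]]] _ _ _] := HD.
move=> [j _ Saj] [l [hl ->]]; rewrite ip_suml (bigD1 j) //= big1 ?addr0.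
  exact: (irred_integral (hI j)).
move=> i ij; apply: (irred_L_orth (hI i) (hl i)) => x rx.
have [be [c [rbe _ ->]]] := irred_gradient (hI j) Saj.
by rewrite !ipZr (ho i j ij _ _ rx rbe) !mulr0.
Qed.

Lemma S_linear_root al : Rt al -> exists2 c, 0 < c & S (c *: al, 0).
Proof.
have [[m [Sj [Rj [Lj [L'j [hI ho -> -> _]]]]]] _ _ _] := HD.
by move=> [j _ ra]; have [c c0 h] := irred_linear_root (hI j) ra; exists c => //; exists j.
Qed.

Lemma L'0 : dL' D 0.
Proof.
have [[m [Sj [Rj [Lj [L'j [hI ho hS hR [_ ->]]]]]]] _ _ _] := HD.
exists (fun _ => 0); split; last by rewrite big1.
by move=> j; exact: (irred_L'0 (hI j)).
Qed.

Lemma root_span v : rspan Rt v.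
Proof. by have [_ -> _ _] := HD. Qed.

End RootFacts.

(** * The Weyl group *)

Lemma count_lt (T : eqType) (p r : pred T) (s : seq T) x :
  {subset p <= r} -> x \in s -> r x -> ~~ p x -> (count p s < count r s)%N.
Proof.
move=> pr + rx px; elim: s => //= y s IH; rewrite inE => /orP [/eqP <-|/IH h].
  rewrite rx (negPf px) add0n add1n ltnS; apply: sub_count; exact: pr.
have [py|] := boolP (p y); last by rewrite add0n => _; exact: ltn_addl.
by rewrite (pr _ py : r y) ltn_add2l.
Qed.

(** The Gram identity [|u - c v|^2 |v|^2 = |u|^2 |v|^2 - <u, v>^2] with [c = <u, v> / |v|^2] gives
    the inequality and its equality case together. *)
Lemma ip_CS (R : realType) (V : vectType R) (ip : {dot V for idfun}) u v :
  ip u v ^+ 2 <= ip u u * ip v v /\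
  (ip u v ^+ 2 = ip u u * ip v v -> v != 0 -> exists c, u = c *: v).
Proof.
have [->|v0] := eqVneq v 0; first by rewrite !ip0r expr0n mulr0.
have h := ip_neq0 ip v0; have hp := ip_gt0 ip v0.
pose c := ip u v / ip v v.
have e : ip (u - c *: v) (u - c *: v) * ip v v = ip u u * ip v v - ip u v ^+ 2.
  by rewrite !(ipBl, ipBr, ipZl, ipZr) (ipC _ v u) /c; field.
have [d0|d0] := eqVneq (u - c *: v) 0.
  move: e; rewrite d0 ip0l mul0r => e; split; first by rewrite -subr_ge0 -e.
  by exists c; apply/eqP; rewrite -subr_eq0 d0.
have := mulr_gt0 (ip_gt0 ip d0) hp; rewrite e subr_gt0 => l.
by split; [exact: ltW|move=> E; rewrite E ltxx in l].
Qed.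

Section WeylGroup.
Context {R : realType} {V : vectType R} (D : data V).
Hypothesis HD : duality_data D.
Local Notation ip := (dip D).
Local Notation L := (dL D).
Local Notation S := (dS D).
Local Notation Rt := (dR D).
Local Notation Rp := (dRp D).
Local Notation simple := (simple_roots D).
Local Notation W0 := (W0 D).

Lemma root_opp al : Rt al -> Rt (- al).
Proof. by move=> ra; rewrite -(refl_self ip (root_neq0 HD ra)); apply: root_refl. Qed.

Lemma positive_vector : exists x0 : V,
  (forall al, Rt al -> ip al x0 != 0) /\ (forall al, Rp al <-> Rt al /\ 0 < ip al x0).
Proof. by have [_ _ [x [h1 ->]] _] := HD; exists x. Qed.

Lemma Rp_root al : Rp al -> Rt al.
Proof. by have [x [_ h]] := positive_vector; rewrite h => -[]. Qed.

Lemma simple_root al : simple al -> Rt al.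
Proof. by case=> /Rp_root. Qed.

Lemma root_pos_or_neg al : Rt al -> Rp al \/ Rp (- al).
Proof.
have [x [h0 h]] := positive_vector => ra; rewrite !h.
have := h0 _ ra; rewrite neq_lt => /orP [l|l]; [right|left] => //.
by split; [exact: root_opp|rewrite ipNl oppr_gt0].
Qed.

Lemma word_prod_cat s t : word_prod D (s ++ t) = (word_prod D s \o word_prod D t)%VF.
Proof.
elim: s => [|a s IH] /=; first by rewrite comp_lfun1l.
by rewrite IH comp_lfunA.
Qed.

Lemma word_prod_rev s : cancel (word_prod D s) (word_prod D (rev s)).
Proof.
elim: s => [|a s IH] x /=; first by rewrite /rev /= !id_lfunE.
by rewrite rev_cons -cats1 word_prod_cat /= comp_lfun1r !comp_lfunE reflK IH.
Qed.

Lemma W0_1 : W0 \1%VF.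
Proof. by exists [::]. Qed.

Lemma W0_comp v w : W0 v -> W0 w -> W0 (v \o w)%VF.
Proof.
move=> [s hs ->] [t ht ->]; exists (s ++ t); last by rewrite word_prod_cat.
by move=> al; rewrite mem_cat => /orP [/hs|/ht].
Qed.

Lemma W0_inv w : W0 w -> exists w', [/\ W0 w', cancel w w' & cancel w' w].
Proof.
move=> [s hs ->]; exists (word_prod D (rev s)); split.
- by exists (rev s) => // al; rewrite mem_rev; exact: hs.
- exact: word_prod_rev.
by rewrite -{2}[s]revK; exact: word_prod_rev.
Qed.

Lemma W0_inj w : W0 w -> injective w.
Proof. by move=> /W0_inv [w' [_ h _]]; exact: can_inj h. Qed.

Lemma W0_simple_refl al : simple al -> W0 (refl ip al).
Proof.
move=> sa; exists [:: al]; first by move=> be; rewrite inE => /eqP ->.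
by rewrite /= comp_lfun1r.
Qed.

Lemma W0_ind (P : 'End(V) -> Prop) :
  P \1%VF -> (forall al w, simple al -> P w -> P (refl ip al \o w)%VF) ->
  forall w, W0 w -> P w.
Proof.
move=> P1 PS _ [s hs ->]; elim: s hs => //= al s IH hs.
by apply: PS; [apply: hs; rewrite mem_head|apply: IH => be bs; apply: hs; rewrite inE bs orbT].
Qed.

Lemma W0_isom w x y : W0 w -> ip (w x) (w y) = ip x y.
Proof.
move=> hw; move: w hw x y; apply: W0_ind => [x y|al w _ IH x y]; first by rewrite !id_lfunE.
by rewrite !comp_lfunE refl_isom IH.
Qed.

Lemma W0_root w al : W0 w -> Rt al -> Rt (w al).
Proof.
move=> hw; move: w hw al; apply: W0_ind => [x hx|al w sa IH x h]; first by rewrite id_lfunE.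
by rewrite !comp_lfunE; apply: root_refl => //; [exact: simple_root|exact: IH].
Qed.

Lemma S_W0 w a : W0 w -> S a -> S (w a.1, a.2).
Proof.
move=> hw; move: w hw a; apply: W0_ind => [[u r] h|al w sa IH a h]; first by rewrite id_lfunE.
rewrite !comp_lfunE; apply: (S_refl_root HD (a := (w a.1, a.2)) (IH _ h)).
exact: simple_root.
Qed.

Lemma coroot_W0 w v : W0 w -> coroot ip (w v) = w (coroot ip v).
Proof. by move=> hw; rewrite /coroot W0_isom // linearZ. Qed.

Lemma refl_conj w v x : W0 w -> refl ip (w v) (w x) = w (refl ip v x).
Proof. by move=> hw; rewrite !reflE coroot_W0 // W0_isom // [in RHS]linearB [in RHS]linearZ. Qed.

Lemma L_refl_S a la : S a -> L la -> L (refl ip a.1 la).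
Proof.
move=> Sa hl; rewrite reflE; apply: (LB HD hl); apply: (LZint HD); first exact: S_int.
exact: S_L.
Qed.

Lemma W0_L w la : W0 w -> L la -> L (w la).
Proof.
move=> hw; move: w hw la; apply: W0_ind => [x hx|al w sa IH x h]; first by rewrite id_lfunE.
rewrite !comp_lfunE.
have [c c0 Sc] := S_linear_root HD (simple_root sa).
have c0' : c != 0 by rewrite gt_eqF.
by rewrite -(reflZ ip al c0'); apply: (L_refl_S Sc); exact: IH.
Qed.

(** Heights [<al, x0>] are real numbers, so well-foundedness comes from finiteness: the number of
    roots of smaller height decreases. *)
Lemma root_height_ind (x0 : V) (P : V -> Prop) :
  (forall al, Rp al -> (forall be, Rp be -> ip be x0 < ip al x0 -> P be) -> P al) ->
  forall al, Rp al -> P al.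
Proof.
move=> H; have /finite_seqP [s hs] := roots_finite HD.
pose N al := count (fun be => ip be x0 < ip al x0) s.
move=> al; have [p] := ubnP (N al); elim: p al => // p IH al hN ra.
apply: H => // be rb lt; apply: IH => //.
rewrite ltnS in hN; apply: leq_trans hN.
apply: (@count_lt _ _ _ _ be) => //; rewrite ?ltxx //.
  by move=> ga; rewrite /in_mem /= => l; exact: lt_trans lt.
by have := Rp_root rb; rewrite hs.
Qed.

Lemma pos_root_sum al : Rp al ->
  exists s : seq V, (forall be, be \in s -> simple be) /\ al = \sum_(be <- s) be.
Proof.
have [x0 [_ hp]] := positive_vector.
move: al; apply: (root_height_ind (x0 := x0)) => al ra IH.
have [sa|ns] := pselect (simple al).
  exists [:: al]; rewrite big_seq1; split => // be.
  by rewrite inE => /eqP ->.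
have [be [ga [rb rg e]]] : exists be ga, [/\ Rp be, Rp ga & al = be + ga].
  by apply: contrapT => h; apply: ns.
have pb : 0 < ip be x0 by case/hp: rb.
have pg : 0 < ip ga x0 by case/hp: rg.
have [|s [hs es]] := IH be rb; first by rewrite e ipDl ltrDl.
have [|t [ht et]] := IH ga rg; first by rewrite e ipDl ltrDr.
exists (s ++ t); split; last by rewrite big_cat /= -es -et.
by move=> v; rewrite mem_cat => /orP [/hs|/ht].
Qed.

(* Otherwise [m s - al] is positive, where [m] is the integer [<al, s^vee>]; as
   [m * <s, al^vee> < 4], in each case [s] is a sum of two positive roots. *)
Lemma simple_refl_pos s al : simple s -> Rp al -> al <> s -> 0 < ip al s ->
  Rp (refl ip s al).
Proof.
move=> ss ra nas hpos; have rs := simple_root ss; have ral := Rp_root ra.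
have indec be ga : Rp be -> Rp ga -> s = be + ga -> False.
  by move=> rb rg e; case: ss => _; apply; exists be, ga.
have [//|neg] := root_pos_or_neg (root_refl HD rs ral); exfalso.
have s0 := root_neq0 HD rs; have a0 := root_neq0 HD ral.
have hs := ip_gt0 ip s0; have ha := ip_gt0 ip a0.
have /intrP [m em] := root_int HD rs ral.
have /intrP [m' em'] := root_int HD ral rs.
have rm : (m%:~R : R) = 2 / ip s s * ip al s by rewrite -em ipZr.
have rm' : (m'%:~R : R) = 2 / ip al al * ip al s by rewrite -em' ipZr ipC.
have m0 : (0 < m)%R by rewrite -(ltr0z R) rm mulr_gt0 // divr_gt0.
have m'0 : (0 < m')%R by rewrite -(ltr0z R) rm' mulr_gt0 // divr_gt0.
have [cs ceq] := ip_CS ip al s.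
have lt4 : (m * m' < 4)%R.
  rewrite -(ltr_int R) rmorphM /= rm rm'.
  have -> : 2 / ip s s * ip al s * (2 / ip al al * ip al s) =
     4 * (ip al s ^+ 2 / (ip al al * ip s s)) by field; rewrite !gt_eqF.
  rewrite gtr_pMr // ltr_pdivrMr ?mulr_gt0 // mul1r lt_neqAle cs andbT.
  apply/eqP => E; have [c ec] := ceq E s0.
  have [c1|c1] := root_reduced HD rs (c := c) (eq_ind _ Rt ral _ ec).
    by apply: nas; rewrite ec c1 scale1r.
  by move: hpos; rewrite ec c1 scaleN1r ipNl oppr_gt0 ltNge ltW.
have rb : Rp (s *~ m - al).
  by move: neg; rewrite reflE em scaler_int opprB.
have [m1|[m'1 m23]] : m = 1 \/ m' = 1 /\ (m = 2 \/ m = 3) by nia.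
  by apply: (indec al (s *~ m - al)) => //; rewrite m1 mulr1z addrC subrK.
have := root_refl HD ral rs; rewrite reflE em' m'1 scale1r => rsa.
have [rsa'|] := root_pos_or_neg rsa.
  by apply: (indec _ _ ra rsa'); rewrite addrC subrK.
rewrite opprB => rg.
case: m23 => m2.
  by apply: (indec _ _ rb rg); rewrite m2 -[s *~ 2]/(s *+ 2) mulr2n addrA subrK addrK.
have := root_refl HD rs (Rp_root rg); rewrite reflE ipBl em m2 ip_coroot_self //.
have -> : (3%:~R : R) - 2 = 1 by ring.
rewrite scale1r => rgs.
have [rgs'|] := root_pos_or_neg rgs; last rewrite opprB => rgs'.
  apply: (indec _ _ rb rgs'); rewrite m2.
  have -> : s *~ 3 = s + s + s by rewrite -[s *~ 3]/(s *+ 3) !mulrS mulr0n addr0 addrA.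
  by rewrite addrA addrA subrK !addrK.
by apply: (indec _ _ rg rgs'); rewrite addrC subrK.
Qed.

(** As [<al, al> > 0], some simple root occurring in [al] has positive product with it; reflecting
    in that root keeps [al] positive and lowers its height. This puts the reflections in all roots
    into the group generated by the simple ones. *)
Lemma pos_root_conj al : Rp al -> exists w be, [/\ W0 w, simple be & al = w be].
Proof.
have [x0 [_ hp]] := positive_vector.
move: al; apply: (root_height_ind (x0 := x0)) => al ra IH.
have [sa|ns] := pselect (simple al).
  by exists \1%VF, al; split => //; [exact: W0_1|rewrite id_lfunE].
have a0 := root_neq0 HD (Rp_root ra).
have [s [hs es]] := pos_root_sum ra.
have [be bs hb] : exists2 be, be \in s & 0 < ip be al.
  apply: contrapT => h; have := ip_gt0 ip a0; rewrite {1}es ip_suml ltNge.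
  move/negP; apply; rewrite big_seq; apply: sumr_le0 => be bs.
  by rewrite leNgt; apply/negP => l; apply: h; exists be.
have sb := hs _ bs; have nab : al <> be by move=> e; apply: ns; rewrite e.
rewrite ipC in hb.
have r' := simple_refl_pos sb ra nab hb.
have pb : 0 < ip be x0 by case: sb => /hp [].
have [|w [ga [hw sg e]]] := IH _ r'.
  rewrite reflE ipBl ltrBlDr ltrDl ipZl mulr_gt0 // ipZr mulr_gt0 //.
  by rewrite divr_gt0 // ip_gt0 // (root_neq0 HD) //; exact: simple_root.
exists (refl ip be \o w)%VF, ga; split => //.
  by apply: W0_comp => //; exact: W0_simple_refl.
by rewrite comp_lfunE -e reflK.
Qed.

Lemma W0_refl_root al : Rt al -> W0 (refl ip al).
Proof.
have H be : Rp be -> W0 (refl ip be).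
  move=> /pos_root_conj [w [ga [hw sg ->]]].
  have [w' [hw' h1 h2]] := W0_inv hw.
  have -> : refl ip (w ga) = (w \o (refl ip ga \o w'))%VF.
    by apply/lfunP => x; rewrite !comp_lfunE -{1}[x]h2 refl_conj.
  by apply: W0_comp => //; apply: W0_comp => //; exact: W0_simple_refl.
by move=> /root_pos_or_neg [/H //|/H]; rewrite reflN.
Qed.

Lemma W0_refl_S a : S a -> W0 (refl ip a.1).
Proof.
move=> /(S_gradient HD) [al [c [ra c0 ->]]].
by rewrite reflZ ?gt_eqF //; exact: W0_refl_root.
Qed.

(** The roots span [V] and are permuted, so an element is determined by the finite function [f w]
    that records the images of the roots; [g] inverts [f] on its image. *)
Lemma W0_finite : finite_set W0.
Proof.
have /finite_seqP [s hs] := roots_finite HD.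
pose T := seq_sub s.
have ws w : W0 w -> forall t : T, w (val t) \in s.
  move=> hw t; have : Rt (val t) by rewrite hs /=; exact: (valP t).
  by move=> /(W0_root hw); rewrite hs.
pose f (w : 'End(V)) : {ffun T -> option T} := [ffun t => insub (w (val t))].
pose g phi := xget \1%VF [set w | W0 w /\ f w = phi].
apply: (@sub_finite_set _ _ (g @` setT)); last by apply: finite_image; exact: finite_finset.
move=> w hw; exists (f w) => //; rewrite /g; case: xgetP => [w' _ [hw' ef]|/(_ w)]; last by case.
apply/lfunP => x; have [l [lR lx]] := root_span HD x.
have := lx; rewrite -[l]/(val (in_tuple l)) => /coord_span ->.
rewrite !linear_sum; apply: eq_bigr => i _; rewrite !linearZ; congr (_ *: _).
have : l`_i \in l by rewrite mem_nth.
move=> /lR; rewrite hs /= => li.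
have := congr1 (fun h : {ffun T -> option T} => h (SeqSub li)) ef; rewrite !ffunE.
rewrite (insubT (fun v => v \in s) (ws _ hw (SeqSub li))).
rewrite (insubT (fun v => v \in s) (ws _ hw' (SeqSub li))).
by move=> [].
Qed.

End WeylGroup.

(** * Affine roots near the origin and the fundamental alcove *)

Section PositiveAffineRoots.
Context {R : realType} {V : vectType R} (D : data V).
Hypothesis HD : duality_data D.
Local Notation ip := (dip D).
Local Notation S := (dS D).
Local Notation Rt := (dR D).
Local Notation Rp := (dRp D).
Local Notation W0 := (W0 D).

(** Each [g] is the gradient of an arithmetic progression of roots together with the step of its
    constant terms. This is the source of the finite layers, of the gap above 0 and of the geometric
    series that bound [sigma]. *)
Lemma S_enum : exists G : seq (V * R), (forall g, g \in G -> 0 < g.2) /\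
  forall a, S a -> 0 <= a.2 -> exists g, g \in G /\ exists j : nat, a = (g.1, g.2 * j%:R).
Proof.
have /finite_seqP [s hs] := roots_finite HD.
exists ([seq (al, 1) | al <- s] ++ [seq (coroot ip al, 2 / ip al al) | al <- s]); split.
  move=> g; rewrite mem_cat => /orP [/mapP [al _ ->] //|/mapP [al als ->]] /=.
  by rewrite divr_gt0 // ip_gt0 // (root_neq0 HD) // hs.
move=> a /(S_affine_root HD) [al [m [ral [->|->]]]] /=.
  rewrite ler0z => m0; exists (al, 1); rewrite mem_cat map_f /=; last by rewrite hs in ral.
  by split => //; exists `|m|%N; rewrite mul1r natr_absz ger0_norm.
have c0 : 0 < 2 / ip al al by rewrite divr_gt0 // ip_gt0 // (root_neq0 HD).
rewrite pmulr_rge0 // ler0z => m0; exists (coroot ip al, 2 / ip al al).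
split; last by exists `|m|%N; rewrite natr_absz ger0_norm.
by rewrite mem_cat orbC map_f //; rewrite hs in ral.
Qed.

Lemma S_bounded_finite (B : R) : finite_set [set a | S a /\ 0 <= a.2 <= B].
Proof.
have [G [G0 hG]] := S_enum.
pose M := \sum_(g <- G) (Num.truncn (B / g.2)).+1.
apply: (@sub_finite_set _ _
  [set` [seq (g.1, g.2 * j%:R) | g <- G, j <- iota 0 M]]); last exact: finite_seq.
move=> a [Sa /andP [a0 aB]]; have [g [gG [j ea]]] := hG _ Sa a0.
rewrite /= ea; apply: (allpairs_f (fun (g : V * R) (j : nat) => (g.1, g.2 * j%:R))) => //.
rewrite mem_iota add0n /=; apply: (@leq_trans (Num.truncn (B / g.2)).+1); last first.
  by rewrite /M (big_rem g) //= leq_addr.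
have hj : j%:R <= B / g.2 by rewrite ler_pdivlMr ?G0 // mulrC; move: aB; rewrite ea.
by rewrite ltnS truncn_ge_nat // (le_trans _ hj).
Qed.

Section Alcove.
Variable x0 : V.
Hypothesis x0reg : forall al, Rt al -> ip al x0 != 0.
Hypothesis x0pos : forall al, Rp al <-> Rt al /\ 0 < ip al x0.

Lemma S_regular a : S a -> ip a.1 x0 != 0.
Proof.
move=> /(S_gradient HD) [al [c [ra c0 ->]]].
by rewrite ipZl mulf_neq0 ?x0reg // gt_eqF.
Qed.

(** Constant term and gradient carry the same scaling factor. After division by it a non-zero
    constant term has absolute value at least 1, and [u <= (1 + B)^-1] keeps [u <al, x0>] below 1
    for every root. *)
Lemma small_regular : exists2 t : R, 0 < t &
  forall a u, S a -> a.2 != 0 -> 0 < u <= t -> `|u * ip a.1 x0| < `|a.2|.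
Proof.
have /finite_seqP [s hs] := roots_finite HD.
pose B := \sum_(al <- s) `|ip al x0|.
have B0 : 0 <= B by apply: sumr_ge0.
exists (1 + B)^-1; first by rewrite invr_gt0; lra.
have key al u : Rt al -> 0 < u <= (1 + B)^-1 -> `|u * ip al x0| < 1.
  move=> ral /andP [u0 ut]; have : `|ip al x0| <= B.
    rewrite /B (big_rem al) /=; last by rewrite hs in ral.
    by rewrite lerDl; apply: sumr_ge0.
  move=> hB; rewrite normrM gtr0_norm //.
  apply: (@le_lt_trans _ _ ((1 + B)^-1 * B)); first by apply: ler_pM => //; exact: ltW.
  by rewrite mulrC ltr_pdivrMr; lra.
move=> a u /(S_affine_root HD) [al [m [ral hm]]] a20 hu; have := key _ _ ral hu.
have hm1 (z : int) : z != 0 -> 1 <= `|z%:~R : R|.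
  by move=> z0; rewrite -intr_norm ler1z; lia.
case: hm a20 => -> /=; first by rewrite intr_eq0 => /hm1 h1 h2; exact: lt_le_trans h2 h1.
have c0 : 0 < 2 / ip al al by rewrite divr_gt0 // ip_gt0 // (root_neq0 HD).
rewrite mulf_eq0 negb_or intr_eq0 => /andP [_ /hm1 h1] h2.
rewrite ipZl mulrCA; set c := 2 / _ in c0 *; rewrite (normrM c) (normrM c) (gtr0_norm c0) ltr_pM2l //.
exact: lt_le_trans h2 h1.
Qed.

(** The sign of [a] at [u x0] for all small [u > 0]: the constant term decides and the gradient
    breaks the tie. *)
Definition dominant_affine (a : V * R) : Prop := 0 < a.2 \/ (a.2 = 0 /\ 0 < ip a.1 x0).

Lemma aeval_sign : exists2 t : R, 0 < t &
  forall a u, S a -> 0 < u <= t ->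
   [/\ aeval ip a (u *: x0) != 0, dominant_affine a -> 0 < aeval ip a (u *: x0) &
      ~ dominant_affine a -> aeval ip a (u *: x0) < 0].
Proof.
have [t t0 ht] := small_regular; exists t => // a u Sa hu; have /andP [u0 ut] := hu.
rewrite /aeval ipZr /dominant_affine.
have [a20|a20] := eqVneq a.2 0.
  have := S_regular Sa; rewrite a20 addr0 neq_lt ltxx => /orP [l|l].
    have l' : u * ip a.1 x0 < 0 by rewrite pmulr_rlt0.
    by split; [rewrite lt_eqF|case=> // -[_]; rewrite ltNge ltW|].
  have l' : 0 < u * ip a.1 x0 by rewrite pmulr_rgt0.
  by split; [rewrite gt_eqF| |case; right].
have := ht _ _ Sa a20 hu; rewrite ltr_norml => /andP [h1 h2].
move: (a20); rewrite neq_lt => /orP [l|l].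
  rewrite (ltr0_norm l) opprK in h1 h2.
  have h : u * ip a.1 x0 + a.2 < 0 by lra.
  split; first by rewrite lt_eqF.
    by case=> [|[/eqP]]; [rewrite ltNge ltW|rewrite (negPf a20)].
  by [].
rewrite (gtr0_norm l) in h1 h2.
have h : 0 < u * ip a.1 x0 + a.2 by lra.
by split=> //; [rewrite gt_eqF|case; left].
Qed.

(** The alcove of [u x0] for small [u] is fundamental, which gives one direction. For the other, a
    fundamental alcove has points arbitrarily close to 0, where by Cauchy-Schwarz a negative
    constant term would prevail; if the constant term is 0, dominance of the alcove decides. *)
Lemma SposP a : Spos D a <-> S a /\ dominant_affine a.
Proof.
have [t t0 ht] := aeval_sign.
have tt : 0 < t <= t by rewrite t0 lexx.
pose C := [set y | forall b, S b -> 0 < aeval ip b (t *: x0) * aeval ip b y].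
have Cu u : 0 < u <= t -> C (u *: x0).
  move=> hu b Sb; have [h1 h2 h3] := ht _ _ Sb tt; have [h4 h5 h6] := ht _ _ Sb hu.
  have [d|d] := pselect (dominant_affine b).
    by rewrite mulr_gt0 ?h2 ?h5.
  by rewrite nmulr_rgt0 ?h3 ?h6.
have fC : fundamental_alcove D C.
  split.
  - by exists (t *: x0) => // b Sb; case: (ht _ _ Sb tt).
  - move=> x al Cx /x0pos [ral hal].
    have [c c0 Sc] := S_linear_root HD ral.
    have := Cx _ Sc; rewrite /aeval /= !addr0 !ipZl ipZr.
    rewrite pmulr_rgt0; last by rewrite !mulr_gt0.
    by rewrite pmulr_rgt0.
  (* The summand 1 avoids a division by 0 when [x0 = 0]. The cap at 1 in [v] gives
     [v^2 <= v <= u]. *)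
  move=> eps e0; pose u := Num.min t (eps / (1 + ip x0 x0)).
  have q0 : 0 <= ip x0 x0.
    by have [->|/(ip_gt0 ip)/ltW //] := eqVneq x0 0; rewrite ip0l.
  have u0 : 0 < u by rewrite lt_min t0 divr_gt0 //; lra.
  have ut : u <= t by rewrite ge_min lexx.
  have ue : u <= eps / (1 + ip x0 x0) by rewrite ge_min lexx orbT.
  pose v := Num.min u 1.
  have v0 : 0 < v by rewrite lt_min u0 ltr01.
  have vu : v <= u by rewrite ge_min lexx.
  have v1 : v <= 1 by rewrite ge_min lexx orbT.
  exists (v *: x0); first by apply: Cu; rewrite v0 (le_trans vu).
  rewrite ipZl ipZr mulrA.
  apply: (@le_lt_trans _ _ (u * ip x0 x0)).
    apply: ler_wpM2r => //; apply: (@le_trans _ _ (v * 1)); last by rewrite mulr1.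
    by rewrite ler_wpM2l // ltW.
  apply: (@lt_le_trans _ _ (u * (1 + ip x0 x0))); first by rewrite ltr_pM2l // ltrDr.
  by rewrite -ler_pdivlMr //; lra.
split; last first.
  move=> [Sa da]; split => //; exists C => // y Cy; have [_ h _] := ht _ _ Sa tt.
  by have := Cy _ Sa; rewrite pmulr_rgt0 // h.
move=> [Sa [E [alE posE smallE] hE]]; split => //.
have [l|l|e] := ltgtP a.2 0; [exfalso|by left|right; split => //].
  have a0 := S_neq0 HD Sa; have ha := ip_gt0 ip a0.
  have [|x Ex hx] := smallE (a.2 ^+ 2 / ip a.1 a.1).
    by rewrite divr_gt0 // exprn_even_gt0 //= lt_eqF.
  have := hE _ Ex; rewrite /aeval => h.
  have [cs _] := ip_CS ip a.1 x.
  move: hx; rewrite ltr_pdivlMr // mulrC => hx.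
  have := le_lt_trans cs hx; nra.
have [al [c [ra c0 ea]]] := S_gradient HD Sa.
have [x Ex _] := smallE 1 ltr01; have := hE _ Ex; rewrite /aeval e addr0 ea !ipZl.
rewrite !pmulr_rgt0 // => h.
have := x0reg ra; rewrite neq_lt => /orP [lt|//].
have rN : Rp (- al) by apply/x0pos; split; [exact: root_opp|rewrite ipNl oppr_gt0].
by have := posE _ _ Ex rN; rewrite ipNl oppr_gt0 ltNge ltW.
Qed.

End Alcove.

Section Labels.
Variable k : V * R -> R.
Hypothesis Hk : labelling D k.
Lemma k_W0 w a : W0 w -> S a -> k (w a.1, a.2) = k a.
Proof.
move=> hw Sa; have := Hk (L'0 HD) hw Sa.
by rewrite /affine_act ip0r subr0.
Qed.

Lemma double_W0 (w : 'End(V)) a : ((w a.1, a.2) : V * R) *+ 2 = (w (a *+ 2).1, (a *+ 2).2).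
Proof. by case: a => v r /=; rewrite !mulr2n /= linearD. Qed.

Lemma S_double_W0 w a : W0 w -> S ((w a.1, a.2) *+ 2) <-> S (a *+ 2).
Proof.
move=> hw; rewrite double_W0; move: (a *+ 2) => {}a; split; last by move=> /(S_W0 HD hw).
have [w' [hw' h1 h2]] := W0_inv hw.
by move=> /(S_W0 HD hw') /=; rewrite h1; case: a.
Qed.

Lemma k2_W0 w a : W0 w -> S a -> k2 D k (w a.1, a.2) = k2 D k a.
Proof.
move=> hw Sa; rewrite /k2; have := S_double_W0 a hw.
case: asboolP => h1; case: asboolP => h2 // h3; [|by case: h2; apply/h3|by case: h1; apply/h3].
by rewrite double_W0 k_W0.
Qed.
End Labels.

Lemma indivisible_W0 w a : W0 w -> indivisible D a -> indivisible D (w a.1, a.2).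
Proof.
move=> hw [Sa ni]; split; first exact: S_W0.
have [w' [hw' h1 h2]] := W0_inv hw.
case=> b Sb e; apply: ni; exists (w' b.1, b.2); first exact: S_W0.
by rewrite double_W0 -e /= h1; case: (a).
Qed.

End PositiveAffineRoots.

(** * The group algebra and its fraction field *)

Lemma subf_div (F : fieldType) (a b c d : F) : b != 0 -> d != 0 ->
  a / b - c / d = (a * d - c * b) / (b * d).
Proof. by move=> b0 d0; field; rewrite b0 d0. Qed.

Section FractionRepr.
Import FracField.

Lemma frac_reprE (A : idomainType) (x : {fraction A}) :
  x = @FracField.tofrac A (frac (repr x)).1 / @FracField.tofrac A (frac (repr x)).2.
Proof.
have d0 := denom_ratioP (repr x).
apply: (canRL (mulfK _)); first by rewrite tofrac_eq0.
rewrite -{1}[x]reprK; move: (repr x) d0 => y d0.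
unlock tofrac; rewrite -[LHS]pi_mul; apply/eqmodP; rewrite /= equivfE /mulf.
by rewrite !numden_Ratio ?mulf_neq0 ?oner_eq0 ?mulr1 // mulrC.
Qed.
End FractionRepr.

Section FractionField.
Context {R : realType} {V : vectType R} (D : data V) (K : fieldType).
Hypothesis HD : duality_data D.
Local Notation L := (dL D).
Local Notation n := (\dim {:V}).
Local Notation bas := (dbasis D).
Local Notation tofrac := (@FracField.tofrac (mpoly.mpoly n K)).
Local Notation X i := (tofrac (mpolyX K (mnm1 i)) : KL V K).
Local Notation KLe := (KLe D K).

Definition KLCm : {rmorphism K -> KL V K} := (tofrac \o @mpolyC n K).

Lemma KLCmE c : KLCm c = KLC V c.
Proof. by []. Qed.

Lemma KLX_neq0 i : X i != 0.
Proof. by rewrite tofrac_eq0 -msupp_eq0 msuppX. Qed.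

Lemma KLeD u v : L u -> L v -> KLe (u + v) = KLe u * KLe v.
Proof. by move=> Lu Lv; apply: monomialD => //; exact: KLX_neq0. Qed.
Lemma KLe0 : KLe 0 = 1.
Proof. exact: monomial0. Qed.
Lemma KLe_neq0 u : KLe u != 0.
Proof. by apply: monomial_neq0; exact: KLX_neq0. Qed.
Lemma KLeN u : L u -> KLe (- u) = (KLe u)^-1.
Proof. by move=> Lu; apply: monomialN => //; exact: KLX_neq0. Qed.

Lemma KLe_basis i : KLe (tnth bas i) = X i.
Proof.
have e : tnth bas i = \sum_j tnth bas j *~ (j == i)%:R.
  rewrite (bigD1 i) //= eqxx big1 ?addr0 //.
  by move=> j /negPf ->; rewrite mulr0z.
rewrite /Defs.KLe /monomial e zcoordE // (bigD1 i) //= eqxx big1 ?mulr1 //.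
by move=> j /negPf ->; rewrite expr0z.
Qed.

Lemma KLe_nat v : L v -> (forall i, 0 <= zcoord D v i) ->
  KLe v = tofrac (mpolyX K (Multinom [tuple `|zcoord D v i|%N | i < n])).
Proof.
move=> Lv h; rewrite mpolyXE_id rmorph_prod; apply: eq_bigr => i _.
rewrite rmorphXn mnmE /=.
by rewrite -{1}[zcoord D v i]gez0_abs.
Qed.

Definition coef_at (F : zmodType) (s : seq (F * V)) (v : V) : F := \sum_(t <- s | t.2 == v) t.1.

(** Multiplication by [KLe u], where all coordinates of [u] are [N], makes every exponent a natural
    number; then the coefficients of a polynomial can be compared. *)
Lemma KLe_indep (s : seq (K * V)) : (forall t, t \in s -> L t.2) ->
  \sum_(t <- s) KLC V t.1 * KLe t.2 = 0 -> forall v, coef_at s v = 0.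
Proof.
move=> sL s0 v.
have [vs|nvs] := boolP (v \in [seq t.2 | t <- s]); last first.
  rewrite /coef_at big_seq_cond big1 // => t /andP [ts /eqP e].
  by rewrite -e map_f in nvs.
have Lv : L v by case/mapP: vs => t /sL + ->.
pose N := (\sum_(t <- s) \sum_(i < n) `|zcoord D t.2 i|)%N.
pose u := \sum_i tnth bas i *~ (N%:Z).
have Lu : L u by apply/(LP HD); exists (fun _ => N%:Z).
have zu i : zcoord D u i = N by rewrite zcoordE.
have zt t i : t \in s -> 0 <= zcoord D (t.2 + u) i.
  move=> ts; rewrite (zcoordD HD _ (sL _ ts) Lu) zu.
  have : (`|zcoord D t.2 i| <= N)%N.
    rewrite /N (big_rem t) //= (bigD1 i) //= -addnA; exact: leq_addr.
  lia.
pose mm (x : V) := Multinom [tuple `|zcoord D (x + u) i|%N | i < n].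
have e1 : \sum_(t <- s) KLC V t.1 * KLe (t.2 + u) = 0.
  transitivity ((\sum_(t <- s) KLC V t.1 * KLe t.2) * KLe u); last by rewrite s0 mul0r.
  rewrite mulr_suml; apply: eq_big_seq => t ts.
  by rewrite KLeD ?mulrA //; exact: sL.
have e2 : \sum_(t <- s) t.1 *: mpolyX K (mm t.2) = 0.
  apply/eqP; rewrite -tofrac_eq0 -e1 rmorph_sum; apply/eqP; apply: eq_big_seq => t ts.
  rewrite KLe_nat; first by rewrite -mul_mpolyC rmorphM.
    by apply: (LD HD) => //; exact: sL.
  by move=> i; exact: zt.
have := congr1 (mcoeff (mm v)) e2; rewrite mcoeff0 raddf_sum /= => e3.
rewrite -[RHS]e3 /coef_at big_mkcond; apply: eq_big_seq => t ts.
rewrite mcoeffZ mcoeffX; have [->|ne] := eqVneq t.2 v; first by rewrite eqxx mulr1.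
suff -> : (mm t.2 == mm v) = false by rewrite mulr0.
apply/negbTE/eqP => /mnmP E; move/eqP: ne; apply.
apply: (addIr u); apply: (zcoord_inj HD); [by apply: (LD HD) => //; exact: sL|exact: (LD HD)|].
move=> i; have := E i; rewrite !mnmE.
have h1 := zt _ i ts; have [t' t's ev] := mapP vs; have h2 := zt _ i t's.
rewrite -ev in h2 => e.
by rewrite -(gez0_abs h1) -(gez0_abs h2) e.
Qed.

Section SemilinearMap.
Variables (phi : {rmorphism K -> K}) (g : {additive V -> V}).
Hypotheses (g_inj : injective g) (gL : forall v, L v -> L (g v)).
Local Notation h := (fun i => KLe (g (tnth bas i))).
Local Notation f := (KLCm \o phi).
Local Notation mm := (mmap f h).

Lemma KLe_additive m : \prod_i KLe (g (tnth bas i)) ^ (m i) = KLe (g (\sum_i tnth bas i *~ m i)).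
Proof.
rewrite raddf_sum /Defs.KLe.
under [in RHS]eq_bigr do rewrite raddfMz.
by rewrite monomial_sum //; [exact: KLX_neq0|move=> i; apply: gL; exact: L_basis].
Qed.

(** Injectivity of [g] keeps exponents distinct, and the [KLe] are independent. It follows that
    [KLmap], which evaluates one chosen numerator and denominator, does not depend on that
    choice. *)
Lemma mmap_eq0 p : mm p = 0 -> p = 0.
Proof.
move=> p0; apply/eqP; rewrite -msupp_eq0; case E : (msupp p) => [//|m l]; exfalso.
pose vec (m : multinom n) := \sum_i tnth bas i *~ (m i).
have zvec m' i : zcoord D (vec m') i = m' i by rewrite /vec zcoordE.
pose s := [seq (phi (mcoeff m p), g (vec m)) | m <- msupp p].
have sL t : t \in s -> L t.2.
  by case/mapP => m' _ -> /=; apply: gL; apply/(LP HD); exists (fun i => (m' i)%:Z).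
have s0 : \sum_(t <- s) KLC V t.1 * KLe t.2 = 0.
  rewrite -[RHS]p0 big_map; apply: eq_bigr => m' _; congr (_ * _).
  by rewrite -KLe_additive.
have := KLe_indep sL s0 (g (vec m)); rewrite /coef_at /s big_map.
rewrite big_mkcond (bigD1_seq m) /= ?eqxx //; [|by rewrite E mem_head].
rewrite big1 ?addr0 => [/eqP|m' ne].
  by rewrite fmorph_eq0 mcoeff_eq0 E mem_head.
case: eqP => // /g_inj e.
by case/eqP: ne; apply/mnmP => i; apply/eqP; rewrite -eqz_nat -!zvec e.
Qed.

Lemma mmap_neq0 p : p != 0 -> mm p != 0.
Proof. by apply: contra_neq => /mmap_eq0. Qed.

Local Notation Phi := (KLmap f h).

Lemma KLmap_frac p r : r != 0 -> Phi (tofrac p / tofrac r) = mm p / mm r.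
Proof.
move=> r0; rewrite /KLmap; set x := (X in repr X).
have d0 := denom_ratioP (repr x).
have := frac_reprE x; rewrite {1}/x => /eqP.
rewrite eqr_div ?tofrac_eq0 //; rewrite -!tofracM tofrac_eq => /eqP e.
apply/eqP; rewrite eqr_div ?mmap_neq0 // -!rmorphM /= -e.
by rewrite e.
Qed.

Lemma KLfracP (x : KL V K) : exists p r, r != 0 /\ x = tofrac p / tofrac r.
Proof.
exists (frac (repr x)).1, (frac (repr x)).2; split; first exact: denom_ratioP.
exact: frac_reprE.
Qed.

Lemma KLmap_tofrac p : Phi (tofrac p) = mm p.
Proof.
have := @KLmap_frac p 1 (oner_neq0 _).
by rewrite !rmorph1 !divr1.
Qed.

Lemma KLmap_zmod : zmod_morphism Phi.
Proof.
move=> x y; have [p [r [r0 ->]]] := KLfracP x; have [p' [r' [r0' ->]]] := KLfracP y.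
have -> : tofrac p / tofrac r - tofrac p' / tofrac r' = tofrac (p * r' - p' * r) / tofrac (r * r').
  by rewrite rmorphB !rmorphM subf_div ?tofrac_eq0.
rewrite !KLmap_frac ?mulf_neq0 // rmorphB !rmorphM.
by rewrite subf_div ?mmap_neq0.
Qed.

Lemma KLmap_monoid : monoid_morphism Phi.
Proof.
split; first by have := KLmap_tofrac 1; rewrite !rmorph1.
move=> x y; have [p [r [r0 ->]]] := KLfracP x; have [p' [r' [r0' ->]]] := KLfracP y.
rewrite mulf_div -!rmorphM !KLmap_frac ?mulf_neq0 // !rmorphM /=.
by rewrite mulf_div.
Qed.

HB.instance Definition _ := GRing.isZmodMorphism.Build (KL V K) (KL V K) Phi KLmap_zmod.
HB.instance Definition _ := GRing.isMonoidMorphism.Build (KL V K) (KL V K) Phi KLmap_monoid.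

(** Serves both the action of [w], with [phi] the identity, and the involution, with [g] the
    negation. The bundled [Psi] gives access to the rules for ring morphisms. *)
Lemma KLmap_rmorphism : exists Psi : {rmorphism KL V K -> KL V K},
  [/\ forall x, Phi x = Psi x, forall c, Psi (KLC V c) = KLC V (phi c) &
   forall v, L v -> Psi (KLe v) = KLe (g v)].
Proof.
exists Phi; split => // [c|v Lv].
  by rewrite /= KLmap_tofrac mmapC.
rewrite {2}(L_zcoord HD Lv) -KLe_additive rmorph_prod; apply: eq_bigr => i _.
rewrite fmorphXz; congr (_ ^ _).
by transitivity (mm (mpolyX K (mnm1 i))); [exact: KLmap_tofrac|rewrite mmapX mmap1U].
Qed.

End SemilinearMap.

Section Action.
Local Notation W0 := (W0 D).
Variable w : 'End(V).
Hypothesis hw : W0 w.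

Lemma KLact_rmorphism : exists Psi : {rmorphism KL V K -> KL V K},
  [/\ forall x, KLact D w x = Psi x, forall c, Psi (KLC V c) = KLC V c &
   forall v, L v -> Psi (KLe v) = KLe (w v)].
Proof. exact: (KLmap_rmorphism idfun (W0_inj hw) (fun v => W0_L HD hw)). Qed.
End Action.

Lemma KLstar_rmorphism (star : {rmorphism K -> K}) : exists Psi : {rmorphism KL V K -> KL V K},
  [/\ forall x, KLstar D star x = Psi x, forall c, Psi (KLC V c) = KLC V (star c) &
   forall v, L v -> Psi (KLe v) = KLe (- v)].
Proof. exact: (@KLmap_rmorphism star (-%R : {additive V -> V}) oppr_inj (fun v hv => LN HD hv)). Qed.

End FractionField.

Section SupportSum.
Variables (C F : zmodType) (V : eqType).

Lemma sum_partition (s : seq (C * V)) (G : C * V -> F) :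
  \sum_(t <- s) G t = \sum_(v <- undup [seq t.2 | t <- s]) \sum_(t <- s | t.2 == v) G t.
Proof.
under [RHS]eq_bigr do rewrite big_mkcond.
rewrite exchange_big /=; apply: eq_big_seq => t ts.
rewrite (bigD1_seq t.2) ?undup_uniq ?mem_undup ?map_f //= eqxx big1 ?addr0 //.
by move=> v /negPf; rewrite eq_sym => ->.
Qed.

(** Additivity in the coefficient suffices; [phi] is arbitrary in the exponent. A formal identity
    therefore passes to every evaluation of the exponents. *)
Lemma sum_by_support (phi : C -> V -> F) (s : seq (C * V)) :
  (forall v, phi 0 v = 0) -> (forall v, {morph phi^~ v : x y / x + y}) ->
  (forall v, \sum_(t <- s | t.2 == v) t.1 = 0) -> \sum_(t <- s) phi t.1 t.2 = 0.
Proof.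
move=> phi0 phiD h; rewrite sum_partition big1 // => v _.
transitivity (phi (\sum_(t <- s | t.2 == v) t.1) v); last by rewrite h phi0.
rewrite (big_morph (phi^~ v) (phiD v) (phi0 v)).
by apply: eq_bigr => t /eqP ->.
Qed.
End SupportSum.

(** * Divisibility and coprimality in the group algebra *)

Section GroupAlgebraElements.
Context {R : realType} {V : vectType R} (D : data V) (K : fieldType).
Hypothesis HD : duality_data D.
Local Notation L := (dL D).
Local Notation KLe := (KLe D K).
Local Notation in_A := (@in_A R V D K).

Lemma in_A_e v : L v -> in_A (KLe v).
Proof.
move=> Lv; exists [:: (1, v)]; split; last by rewrite big_seq1 -KLCmE rmorph1 mul1r.
by move=> t; rewrite inE => /eqP ->.
Qed.
Lemma in_AD x y : in_A x -> in_A y -> in_A (x + y).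
Proof.
move=> [s [hs ->]] [t [ht ->]]; exists (s ++ t); rewrite big_cat; split => // u.
by rewrite mem_cat => /orP [/hs|/ht].
Qed.
Lemma in_A_KLCe c v : L v -> in_A (KLC V c * KLe v).
Proof.
move=> Lv; exists [:: (c, v)]; split; last by rewrite big_seq1.
by move=> t; rewrite inE => /eqP ->.
Qed.
Lemma in_A_C c : in_A (KLC V c).
Proof. by rewrite -[KLC V c]mulr1 -(KLe0 K HD); apply/in_A_KLCe/L0. Qed.
Lemma in_A0 : in_A 0.
Proof. by rewrite -(rmorph0 (@KLCm R V K)); exact: in_A_C. Qed.
Lemma in_A1 : in_A 1.
Proof. by rewrite -(rmorph1 (@KLCm R V K)); exact: in_A_C. Qed.
Lemma in_A_sum I (s : seq I) (F : I -> KL V K) (P : pred I) :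
  (forall i, P i -> in_A (F i)) -> in_A (\sum_(i <- s | P i) F i).
Proof. by move=> h; apply: big_ind => //; [exact: in_A0|exact: in_AD]. Qed.
Lemma in_A_sum_seq (I : eqType) (s : seq I) (F : I -> KL V K) :
  (forall i, i \in s -> in_A (F i)) -> in_A (\sum_(i <- s) F i).
Proof. by move=> h; rewrite big_seq; apply: in_A_sum. Qed.
Lemma in_AM x y : in_A x -> in_A y -> in_A (x * y).
Proof.
move=> [s [hs ->]] [t [ht ->]]; rewrite mulr_suml; apply: in_A_sum_seq => a /hs La.
rewrite mulr_sumr; apply: in_A_sum_seq => b /ht Lb.
by rewrite mulrACA -(KLeD K HD) // -!KLCmE -rmorphM KLCmE; apply/in_A_KLCe/(LD HD).
Qed.
Lemma in_AN x : in_A x -> in_A (- x).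
Proof.
by move=> h; rewrite -mulN1r -(rmorphN1 (@KLCm R V K)); apply: in_AM => //; exact: in_A_C.
Qed.
Lemma in_AB x y : in_A x -> in_A y -> in_A (x - y).
Proof. by move=> hx hy; apply/in_AD/in_AN. Qed.
Lemma in_A_prod I (s : seq I) (F : I -> KL V K) (P : pred I) :
  (forall i, P i -> in_A (F i)) -> in_A (\prod_(i <- s | P i) F i).
Proof. by move=> h; apply: big_ind => //; [exact: in_A1|exact: in_AM]. Qed.
Lemma in_A_prod_seq (I : eqType) (s : seq I) (F : I -> KL V K) (P : pred I) :
  (forall i, i \in s -> P i -> in_A (F i)) -> in_A (\prod_(i <- s | P i) F i).
Proof. by move=> h; rewrite big_seq_cond; apply: in_A_prod => i /andP [? ?]; apply: h. Qed.
Lemma in_A_1e v : L v -> in_A (1 - KLe v).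
Proof. by move=> Lv; apply: in_AB; [exact: in_A1|exact: in_A_e]. Qed.

Lemma in_A_map (phi : K -> K) (g : V -> V) (Psi : {rmorphism KL V K -> KL V K}) x :
  (forall c, Psi (KLC V c) = KLC V (phi c)) -> (forall v, L v -> Psi (KLe v) = KLe (g v)) ->
  (forall v, L v -> L (g v)) -> in_A x -> in_A (Psi x).
Proof.
move=> hC he hL [s [hs ->]]; rewrite rmorph_sum; apply: in_A_sum_seq => t /hs Lt.
by rewrite rmorphM hC he //; apply/in_A_KLCe/hL.
Qed.

(** Any function on the exponents extends to a linear functional. With [f] the indicator of a coset
    it controls divisibility; with [f] a table of chosen constant terms it makes [ct] independent of
    the expansion. *)
Lemma KLe_functional (f : V -> K) (s : seq (K * V)) : (forall t, t \in s -> L t.2) ->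
  \sum_(t <- s) KLC V t.1 * KLe t.2 = 0 -> \sum_(t <- s) t.1 * f t.2 = 0.
Proof.
move=> sL /(KLe_indep HD sL) h.
apply: (sum_by_support (phi := fun c v => c * f v)) => // v.
  by rewrite mul0r.
by move=> x y; rewrite mulrDl.
Qed.

Lemma KLe_eq1 v : L v -> KLe v = 1 -> v = 0.
Proof.
move=> Lv h; apply: contrapT => /eqP v0.
pose s := [:: ((1 : K), v); (-1, 0)].
have sL t : t \in s -> L t.2.
  by rewrite !inE => /orP [] /eqP -> //=; exact: L0.
have := KLe_functional (fun u => (u == v)%:R) sL; rewrite /s !big_cons !big_nil /=.
rewrite -!KLCmE rmorphN1 rmorph1 h (KLe0 K HD) !mulr1 addr0 subrr => /(_ erefl).
by rewrite eqxx [0 == v]eq_sym (negPf v0) !(mulr0, addr0, mul1r) => /eqP; rewrite oner_eq0.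
Qed.

Lemma KLe_neq1 v : L v -> v != 0 -> 1 - KLe v != 0.
Proof. by move=> Lv; apply: contra_neq => /eqP; rewrite subr_eq0 => /eqP /esym; exact: KLe_eq1. Qed.

Lemma KLe_shift_div b v (m : int) : L b -> L v ->
  exists2 y, in_A y & KLe (v + b *~ m) - KLe v = (1 - KLe b) * y.
Proof.
move=> Lb Lv.
have H (p : nat) u : L u -> exists2 y, in_A y & KLe (u + b *+ p) - KLe u = (1 - KLe b) * y.
  move=> Lu; elim: p => [|p [y Ay e]].
    by exists 0; [exact: in_A0|rewrite addr0 subrr mulr0].
  have Lp : L (u + b *+ p) by apply: (LD HD) => //; exact: (Lmn HD).
  exists (y - KLe (u + b *+ p)); first by apply: in_AB => //; exact: in_A_e.
  rewrite mulrSr addrA (KLeD K HD Lp Lb) mulrBr -e; ring.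
case: m => p; first by rewrite -pmulrn; exact: H.
have Lu : L (v - b *+ p.+1) by apply: (LB HD) => //; exact: (Lmn HD).
have [y Ay] := H p.+1 _ Lu; rewrite subrK => e.
exists (- y); first exact: in_AN.
by rewrite NegzE mulrNz -pmulrn mulrN -e opprB.
Qed.

Section Coprime.
Variables (b c : V).
Hypotheses (Lb : L b) (Lc : L c).
Hypothesis indep : forall m p : int, c *~ m = b *~ p -> m = 0.

Definition coset_fun (v u : V) : K := if `[< exists m : int, u = v + b *~ m >] then 1 else 0.

(* Divisibility by [1 - e(b)] holds as soon as the coefficients sum to zero over
   each coset of [Z b]. *)
Lemma coset_div (s : seq (K * V)) : (forall t, t \in s -> L t.2) ->
  (forall v, L v -> \sum_(t <- s) t.1 * coset_fun v t.2 = 0) ->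
  exists2 y, in_A y & \sum_(t <- s) KLC V t.1 * KLe t.2 = (1 - KLe b) * y.
Proof.
move=> sL h.
(* Moving every exponent to the representative of its coset changes the sum by a multiple of
   [1 - e(b)] and leaves 0, since each coset sum vanishes. *)
pose rep v := xget 0 [set u | exists m : int, u = v + b *~ m].
have repP v : exists m : int, rep v = v + b *~ m.
  by rewrite /rep; case: xgetP => [u _ //|/(_ v)]; case; exists 0; rewrite mulr0z addr0.
have rep_eq u v m : u = v + b *~ m -> rep u = rep v.
  move=> ->; rewrite /rep; congr xget; apply/seteqP; split => x /= [p ->].
    by exists (m + p); rewrite mulrzDr addrA.
  by exists (p - m); rewrite mulrzBr addrA addrAC addrK.
have Lrep v : L v -> L (rep v).
  by move=> Lv; have [m ->] := repP v; apply: (LD HD) => //; exact: (Lz HD).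
have e1 : \sum_(t <- s) KLC V t.1 * KLe (rep t.2) = 0.
  transitivity (\sum_(t <- [seq (t.1, rep t.2) | t <- s]) KLC V t.1 * KLe t.2).
    by rewrite big_map.
  apply: (sum_by_support (phi := fun c v => KLC V c * KLe v)) => v.
  - by rewrite -KLCmE rmorph0 mul0r.
  - by move=> x y; rewrite -!KLCmE rmorphD mulrDl.
  rewrite big_map /=.
  have [/mapP [t0 t0s ev]|nv] := boolP (v \in [seq rep t.2 | t <- s]); last first.
    rewrite big_seq_cond big1 // => t /andP [ts /eqP e].
    by case/negP: nv; apply/mapP; exists t.
  rewrite -[RHS](h t0.2 (sL _ t0s)) big_mkcond; apply: eq_bigr => t _.
  rewrite ev /coset_fun; case: asboolP => [[m em]|nm].
    by rewrite (rep_eq _ _ _ em) eqxx mulr1.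
  rewrite mulr0; case: eqP => // e; case: nm.
  have [m1 E1] := repP t.2; have [m2 E2] := repP t0.2.
  exists (m2 - m1); rewrite mulrzBr addrA -E2 -e E1 addrK //.
have H t : t \in s -> exists2 y, in_A y & KLC V t.1 * KLe t.2 - KLC V t.1 * KLe (rep t.2) = (1 - KLe b) * y.
  move=> ts; have [m ->] := repP t.2.
  have [y Ay e] := KLe_shift_div m Lb (sL _ ts).
  exists (- (KLC V t.1 * y)); first by apply/in_AN/in_AM => //; exact: in_A_C.
  by rewrite mulrN mulrCA -e; ring.
have -> : \sum_(t <- s) KLC V t.1 * KLe t.2 =
   \sum_(t <- s) (KLC V t.1 * KLe t.2 - KLC V t.1 * KLe (rep t.2)).
  by rewrite sumrB e1 subr0.
clear -H HD; elim: s H => [|t s IH] H.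
  by exists 0; [exact: in_A0|rewrite big_nil mulr0].
have [y Ay e] := H t (mem_head _ _).
have [|y' Ay' e'] := IH; first by move=> u us; apply: H; rewrite inE us orbT.
by exists (y + y'); [exact: in_AD|rewrite big_cons e e' mulrDr].
Qed.

(* The coset sums of [y] are invariant under translation by [c], hence vanish by
   finiteness of the support. *)
Lemma coprime_div y z : in_A y -> in_A z -> (1 - KLe c) * y = (1 - KLe b) * z ->
  exists2 y', in_A y' & y = (1 - KLe b) * y'.
Proof.
move=> [s [sL ey]] [r [rL ez]] E.
rewrite ey; apply: coset_div => //.
pose sg v := \sum_(t <- s) t.1 * coset_fun v t.2.
have sgc v : L v -> sg v = sg (v - c).
  move=> Lv.
  (* The expansion of [(1 - e(c)) y - (1 - e(b)) z]. Under [coset_fun v] the two parts coming from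
     [z] cancel by periodicity, and the shift by [c] replaces [v] by [v - c]. *)
  pose S := s ++ [seq (- t.1, t.2 + c) | t <- s] ++ [seq (- t.1, t.2) | t <- r]
     ++ [seq (t.1, t.2 + b) | t <- r].
  have SL t : t \in S -> L t.2.
    rewrite !mem_cat => /or4P [/sL //| /mapP [u us ->]| /mapP [u us ->]| /mapP [u us ->]] /=.
    - by apply: (LD HD) => //; exact: sL.
    - exact: rL.
    by apply: (LD HD) => //; exact: rL.
  have S0 : \sum_(t <- S) KLC V t.1 * KLe t.2 = 0.
    rewrite !big_cat !big_map /=.
    have -> : \sum_(t <- s) KLC V (- t.1) * KLe (t.2 + c) = - (KLe c * y).
      rewrite ey mulr_sumr -sumrN; apply: eq_big_seq => t ts.
      by rewrite -!KLCmE rmorphN (KLeD K HD (sL _ ts) Lc) /=; ring.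
    have -> : \sum_(t <- r) KLC V (- t.1) * KLe t.2 = - z.
      by rewrite ez -sumrN; apply: eq_bigr => t _; rewrite -!KLCmE rmorphN mulNr.
    have -> : \sum_(t <- r) KLC V t.1 * KLe (t.2 + b) = KLe b * z.
      rewrite ez mulr_sumr; apply: eq_big_seq => t ts.
      by rewrite (KLeD K HD (rL _ ts) Lb) /=; ring.
    rewrite -ey; transitivity ((1 - KLe c) * y - (1 - KLe b) * z); first by ring.
    by rewrite E subrr.
  have := KLe_functional (coset_fun v) SL S0; rewrite !big_cat !big_map /=.
  have cb u : coset_fun v (u + b) = coset_fun v u.
    rewrite /coset_fun; do 2 case: asboolP => //.
      by move=> h [m e]; case: h; exists (m - 1); rewrite mulrzBr mulr1z addrA -e addrK.
    by move=> [m e] h; case: h; exists (m + 1); rewrite mulrzDr mulr1z addrA -e.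
  have cc u : coset_fun v (u + c) = coset_fun (v - c) u.
    rewrite /coset_fun; do 2 case: asboolP => //.
      by move=> h [m e]; case: h; exists m; rewrite addrAC -e addrK.
    by move=> [m e] h; case: h; exists m; rewrite e addrAC subrK.
  under [X in _ + (X + _)]eq_bigr do rewrite cc mulNr.
  under [X in _ + (_ + (_ + X))]eq_bigr do rewrite cb.
  under [X in _ + (_ + (X + _))]eq_bigr do rewrite mulNr.
  rewrite !sumrN addNr addr0 -/(sg _) -/(sg _) => /eqP.
  by rewrite subr_eq0 => /eqP.
have sgj j v : L v -> sg v = sg (v - c *+ j).
  elim: j v => [|j IH] v Lv; first by rewrite subr0.
  rewrite (IH v Lv) sgc; first by rewrite mulrSr opprD addrA.
  by apply: (LB HD) => //; exact: (Lmn HD).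
move=> v Lv; rewrite -/(sg v).
(* Two cosets [v - c j + Z b] through one exponent would give a relation between [c] and [b]. So
   each exponent of [y] lies on at most one of them, and [j0] exceeds all the indices that occur. *)
have [j hj] : exists j0 : nat, forall j t, (j0 <= j)%N -> t \in s ->
    ~ exists m : int, t.2 = v - c *+ j + b *~ m.
  clear -indep; elim: s => [|t s [j0 H]]; first by exists 0%N.
  have [[j1 [m1 e1]]|no] := pselect (exists j (m : int), t.2 = v - c *+ j + b *~ m); last first.
    exists j0 => j u jj; rewrite inE => /orP [/eqP -> [m e]|/(H _ _ jj) //].
    by apply: no; exists j, m.
  exists (maxn j0 j1.+1) => j u; rewrite geq_max => /andP [jj jj1].
  rewrite inE => /orP [/eqP -> [m e]|/(H _ _ jj) //].
  have /indep : c *~ (j%:Z - j1%:Z) = b *~ (m - m1).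
    rewrite !mulrzBr -!pmulrn; move: e; rewrite e1 -!addrA => /addrI e.
    by rewrite -[- (c *+ j1)](addrK (b *~ m1)) e !addrA subrr add0r.
  lia.
rewrite (sgj j v Lv) /sg big_seq big1 // => t ts; rewrite /coset_fun.
by case: asboolP => [/(hj _ _ (leqnn j) ts)|_] //; rewrite mulr0.
Qed.

Lemma in_A_coprime x : b != 0 -> in_A ((1 - KLe b) * x) -> in_A ((1 - KLe c) * x) -> in_A x.
Proof.
move=> b0 h1 h2; have := KLe_neq1 Lb b0 => e0.
have [|y Ay /(mulfI e0) -> //] := coprime_div h1 h2.
by rewrite mulrCA.
Qed.

End Coprime.

(** Factors are cleared one at a time: [(1 - KLe c) * x] satisfies the hypotheses with one factor
    fewer, and then coprimality of [1 - KLe b] and [1 - KLe c] yields [x]. *)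
Lemma in_A_coprime_prod b x (l : seq V) : L b -> b != 0 -> (forall c, c \in l -> L c) ->
  (forall c, c \in l -> forall m p : int, c *~ m = b *~ p -> m = 0) ->
  in_A ((1 - KLe b) * x) -> in_A (x * \prod_(c <- l) (1 - KLe c)) -> in_A x.
Proof.
move=> Lb b0; elim: l x => [|c l IH] x lL hl h; first by rewrite big_nil mulr1.
rewrite big_cons mulrA => h'.
have cl : c \in c :: l by rewrite mem_head.
apply: (in_A_coprime Lb (lL _ cl) (hl _ cl) b0 h).
rewrite mulrC; apply: IH => // [d dl|d dl|].
- by apply: lL; rewrite inE dl orbT.
- by apply: hl; rewrite inE dl orbT.
by rewrite mulrA; apply: in_AM => //; apply: in_A_1e; exact: lL.
Qed.

End GroupAlgebraElements.

(** * Averages over the Weyl group *)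

Section BigSubsequence.
Context {A : Type} {idx : A} {op : Monoid.com_law idx} {T : eqType} (l Bs : seq T).
Hypotheses (Ul : uniq l) (UB : uniq Bs) (lB : {subset l <= Bs}).

Lemma big_mem_sub (P : pred T) (f : T -> A) :
  \big[op/idx]_(c <- Bs | P c && (c \in l)) f c = \big[op/idx]_(c <- l | P c) f c.
Proof.
rewrite -big_filter -[RHS]big_filter; apply: perm_big.
apply: uniq_perm; rewrite ?filter_uniq // => c; rewrite !mem_filter.
by case: (boolP (c \in l)) => [/lB ->|]; rewrite ?andbT ?andbF.
Qed.

Lemma big_sub_split (f : T -> A) :
  \big[op/idx]_(c <- Bs) f c = op (\big[op/idx]_(c <- l) f c) (\big[op/idx]_(c <- Bs | c \notin l) f c).
Proof. by rewrite (bigID (mem l)) /= (big_mem_sub xpredT). Qed.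
End BigSubsequence.

Lemma antisym_quotient (F : fieldType) (a p y B x : F) :
  1 - B != 0 -> x != 0 -> 1 - B = - B * x -> a - B * p = (1 - B) * y ->
  a / (1 - B) + p / x = y.
Proof.
move=> b0 x0 eb ey; apply: (mulfI b0); rewrite -ey mulrDr.
rewrite [(1 - B) * (a / _)]mulrC divfK //; congr (_ + _); rewrite eb.
by field.
Qed.

Lemma div_mul_swap (F : fieldType) (x d p q u : F) :
  d != 0 -> q != 0 -> p * q = d * u -> x / d * p = x * u / q.
Proof.
move=> d0 q0 e; apply: (canRL (mulfK q0)).
by rewrite -mulrA e mulrA divfK.
Qed.

Lemma half_double (F : fieldType) (h g p : F) : h * 2%:R = 1 -> g * p = h * ((g + g) * p).
Proof. by move=> e; rewrite -mulr2n -mulr_natl -mulrA mulrA e mul1r. Qed.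

(** * The denominators of the average and the cancellation of its poles *)

Section DenominatorRoots.
Context {R : realType} {V : vectType R} (D : data V).
Hypothesis HD : duality_data D.
Local Notation ip := (dip D).
Local Notation L := (dL D).
Local Notation S := (dS D).
Local Notation W0 := (W0 D).

(* The linear roots [v] with [2 v] not a root: one denominator [1 - e(-v)] of
   [1 / Delta0] for each positive one. *)
Definition top_root (v : V) : Prop := S (v, 0) /\ ~ S (v *+ 2, 0).

Lemma S_linear_opp v : S (v, 0) -> S (- v, 0).
Proof.
move=> Sv; have := S_W0 HD (W0_refl_S HD Sv) Sv.
by rewrite /= refl_self // (S_neq0 HD Sv).
Qed.

Lemma top_root_L v : top_root v -> L v.
Proof. by case=> /(S_L HD). Qed.

Lemma top_root_neq0 v : top_root v -> v != 0.
Proof. by case=> /(S_neq0 HD). Qed.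

Lemma top_root_W0 w v : W0 w -> top_root v -> top_root (w v).
Proof.
move=> hw [h1 h2]; split; first exact: (S_W0 HD hw h1).
move=> h; apply: h2; have [w' [hw' k1 _]] := W0_inv hw.
by have := S_W0 HD hw' h; rewrite /= raddfMn /= k1.
Qed.

Lemma top_root_opp v : top_root v -> top_root (- v).
Proof.
move=> [h1 h2]; split; first exact: S_linear_opp.
by move=> h; apply: h2; rewrite -[v]opprK mulNrn; apply: S_linear_opp.
Qed.

Lemma top_root_refl v : top_root v -> W0 (refl ip v).
Proof. by case=> h _; exact: (W0_refl_S HD h). Qed.

(** The numbers [<c, b^vee> = 2 t] and [<b, c^vee> = 2 / t] are integers with product 4. *)
Lemma S_linear_proportional b c (t : R) : S (b, 0) -> S (c, 0) -> c = t *: b ->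
  [\/ t = 1 \/ t = -1, t = 2 \/ t = -2 | t = 1 / 2 \/ t = - (1 / 2)].
Proof.
move=> Sb Sc e; have b0 := S_neq0 HD Sb; have c0 := S_neq0 HD Sc.
have t0 : t != 0 by apply: contraNneq c0 => t0; rewrite /= e t0 scale0r.
have /intrP [x hx] := S_int HD Sb (S_L HD Sc).
have /intrP [y hy] := S_int HD Sc (S_L HD Sb).
rewrite /= e ipZl ip_coroot_self // in hx.
rewrite /= e corootZ // ipZr ip_coroot_self // in hy.
have xy : (x * y = 4)%R.
  apply: (@intr_inj R); rewrite rmorphM /= -hx -hy; field; exact: t0.
have : [\/ x = 2 \/ x = -2, x = 4 \/ x = -4 | x = 1 \/ x = -1].
  have hx4 : (`|x| <= 4)%N by apply: dvdn_leq => //; apply/dvdnP; exists `|y|%N; rewrite mulnC -abszM xy.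
  have : (x <= 4)%R /\ (-4 <= x)%R by lia.
  case: x xy {hx hx4} => x xy [h1 h2].
    case: x xy h1 h2 => [|[|[|[|[|x]]]]] xy h1 h2; try lia.
    - by apply: Or33; left.
    - by apply: Or31; left.
    by apply: Or32; left.
  case: x xy h1 h2 => [|[|[|[|x]]]] xy h1 h2; try lia.
  - by apply: Or33; right.
  - by apply: Or31; right.
  by apply: Or32; right.
by case=> -[E|E]; rewrite E in hx; [apply: Or31; left|apply: Or31; right|apply: Or32; left
  |apply: Or32; right|apply: Or33; left|apply: Or33; right]; lra.
Qed.

(** Among proportional linear roots the ratios [2] and [1/2], up to sign, make one root twice the
    other up to sign, which a top root excludes. This supplies the independence that the coprimality
    lemmas assume. *)
Lemma top_root_indep b c : top_root b -> top_root c -> c != b -> c != - b ->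
  forall m p : int, c *~ m = b *~ p -> m = 0.
Proof.
move=> [Sb nb] [Sc nc] cb cNb m p e; apply/eqP; apply: contraT => m0.
have e' : c = (p%:~R / m%:~R) *: b.
  rewrite mulrC -scalerA [_%:~R *: b]scaler_int -e -[c *~ m]scaler_int scalerA mulVf ?scale1r //.
  by rewrite intr_eq0.
have [] := S_linear_proportional Sb Sc e'; case=> ht; rewrite ht in e'; exfalso.
- by rewrite e' scale1r eqxx in cb.
- by rewrite e' scaleN1r eqxx in cNb.
- by apply: nb; rewrite -scaler_nat -e'.
- apply: nb; rewrite -scaler_nat -[_ *: b]opprK -scaleNr -e'; exact: S_linear_opp.
- apply: nc; rewrite e' -scaler_nat scalerA mulrA mulr1 divff ?pnatr_eq0 // scale1r //.
apply: nc; rewrite e' -scaler_nat scalerA mulrN mulrA mulr1 divff ?pnatr_eq0 // scaleN1r.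
exact: S_linear_opp.
Qed.

Lemma top_roots_finite : finite_set top_root.
Proof.
apply: (@sub_finite_set _ _ (fst @` [set a | S a /\ 0 <= a.2 <= 0])).
  by move=> v [Sv _]; exists (v, 0) => //; split => //=; rewrite lexx.
by apply: finite_image; exact: S_bounded_finite.
Qed.

Definition top_seq : seq V := fset_set top_root.
Lemma top_seqP v : v \in top_seq <-> top_root v.
Proof. by rewrite /top_seq (in_fset_set top_roots_finite) inE. Qed.
Lemma top_seq_uniq : uniq top_seq.
Proof. exact: fset_uniq. Qed.

Definition W0_seq : seq 'End(V) := fset_set W0.
Lemma W0_seqP w : w \in W0_seq <-> W0 w.
Proof. by rewrite /W0_seq (in_fset_set (W0_finite HD)) inE. Qed.
Lemma W0_seq_uniq : uniq W0_seq.
Proof. exact: fset_uniq. Qed.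
Lemma W0_seq_mul v : W0 v -> perm_eq [seq (v \o w)%VF | w <- W0_seq] W0_seq.
Proof.
move=> hv; have [v' [hv' h1 h2]] := W0_inv hv.
have K1 (w : 'End(V)) : (v' \o (v \o w))%VF = w by apply/lfunP => x; rewrite !comp_lfunE h1.
have K2 (w : 'End(V)) : (v \o (v' \o w))%VF = w by apply/lfunP => x; rewrite !comp_lfunE h2.
apply: uniq_perm; rewrite ?W0_seq_uniq //.
  by rewrite map_inj_uniq ?W0_seq_uniq // => x y e; rewrite -(K1 x) e K1.
move=> w; apply/mapP/idP => [[u /W0_seqP hu ->]|/W0_seqP hw].
  by apply/W0_seqP; apply: W0_comp.
by exists (v' \o w)%VF; [apply/W0_seqP; apply: W0_comp|rewrite K2].
Qed.

Lemma card_W0_gt0 : (0 < card_W0 D)%N.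
Proof.
rewrite /card_W0 cardfs_gt0; apply/fset0Pn; exists \1%VF.
by rewrite (in_fset_set (W0_finite HD)) inE; exact: W0_1.
Qed.
Lemma size_W0_seq : size W0_seq = card_W0 D.
Proof. by []. Qed.

Section Averaging.
Variables (K : fieldType) (Bp : seq V).
Hypothesis K0 : [pchar K] =i pred0.
Hypotheses (Bp_uniq : uniq Bp) (Bp_top : forall b, b \in Bp -> top_root b)
  (Bp_half : forall b, b \in Bp -> - b \notin Bp).
Local Notation KLe := (KLe D K).
Local Notation in_A := (@in_A R V D K).
Local Notation Bs := top_seq.

Definition denom_seq (w : 'End(V)) : seq V := [seq - w b | b <- Bp].

Lemma denom_seq_uniq w : W0 w -> uniq (denom_seq w).
Proof. by move=> hw; rewrite map_inj_uniq // => x y /oppr_inj /(W0_inj hw). Qed.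

Lemma denom_seq_sub w : W0 w -> {subset denom_seq w <= Bs}.
Proof.
by move=> hw c /mapP [b bB ->]; apply/top_seqP/top_root_opp/top_root_W0/Bp_top.
Qed.

Lemma denom_seq_half w b : W0 w -> b \in denom_seq w -> - b \notin denom_seq w.
Proof.
move=> hw /mapP [c cB ->]; apply/negP => /mapP [d dB]; rewrite opprK => e.
have : c = - d by apply: (W0_inj hw); rewrite e raddfN.
by move=> e'; have := Bp_half dB; rewrite -e' cB.
Qed.

(* The pairwise coprime denominators other than [1 - e(b)] and [1 - e(-b)]. *)
Definition pprod (b : V) : KL V K := \prod_(c <- Bs | (c != b) && (c != - b)) (1 - KLe c).

Lemma in_A_1e_top c : c \in Bs -> in_A (1 - KLe c).
Proof. by move=> /top_seqP h; apply: in_A_1e => //; exact: top_root_L. Qed.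

Lemma top_neq0 c : c \in Bs -> 1 - KLe c != 0.
Proof. by move=> /top_seqP h; apply: KLe_neq1 => //; [exact: top_root_L|exact: top_root_neq0]. Qed.

Lemma one_sub_opp b : L b -> 1 - KLe b = - KLe b * (1 - KLe (- b)).
Proof.
move=> Lb; rewrite (KLeN K HD Lb) mulrBr mulr1 mulNr divff ?opprK ?KLe_neq0 //.
by rewrite addrC.
Qed.

(** The denominator of a term has distinct factors and contains at most one of [1 - e(b)] and
    [1 - e(-b)], which agree up to the unit [- e(b)]. So after multiplication by [pprod b] only a
    single [1 - e(b)] can remain below. *)
Lemma pprod_factor (l : seq V) b : b \in Bs -> uniq l -> {subset l <= Bs} ->
  (b \in l -> - b \notin l) ->
  exists2 u, in_A u & pprod b * (1 - KLe b) = (\prod_(c <- l) (1 - KLe c)) * u.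
Proof.
move=> bB Ul lB half.
have Lb : L b by apply: top_root_L; apply/top_seqP.
pose P c := (c != b) && (c != - b).
pose u0 := \prod_(c <- Bs | P c && (c \notin l)) (1 - KLe c).
have Au0 : in_A u0 by apply: in_A_prod_seq => // c cB _; exact: in_A_1e_top.
have e0 : pprod b = \prod_(c <- l | P c) (1 - KLe c) * u0.
  by rewrite /pprod (bigID (mem l)) /= (big_mem_sub Ul top_seq_uniq lB P).
have [bl|bl] := boolP (b \in l).
  exists u0 => //; rewrite e0 (bigD1_seq b) //= mulrAC; congr (_ * _).
  rewrite mulrC; congr (_ * _); rewrite big_seq_cond [RHS]big_seq_cond; apply: eq_bigl => c.
  rewrite /P; case: (boolP (c \in l)) => //= cl; case: eqP => //= _.
  by apply: contraTneq cl => ->; exact: half.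
have [bl'|bl'] := boolP (- b \in l).
  exists (- KLe b * u0); first by apply: in_AM => //; apply/in_AN/in_A_e.
  rewrite e0 (bigD1_seq (- b)) //= one_sub_opp //.
  have -> : \prod_(c <- l | P c) (1 - KLe c) = \prod_(c <- l | c != - b) (1 - KLe c).
    rewrite big_seq_cond [RHS]big_seq_cond; apply: eq_bigl => c.
    rewrite /P; case: (boolP (c \in l)) => //= cl.
    by have -> : c != b by apply: contraTneq cl => ->.
  ring.
exists (u0 * (1 - KLe b)); first by apply: in_AM => //; exact: in_A_1e.
rewrite e0 -mulrA; congr (_ * _); rewrite big_seq_cond [RHS]big_seq_cond; apply: eq_bigl => c.
rewrite /P; case: (boolP (c \in l)) => //= cl.
have -> : c != b by apply: contraTneq cl => ->.
by have -> : c != - b by apply: contraTneq cl => ->.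
Qed.

(** With [m = <la, b^vee>], the monomial [e(b) s_b e(la) = e(la + (1 - m) b)] differs from [e(la)]
    by a multiple of [1 - e(b)]. The left-hand side is the numerator of
    [a / (1 - e(b)) + s_b(a) / (1 - e(-b))] over [1 - e(b)]. *)
Lemma refl_antisym_div (Psi : {rmorphism KL V K -> KL V K}) b a : top_root b ->
  (forall c, Psi (KLC V c) = KLC V c) ->
  (forall v, L v -> Psi (KLe v) = KLe (refl ip b v)) -> in_A a ->
  exists2 y, in_A y & a - KLe b * Psi a = (1 - KLe b) * y.
Proof.
move=> tb PC Pe [s [sL ->]]; have Lb := top_root_L tb.
elim: s sL => [|t s IH] sL.
  by exists 0; [exact: in_A0|rewrite big_nil rmorph0 !mulr0 subr0].
have [|y Ay e] := IH; first by move=> u us; apply: sL; rewrite inE us orbT.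
have Lt := sL t (mem_head _ _).
have /intrP [m em] := S_int HD tb.1 Lt.
have [z Az ez] := KLe_shift_div K HD (1 - m) Lb Lt.
exists (- (KLC V t.1 * z) + y); first by apply: in_AD => //; apply/in_AN/in_AM => //; exact: in_A_C.
rewrite big_cons rmorphD rmorphM PC Pe // reflE em scaler_int.
rewrite [RHS]mulrDr -e [_ * - _]mulrN [(1 - KLe b) * (_ * _)]mulrCA -ez.
have -> : KLe (t.2 + b *~ (1 - m)) = KLe b * KLe (t.2 - b *~ m).
  rewrite -(KLeD K HD Lb); last by apply: (LB HD) => //; exact: (Lz HD).
  by congr KLe; rewrite mulrzBr mulr1z addrCA.
ring.
Qed.

Definition avg_term (nu : V) (w : 'End(V)) : KL V K :=
  KLe (w nu) / \prod_(b <- Bp) (1 - KLe (- w b)).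
Definition avg (nu : V) : KL V K := \sum_(w <- W0_seq) avg_term nu w.

Lemma avg_termE nu w : avg_term nu w = KLe (w nu) / \prod_(c <- denom_seq w) (1 - KLe c).
Proof. by rewrite /avg_term big_map. Qed.

Lemma denom_neq0 w : W0 w -> \prod_(c <- denom_seq w) (1 - KLe c) != 0.
Proof.
move=> hw; rewrite prodf_seq_neq0; apply/allP => c /(denom_seq_sub hw) cB.
by apply/implyP => _; exact: top_neq0.
Qed.

(* The terms of [w] and [s_b w] are paired, which removes the pole [1 - e(b)]. *)
Lemma avg_pprod nu b : L nu -> b \in Bs -> in_A (avg nu * pprod b).
Proof.
move=> Lnu bB; have tb : top_root b by apply/top_seqP.
have Lb := top_root_L tb; have hs := top_root_refl tb.
have [Psi [_ PC Pe]] := KLact_rmorphism K HD hs.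
have b0 := top_neq0 bB.
have Pp : Psi (pprod b) = pprod b.
  rewrite /pprod rmorph_prod.
  transitivity (\prod_(c <- [seq refl ip b c | c <- Bs] | (c != b) && (c != - b)) (1 - KLe c)).
    rewrite big_map; rewrite big_seq_cond [RHS]big_seq_cond; apply: eq_big => c.
      case: (boolP (c \in Bs)) => //= _.
      have e (x y : V) : (refl ip b x == y) = (x == refl ip b y).
        by apply/eqP/eqP => [<-|->]; rewrite reflK.
      by rewrite !e raddfN /= refl_self ?top_root_neq0 // opprK andbC.
    case/andP => /top_seqP /top_root_L Lc _.
    by rewrite rmorphB rmorph1 Pe.
  apply: perm_big; apply: uniq_perm; rewrite ?top_seq_uniq //.
    by rewrite map_inj_uniq ?top_seq_uniq //; exact: (can_inj (reflK _ _)).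
  move=> c; apply/mapP/idP => [[d /top_seqP td ->]|/top_seqP tc].
    by apply/top_seqP/top_root_W0.
  exists (refl ip b c); last by rewrite reflK.
  by apply/top_seqP/top_root_W0.
have term w : W0 w -> in_A ((avg_term nu w + avg_term nu (refl ip b \o w)%VF) * pprod b).
  move=> hw.
  have [u Au eu] := pprod_factor bB (denom_seq_uniq hw) (denom_seq_sub hw) (denom_seq_half hw).
  pose a := KLe (w nu) * u.
  have Aa : in_A a by apply: in_AM => //; apply/in_A_e/W0_L.
  have e1 : avg_term nu w * pprod b = a / (1 - KLe b).
    by rewrite avg_termE; exact: (div_mul_swap _ (denom_neq0 hw) b0 eu).
  have e2 : avg_term nu (refl ip b \o w)%VF = Psi (avg_term nu w).
    rewrite /avg_term fmorph_div Pe ?comp_lfunE; last exact: W0_L.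
    congr (_ / _); rewrite rmorph_prod; apply: eq_big_seq => c cB.
    rewrite rmorphB rmorph1 Pe ?comp_lfunE ?raddfN //.
    by apply/(LN HD)/W0_L => //; apply/top_root_L/Bp_top.
  rewrite mulrDl e1 e2 -[X in _ + _ * X]Pp -rmorphM e1 fmorph_div rmorphB rmorph1 Pe // refl_self ?top_root_neq0 //.
  have [y Ay ey] := refl_antisym_div tb PC Pe Aa.
  suff -> : a / (1 - KLe b) + Psi a / (1 - KLe (- b)) = y by [].
  have eb := one_sub_opp Lb.
  have nb : 1 - KLe (- b) != 0 by apply: contraNneq b0 => h; rewrite eb h mulr0.
  exact: (antisym_quotient b0 nb eb ey).
have e3 : \sum_(w <- W0_seq) (avg_term nu w + avg_term nu (refl ip b \o w)%VF) = avg nu + avg nu.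
  rewrite big_split; congr (_ + _).
  transitivity (\sum_(w <- [seq (refl ip b \o w)%VF | w <- W0_seq]) avg_term nu w).
    by rewrite big_map.
  exact: perm_big (W0_seq_mul hs).
(* Summing the pairs over the whole group counts every term twice; characteristic 0 permits the
   division by 2. *)
have two : KLC V (2%:R^-1) * (2%:R : KL V K) = 1.
  rewrite -KLCmE -(rmorph_nat (@KLCm R V K) 2) -rmorphM mulVf ?rmorph1 //.
  by have := K0 2; rewrite !inE /= => /negbT.
have -> : avg nu * pprod b = KLC V (2%:R^-1) *
   \sum_(w <- W0_seq) (avg_term nu w + avg_term nu (refl ip b \o w)%VF) * pprod b.
  by rewrite -mulr_suml e3; exact: half_double.
apply: in_AM => //; first exact: in_A_C.
by apply: in_A_sum_seq => // w /W0_seqP; exact: term.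
Qed.

(** The product over [top_seq] clears all poles at once. Each factor [1 - e(b)] can then be dropped
    again, because [pprod b], a product of factors coprime to it, also removes the pole along
    [1 - e(b)]. *)
Lemma avg_in_A nu : L nu -> in_A (avg nu).
Proof.
move=> Lnu.
have H (l : seq V) : {subset l <= Bs} -> in_A (avg nu * \prod_(c <- l) (1 - KLe c)) -> in_A (avg nu).
  elim: l => [|b l IH] lB; first by rewrite big_nil mulr1.
  have bB : b \in Bs by apply: lB; rewrite mem_head.
  have tb : top_root b by apply/top_seqP.
  have lB' : {subset l <= Bs} by move=> c cl; apply: lB; rewrite inE cl orbT.
  rewrite big_cons mulrCA => h; apply: IH => //.
  apply: (@in_A_coprime_prod _ _ _ _ HD b _ [seq c <- Bs | (c != b) && (c != - b)]) h _.
  - exact: top_root_L.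
  - exact: top_root_neq0.
  - by move=> c; rewrite mem_filter => /andP [_ /top_seqP]; exact: top_root_L.
  - move=> c; rewrite mem_filter => /andP [/andP [h1 h2] /top_seqP tc].
    exact: top_root_indep.
  rewrite big_filter -/(pprod b) mulrAC; apply: in_AM => //; first exact: avg_pprod.
  by apply: in_A_prod_seq => // c /lB' cB _; exact: in_A_1e_top.
apply: (H Bs) => //; rewrite mulr_suml; apply: in_A_sum_seq => // w /W0_seqP hw.
rewrite avg_termE (big_sub_split (denom_seq_uniq hw) top_seq_uniq (denom_seq_sub hw)).
rewrite mulrA divfK ?denom_neq0 //; apply: in_AM => //; first exact/in_A_e/W0_L.
by apply: in_A_prod_seq => // c cB _; exact: in_A_1e_top.
Qed.

End Averaging.
End DenominatorRoots.

Section Ratr.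
Variable F : fieldType.
Hypothesis F0 : [pchar F] =i pred0.

Lemma pchar0_intr_eq0 (m : int) : (m%:~R == 0 :> F) = (m == 0).
Proof.
have h := (pcharf0P F).1 F0.
by case: m => p; rewrite ?NegzE ?mulrNz ?oppr_eq0 -?pmulrn h.
Qed.

Lemma ratr_div (a b : int) : b != 0 -> ratr (a%:~R / b%:~R) = a%:~R / b%:~R :> F.
Proof.
move=> b0; set x : rat := _ / _; rewrite /ratr.
have d0 := denq_neq0 x.
apply/eqP; rewrite eqr_div ?pchar0_intr_eq0 // -!rmorphM /=.
suff -> : numq x * b = a * denq x by [].
apply: (@intr_inj rat); rewrite !rmorphM /= -[X in _ = _ * X]mulr1 numqE.
by rewrite /x mulr1 mulrAC divfK // intr_eq0.
Qed.

Lemma ratr_zmod : zmod_morphism (@ratr F).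
Proof.
move=> x y; rewrite -[x]divq_num_den -[y]divq_num_den subf_div ?intr_eq0 ?denq_neq0 //.
rewrite -!rmorphM -rmorphB /= !ratr_div ?mulf_neq0 ?denq_neq0 // subf_div ?pchar0_intr_eq0 ?denq_neq0 //.
by rewrite rmorphB !rmorphM.
Qed.

Lemma ratr_monoid : monoid_morphism (@ratr F).
Proof.
split; first by rewrite -[1]/(1%:~R) ratr_int.
move=> x y; rewrite -[x]divq_num_den -[y]divq_num_den mulf_div.
rewrite -!rmorphM /= !ratr_div ?mulf_neq0 ?denq_neq0 // mulf_div.
by rewrite !rmorphM.
Qed.

Lemma ratr_rmorphism : exists r : {rmorphism rat -> F}, r =1 ratr.
Proof.
pose m1 := GRing.isZmodMorphism.Build rat F (@ratr F) ratr_zmod.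
pose m2 := GRing.isMonoidMorphism.Build rat F (@ratr F) ratr_monoid.
pose r : {rmorphism rat -> F} := HB.pack (@ratr F) m1 m2.
by exists r.
Qed.
End Ratr.

(** * Identities over the rationals and their evaluations *)

Section RationalLists.
Context {R : realType} {V : vectType R} (D : data V).
Hypothesis HD : duality_data D.
Local Notation L := (dL D).

Definition rl_prod (l : seq V) : seq (rat * V) :=
  foldr (fun c s => s ++ [seq (- t.1, t.2 + c) | t <- s]) [:: (1, 0)] l.
Definition rl_mul (s1 s2 : seq (rat * V)) : seq (rat * V) :=
  [seq (t.1 * u.1, t.2 + u.2) | t <- s1, u <- s2].
Definition L_supp (C : eqType) (s : seq (C * V)) := forall t, t \in s -> L t.2.

Lemma L_supp_prod l : (forall c, c \in l -> L c) -> L_supp (rl_prod l).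
Proof.
elim: l => [|c l IH] lL t /=; first by rewrite inE => /eqP ->; exact: L0.
have lL' d : d \in l -> L d by move=> dl; apply: lL; rewrite inE dl orbT.
rewrite mem_cat => /orP [/(IH lL') //|/mapP [u /(IH lL') Lu ->]].
by apply: (LD HD) => //; apply: lL; rewrite mem_head.
Qed.
Lemma L_supp_mul s1 s2 : L_supp s1 -> L_supp s2 -> L_supp (rl_mul s1 s2).
Proof. by move=> h1 h2 t /allpairsP [[u v] [/h1 Lu /h2 Lv ->]]; apply: (LD HD). Qed.

Section Eval.
Variables (F : fieldType) (r : {rmorphism rat -> F}) (e : V -> F).
Hypotheses (e0 : e 0 = 1) (eD : forall u v, L u -> L v -> e (u + v) = e u * e v).
Definition rl_ev (s : seq (rat * V)) : F := \sum_(t <- s) r t.1 * e t.2.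

Lemma rl_ev_mul s1 s2 : L_supp s1 -> L_supp s2 -> rl_ev (rl_mul s1 s2) = rl_ev s1 * rl_ev s2.
Proof.
move=> h1 h2; rewrite /rl_ev big_allpairs_dep mulr_suml; apply: eq_big_seq => t /h1 Lt.
rewrite mulr_sumr; apply: eq_big_seq => u /h2 Lu.
by rewrite rmorphM eD // mulrACA.
Qed.
Lemma rl_ev_prod l : (forall c, c \in l -> L c) -> rl_ev (rl_prod l) = \prod_(c <- l) (1 - e c).
Proof.
elim: l => [|c l IH] lL; first by rewrite /rl_ev big_seq1 big_nil rmorph1 mul1r e0.
have lL' d : d \in l -> L d by move=> dl; apply: lL; rewrite inE dl orbT.
rewrite big_cons -(IH lL') mulrBl mul1r /rl_ev big_cat big_map -mulNr; congr (_ + _).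
rewrite mulr_sumr; apply: eq_big_seq => t ts.
rewrite rmorphN eD //; [ring|exact: (L_supp_prod lL' ts)|].
by apply: lL; rewrite mem_head.
Qed.
End Eval.

(** Equality in the rational group algebra is equality of coefficients, so it survives every field
    morphism and every function [e], multiplicative or not. *)
Lemma rl_transfer (s1 s2 : seq (rat * V)) : L_supp s1 -> L_supp s2 ->
  rl_ev (@KLCm R V rat) (KLe D rat) s1 = rl_ev (@KLCm R V rat) (KLe D rat) s2 ->
  forall (F : fieldType) (r : {rmorphism rat -> F}) (e : V -> F), rl_ev r e s1 = rl_ev r e s2.
Proof.
move=> h1 h2 E F r e.
pose s := s1 ++ [seq (- t.1, t.2) | t <- s2].
have ev (G : fieldType) (g : {rmorphism rat -> G}) (f : V -> G) :
    \sum_(t <- s) g t.1 * f t.2 = rl_ev g f s1 - rl_ev g f s2.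
  rewrite big_cat big_map -sumrN; congr (_ + _); apply: eq_bigr => t _.
  by rewrite rmorphN mulNr.
have sL : L_supp s by move=> t; rewrite mem_cat => /orP [/h1 //|/mapP [u /h2 Lu ->]].
have s0 : \sum_(t <- s) KLC V t.1 * KLe D rat t.2 = 0.
  by rewrite (ev _ (@KLCm R V rat) (KLe D rat)) E subrr.
apply/eqP; rewrite -subr_eq0 -ev; apply/eqP.
apply: (sum_by_support (phi := fun c v => r c * e v)) => [v|v x y|].
- by rewrite rmorph0 mul0r.
- by rewrite rmorphD mulrDl.
exact: (KLe_indep HD sL s0).
Qed.

Section AverageList.
Variable Bp : seq V.
Hypotheses (Bp_uniq : uniq Bp) (Bp_top : forall b, b \in Bp -> top_root D b)
  (Bp_half : forall b, b \in Bp -> - b \notin Bp).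

(** Over the rationals [avg_in_A] gives [u] through an equality of fractions, which cannot be
    evaluated directly. Multiplied by the product over [top_seq] it becomes an equality of two
    lists; after evaluation this product is cancelled, being non-zero by the assumption on [e]. *)
Lemma avg_universal nu : L nu -> exists2 u : seq (rat * V), L_supp u &
  forall (F : fieldType) (r : {rmorphism rat -> F}) (e : V -> F), e 0 = 1 ->
   (forall u v, L u -> L v -> e (u + v) = e u * e v) ->
   (forall c, top_root D c -> 1 - e c != 0) ->
   \sum_(w <- W0_seq D) e (w nu) / \prod_(b <- Bp) (1 - e (- w b)) = rl_ev r e u.
Proof.
move=> Lnu.
have [u [uL eu]] := avg_in_A HD (pchar_num _ : [pchar rat] =i pred0) Bp_uniq Bp_top Bp_half Lnu.
exists u => //.
pose lw (w : 'End(V)) := [seq c <- top_seq D | c \notin denom_seq Bp w].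
have lwL w c : c \in lw w -> L c.
  by rewrite mem_filter => /andP [_ /(top_seqP HD)]; exact: top_root_L.
have BL c : c \in top_seq D -> L c by move=> /(top_seqP HD); exact: top_root_L.
pose lhs := flatten [seq rl_mul [:: (1, (w : 'End(V)) nu)] (rl_prod (lw w)) | w <- W0_seq D].
have s1L w : W0 D w -> L_supp [:: ((1 : rat), w nu)].
  by move=> hw t; rewrite inE => /eqP ->; exact: W0_L.
have lhsL : L_supp lhs.
  move=> t /flatten_mapP [w /(W0_seqP HD) hw]; apply: L_supp_mul; first exact: s1L.
  by apply: L_supp_prod => c; exact: lwL.
pose rhs := rl_mul (rl_prod (top_seq D)) u.
have rhsL : L_supp rhs by apply: L_supp_mul => //; exact: L_supp_prod.
have key (F : fieldType) (r : {rmorphism rat -> F}) (e : V -> F) : e 0 = 1 ->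
   (forall u v, L u -> L v -> e (u + v) = e u * e v) ->
   (forall c, top_root D c -> 1 - e c != 0) ->
   rl_ev r e lhs = \prod_(c <- top_seq D) (1 - e c) *
     \sum_(w <- W0_seq D) e (w nu) / \prod_(b <- Bp) (1 - e (- w b)).
  move=> e0 eD ne; rewrite /rl_ev big_flatten big_map mulr_sumr.
  apply: eq_big_seq => w /(W0_seqP HD) hw.
  rewrite -/(rl_ev r e _) rl_ev_mul //; [|exact: s1L|by apply: L_supp_prod => c; exact: lwL].
  rewrite rl_ev_prod //; last by move=> c; exact: lwL.
  rewrite (big_sub_split (denom_seq_uniq Bp_uniq hw) (top_seq_uniq D)
    (denom_seq_sub HD Bp_top hw)).
  rewrite /rl_ev big_seq1 rmorph1 mul1r big_filter [X in _ = X * _ * _]big_map.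
  set d := \prod_(b <- Bp) _; have d0 : d != 0.
    rewrite prodf_seq_neq0; apply/allP => b bB; apply/implyP => _; apply: ne.
    by apply: top_root_opp => //; apply: top_root_W0 => //; exact: Bp_top.
  by rewrite mulrC [RHS]mulrC mulrA divfK // mulrC.
have E : rl_ev (@KLCm R V rat) (KLe D rat) lhs = rl_ev (@KLCm R V rat) (KLe D rat) rhs.
  rewrite key; [|exact: KLe0|by move=> *; exact: KLeD|]; last first.
    by move=> c tc; apply: KLe_neq1 => //; [exact: top_root_L|exact: (top_root_neq0 HD)].
  rewrite rl_ev_mul //; [|by move=> *; exact: KLeD|exact: L_supp_prod].
  rewrite rl_ev_prod //; [|exact: KLe0|by move=> *; exact: KLeD].
  by congr (_ * _); exact: eu.
move=> F r e e0 eD ne; have := rl_transfer lhsL rhsL E r e.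
rewrite key // rl_ev_mul //; last exact: L_supp_prod.
rewrite rl_ev_prod // => /mulfI; apply.
rewrite prodf_seq_neq0; apply/allP => b /(top_seqP HD) tb; apply/implyP => _; exact: ne.
Qed.
End AverageList.
End RationalLists.

(** * The average of a monomial over [Delta0], with formal parameters *)

Section Delta0Average.
Context {R : realType} {V : vectType R} (D : data V).
Hypothesis HD : duality_data D.
Local Notation ip := (dip D).
Local Notation L := (dL D).
Local Notation S := (dS D).
Local Notation pterm := (rat * pmonomial (R := R) (V := V))%type.

Lemma mulr2n_fst (a : V * R) : (a *+ 2).1 = a.1 *+ 2.
Proof. by case: a => v r; rewrite !mulr2n. Qed.
Lemma mulr2n_snd (a : V * R) : (a *+ 2).2 = a.2 *+ 2.
Proof. by case: a => v r; rewrite !mulr2n. Qed.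

Definition Delta0_set : set (V * R) := [set a | [/\ Spos D a, indivisible D a & a.2 = 0]].

Lemma Delta0_set_finite : finite_set Delta0_set.
Proof.
apply: sub_finite_set (S_bounded_finite HD 0) => a [_ [Sa _] a0].
by split => //; rewrite a0 lexx.
Qed.

Definition Delta0_seq : seq (V * R) := fset_set Delta0_set.
Lemma Delta0_seqP a : a \in Delta0_seq <-> Delta0_set a.
Proof. by rewrite /Delta0_seq (in_fset_set Delta0_set_finite) inE. Qed.
Lemma Delta0_seq_uniq : uniq Delta0_seq.
Proof. exact: fset_uniq. Qed.
Lemma Delta0_seq_S a : a \in Delta0_seq -> S a /\ a.2 = 0.
Proof. by move=> /Delta0_seqP [_ [Sa _] a0]. Qed.

(** The exponent in the denominator of the inverse factor of [a]: if [2a] is a root, [1 - e(-2a)]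
    stays; otherwise [k(2a) = 0], the factor [1 + e(-a)] cancels and [1 - e(-a)] is left. *)
Definition top_of (a : V * R) : V := if `[< S (a *+ 2) >] then (a *+ 2).1 else a.1.
Definition denom_tops : seq V := [seq top_of a | a <- Delta0_seq].

Lemma double_linear (a : V * R) : a.2 = 0 -> a *+ 2 = (a.1 *+ 2, 0).
Proof. by move=> a0; rewrite [LHS]surjective_pairing mulr2n_fst mulr2n_snd a0 mul0rn. Qed.

Lemma denom_tops_top b : b \in denom_tops -> top_root D b.
Proof.
move=> /mapP [a /Delta0_seq_S [Sa a0] ->].
have ea : a = (a.1, 0) by rewrite [LHS]surjective_pairing a0.
rewrite /top_of; case: asboolP => [|ns]; last first.
  by split; [rewrite -ea|rewrite -(double_linear a0)].
rewrite double_linear //= => S2; split => // S4.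
have S1 : S (a.1, 0) by rewrite -ea.
(* A ratio 4 does not occur between linear roots. *)
have e4 : a.1 *+ 2 *+ 2 = 4 *: a.1 by rewrite -mulrnA scaler_nat.
have := S_linear_proportional HD S1 S4 e4.
by case=> -[]; lra.
Qed.

(** Two roots with the same top are equal, or one is twice the other, which indivisibility
    excludes. *)
Lemma denom_tops_uniq : uniq denom_tops.
Proof.
rewrite map_inj_in_uniq ?Delta0_seq_uniq // => a b /Delta0_seqP [_ [Sa na] a0] /Delta0_seqP [_ [Sb nb] b0].
have ea : a = (a.1, 0) by rewrite [LHS]surjective_pairing a0.
have eb : b = (b.1, 0) by rewrite [LHS]surjective_pairing b0.
rewrite /top_of; case: asboolP => h1; case: asboolP => h2; rewrite ?mulr2n_fst => e.
- rewrite ea eb; congr (_, _); apply: (@scalerI _ _ 2) => //.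
  by rewrite !scaler_nat.
- by exfalso; apply: nb; exists a => //; rewrite double_linear // e.
- by exfalso; apply: na; exists b => //; rewrite double_linear // -e.
by rewrite ea eb e.
Qed.

Lemma denom_tops_half b : b \in denom_tops -> - b \notin denom_tops.
Proof.
have [x0 [reg pos]] := positive_vector HD.
have H c : c \in denom_tops -> 0 < ip c x0.
  move=> /mapP [a /Delta0_seqP [/(SposP HD reg pos) [Sa da] _ a0] ->].
  have h : 0 < ip a.1 x0 by case: da => [|[]//]; rewrite a0 ltxx.
  by rewrite /top_of; case: asboolP => _ //; rewrite mulr2n_fst mulr2n ipDl addr_gt0.
move=> /H h; apply/negP => /H; rewrite ipNl oppr_gt0 => h'.
by have := lt_trans h h'; rewrite ltxx.
Qed.

(* Formal sums of terms [c q^m e(v)] with [c] rational and [m] a monomial in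
   the labels; [(1, (0, [::]))] is the monomial [1]. *)
Definition plist : Type := seq (pterm * V).
Definition pm_one : pterm := (1, (0, [::])).
Definition pm_mul (x y : pterm) : pterm :=
  (x.1 * y.1, (x.2.1 + y.2.1, x.2.2 ++ y.2.2)).
Definition pl_mul (s t : plist) : plist := [seq (pm_mul x.1 y.1, x.2 + y.2) | x <- s, y <- t].

(** The polynomial behind [num_factor a], with each label kept as a symbol in the exponent, so that
    one list serves all labellings and all fields. *)
Definition num_list (a : V * R) : plist :=
  pl_mul [:: (pm_one, 0); ((-1, (0, [:: (1, a)])), - a.1)]
    (if `[< S (a *+ 2) >] then [:: (pm_one, 0); ((1, (0, [:: (1, a *+ 2)])), - a.1)]
     else [:: (pm_one, 0)]).
Definition numerator (l : seq (V * R)) : plist := foldr (fun a s => pl_mul (num_list a) s) [:: (pm_one, 0)] l.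
Definition numerator_list : plist := numerator Delta0_seq.

Definition pl_over (s : plist) := forall t, t \in s ->
  L t.2 /\ forall u, u \in t.1.2.2 -> S u.2.

Lemma pl_over_mul s t : pl_over s -> pl_over t -> pl_over (pl_mul s t).
Proof.
move=> hs ht x /allpairsP [[u v] [/hs [Lu Su] /ht [Lv Sv] ->]]; split => /=.
  exact: (LD HD).
by move=> y; rewrite mem_cat => /orP [/Su|/Sv].
Qed.

Lemma pl_over_one : pl_over [:: (pm_one, 0)].
Proof. by move=> t; rewrite inE => /eqP -> /=; split; [exact: L0|]. Qed.

Lemma pl_over_binomial c (a : V * R) v : S a -> L v ->
  pl_over [:: (pm_one, 0); ((c, (0, [:: (1, a)])), v)].
Proof.
move=> Sa Lv t; rewrite !inE => /orP [] /eqP -> /=; split => //; first exact: L0.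
by move=> u; rewrite inE => /eqP ->.
Qed.

Lemma pl_over_num_factors a : S a ->
  pl_over [:: (pm_one, 0); ((-1, (0, [:: (1, a)])), - a.1)] /\
  pl_over (if `[< S (a *+ 2) >] then [:: (pm_one, 0); ((1, (0, [:: (1, a *+ 2)])), - a.1)]
     else [:: (pm_one, 0)]).
Proof.
move=> Sa; have LNa : L (- a.1) by apply: (LN HD); exact: S_L.
split; first exact: pl_over_binomial.
by case: asboolP => S2; [exact: pl_over_binomial|exact: pl_over_one].
Qed.

Lemma pl_over_numerator l : (forall a, a \in l -> S a) -> pl_over (numerator l).
Proof.
elim: l => [|a l IH] h; first exact: pl_over_one.
apply: pl_over_mul; last by apply: IH => b bl; apply: h; rewrite inE bl orbT.
by have [] := pl_over_num_factors (h a (mem_head _ _)); exact: pl_over_mul.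
Qed.

Section Eval.
Variables (k : V * R -> R) (F : fieldType) (r : {rmorphism rat -> F}) (qF : R -> F).
Hypotheses (rE : r =1 ratr) (qF0 : qF 0 = 1) (qFD : forall x y, qF (x + y) = qF x * qF y).

Definition pm_ev (m : pterm) : F := ratr m.1 * qF (pexponent k m.2).
Definition pl_ev (e : V -> F) (s : plist) : F := \sum_(t <- s) pm_ev t.1 * e t.2.

Lemma pexponent_cat (x y : pmonomial (R := R) (V := V)) :
  pexponent k (x.1 + y.1, x.2 ++ y.2) = pexponent k x + pexponent k y.
Proof. by rewrite /pexponent /= big_cat addrACA. Qed.

Lemma pm_ev_mul x y : pm_ev (pm_mul x y) = pm_ev x * pm_ev y.
Proof. by rewrite /pm_ev /= pexponent_cat -!rE rmorphM qFD mulrACA. Qed.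

Lemma pm_ev_one : pm_ev pm_one = 1.
Proof. by rewrite /pm_ev -rE rmorph1 mul1r /pexponent big_nil addr0. Qed.

Variable e : V -> F.
Hypotheses (e0 : e 0 = 1) (eD : forall u v, L u -> L v -> e (u + v) = e u * e v).

Lemma pl_ev_mul s t : pl_over s -> pl_over t -> pl_ev e (pl_mul s t) = pl_ev e s * pl_ev e t.
Proof.
move=> hs ht; rewrite /pl_ev big_allpairs_dep mulr_suml; apply: eq_big_seq => x /hs [Lx _].
rewrite mulr_sumr; apply: eq_big_seq => y /ht [Ly _].
by rewrite pm_ev_mul eD // mulrACA.
Qed.

Lemma pl_ev_one : pl_ev e [:: (pm_one, 0)] = 1.
Proof. by rewrite /pl_ev big_seq1 pm_ev_one e0 mul1r. Qed.

Definition num_factor (a : V * R) : F :=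
  (1 - qF (k a) * e (- a.1)) *
  (if `[< S (a *+ 2) >] then 1 + qF (k (a *+ 2)) * e (- a.1) else 1).

Lemma pl_ev_num a : S a -> pl_ev e (num_list a) = num_factor a.
Proof.
move=> /pl_over_num_factors [h1 h2].
have pe (b : V * R) : pexponent k (0, [:: ((1 : int), b)]) = k b.
  by rewrite /pexponent big_seq1 add0r mul1r.
rewrite pl_ev_mul //; congr (_ * _).
  rewrite /pl_ev big_cons big_seq1 pm_ev_one e0 mul1r; congr (_ + _).
  by rewrite /pm_ev pe /= -rE rmorphN1 mulN1r mulNr.
case: asboolP => S2; last exact: pl_ev_one.
rewrite /pl_ev big_cons big_seq1 pm_ev_one e0 mul1r; congr (_ + _).
by rewrite /pm_ev pe /= -rE rmorph1 mul1r.
Qed.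

Lemma pl_ev_numerator l : (forall a, a \in l -> S a) ->
  pl_ev e (numerator l) = \prod_(a <- l) num_factor a.
Proof.
elim: l => [|a l IH] h; first by rewrite big_nil pl_ev_one.
have Sa : S a by apply: h; rewrite mem_head.
have hl b : b \in l -> S b by move=> bl; apply: h; rewrite inE bl orbT.
rewrite /= pl_ev_mul; [|by have [] := pl_over_num_factors Sa; exact: pl_over_mul|exact: pl_over_numerator].
by rewrite big_cons pl_ev_num // IH.
Qed.

Hypothesis e_regular : forall v, S (v, 0) -> e v ^+ 2 != 1.

Lemma top_root_regular c : top_root D c -> 1 - e c != 0.
Proof.
case=> Sc _; apply: contra (e_regular Sc) => /eqP h.
have -> : e c = 1 by apply/eqP; rewrite eq_sym -subr_eq0 h.
by rewrite expr1n.
Qed.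

(** For [2a] outside [S] the factor [1 + e(-a)] has to be non-zero in order to cancel; this is why
    [e_regular] speaks of squares. *)
Lemma weight_factor_inv a : S a -> a.2 = 0 ->
  (weight_factor D k qF e a (- a))^-1 = num_factor a / (1 - e (- top_of a)).
Proof.
move=> Sa a0.
have ea : a = (a.1, 0) by rewrite [LHS]surjective_pairing a0.
have LNa : L (- a.1) by apply: (LN HD); exact: S_L.
have Sna : S (- a.1, 0) by apply: (S_linear_opp HD); rewrite -ea.
have := e_regular Sna; rewrite -subr_eq0 -opprB oppr_eq0 => hr.
have e1 : eaff qF e (- a) = e (- a.1) by rewrite /eaff /= a0 oppr0 qF0 mul1r.
have e2 : eaff qF e ((- a) *+ 2) = e (- a.1) ^+ 2.
  by rewrite /eaff mulr2n_fst mulr2n_snd /= a0 oppr0 mul0rn qF0 mul1r mulr2n eD.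
rewrite /weight_factor e1 e2 /num_factor /top_of invf_div /k2.
case: asboolP => S2; first by rewrite mulr2n_fst -mulNrn mulr2n eD.
rewrite qF0 mul1r mulr1.
set x := e (- a.1) in hr *; have hx : 1 - x ^+ 2 = (1 - x) * (1 + x) by ring.
have : (1 - x) * (1 + x) != 0 by rewrite -hx.
rewrite mulf_eq0 negb_or => /andP [x1 x2]; rewrite hx.
by rewrite -mulf_div divff // mulr1.
Qed.

Lemma Delta0_inv : (Delta0 D k qF e)^-1 =
  pl_ev e numerator_list / \prod_(b <- denom_tops) (1 - e (- b)).
Proof.
rewrite pl_ev_numerator => [|a /Delta0_seq_S [] //]; rewrite /Delta0 -/Delta0_set (fsbig_finite _ _ Delta0_set_finite) /=.
rewrite -/Delta0_seq big_map -prodfV -prodf_div; apply: eq_big_seq => a.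
by move=> /Delta0_seq_S [Sa a0]; exact: weight_factor_inv.
Qed.
End Eval.

(** Once the numerator of [1 / Delta0] is expanded into monomials [q^m e(nu)], the rational average
    applies to each [e(la + nu)], with the parameters as constants. The labels, the field and [e]
    are quantified after [T], so the same list is valid in [K(L)] and at the points of the torus. *)
Lemma avg_Delta0 la : L la -> exists2 T : plist, pl_over T &
  forall (k : V * R -> R) (F : fieldType) (r : {rmorphism rat -> F}) (qF : R -> F) (e : V -> F),
  r =1 ratr -> qF 0 = 1 -> (forall x y, qF (x + y) = qF x * qF y) ->
  e 0 = 1 -> (forall u v, L u -> L v -> e (u + v) = e u * e v) ->
  (forall v, S (v, 0) -> e v ^+ 2 != 1) ->
  \sum_(w <- W0_seq D) e (w la) / Delta0 D k qF (e \o w) = pl_ev k qF e T.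
Proof.
move=> Lla.
have U nu : {u : seq (rat * V) | L nu -> L_supp D u /\
  forall (F : fieldType) (r : {rmorphism rat -> F}) (e : V -> F), e 0 = 1 ->
   (forall u v, L u -> L v -> e (u + v) = e u * e v) ->
   (forall c, top_root D c -> 1 - e c != 0) ->
   \sum_(w <- W0_seq D) e (w nu) / \prod_(b <- denom_tops) (1 - e (- w b)) = rl_ev r e u}.
  apply: cid; have [Lnu|nL] := pselect (L nu); last by exists [::].
  have [u h1 h2] := avg_universal HD denom_tops_uniq denom_tops_top denom_tops_half Lnu.
  by exists u.
pose u nu := sval (U nu).
pose N := numerator_list.
have NL : pl_over N by apply: pl_over_numerator => a /Delta0_seq_S [].
exists [seq ((t.1.1 * s.1, t.1.2), s.2) | t <- N, s <- u (la + t.2)].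
  move=> x /allpairsPdep [t [s [tN su ->]]] /=.
  have [Lt St] := NL _ tN; split => //.
  by have [h _] := svalP (U (la + t.2)) (LD HD Lla Lt); apply: h.
move=> k F r qF e rE qF0 qFD e0 eD ereg.
transitivity (\sum_(w <- W0_seq D) \sum_(t <- N) pm_ev k qF t.1 *
    (e (w (la + t.2)) / \prod_(b <- denom_tops) (1 - e (- w b)))).
  apply: eq_big_seq => w /(W0_seqP HD) hw.
  have f0 : (e \o w) 0 = 1 by rewrite /= raddf0.
  have fD x y : L x -> L y -> (e \o w) (x + y) = (e \o w) x * (e \o w) y.
    by move=> Lx Ly; rewrite /= raddfD eD //; exact: W0_L.
  have freg v : S (v, 0) -> (e \o w) v ^+ 2 != 1.
    by move=> Sv; apply: ereg; exact: (S_W0 HD hw Sv).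
  rewrite (Delta0_inv k rE qF0 qFD f0 fD freg) /=.
  rewrite mulrA /pl_ev mulr_sumr mulr_suml; apply: eq_big_seq => t tN.
  have [Lt _] := NL _ tN.
  rewrite /= raddfD eD; [|exact: W0_L|exact: W0_L].
  under [in RHS]eq_bigr do rewrite -raddfN.
  by rewrite mulrCA !mulrA.
rewrite exchange_big /= /pl_ev big_allpairs_dep; apply: eq_big_seq => t tN.
have [Lt _] := NL _ tN.
have [uL h] := svalP (U (la + t.2)) (LD HD Lla Lt).
rewrite -mulr_sumr (h F r e e0 eD); last by move=> c; apply: top_root_regular.
rewrite /rl_ev mulr_sumr; apply: eq_bigr => s _.
by rewrite /pm_ev /= -!rE rmorphM mulrACA !mulrA.
Qed.

End Delta0Average.

(** * Rational functions of the parameters *)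

Local Open Scope complex_scope.

Section NumericalParameters.
Context {R : realType}.

Lemma qnumD (q0 x y : R) : 0 < q0 -> qnum q0 (x + y) = qnum q0 x * qnum q0 y.
Proof.
move=> h; rewrite /qnum -rmorphM powRD //; apply/implyP => _.
by rewrite gt_eqF.
Qed.

Lemma qnum0 (q0 : R) : qnum q0 0 = 1.
Proof. by rewrite /qnum powRr0. Qed.

(** At [q0 = exp(-(j + 1))] the sum becomes a weighted sum of the powers of [exp(-x)] with exponent
    [j + 1]. The shift by 1 keeps [q0] below 1; thus the weights annihilate all polynomials without
    constant term, and interpolation isolates [y]. *)
Lemma powR_independent (s : seq (rat * R)) :
  (forall q0 : R, 0 < q0 < 1 -> \sum_(t <- s) ratr t.1 * qnum q0 t.2 = 0) ->
  forall y, \sum_(t <- s | t.2 == y) t.1 = 0.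
Proof.
move=> H y; pose z (x : R) := expR (- x).
have zinj : injective z by move=> u v /expR_inj /oppr_inj.
have E1 (j : nat) : \sum_(t <- s) ratr t.1 * z t.2 ^+ j.+1 = 0 :> R.
  have := H (expR (- j.+1%:R)); rewrite expR_gt0 expR_lt1 oppr_lt0 ltr0n => /(_ isT) h.
  apply: (@complexI R); rewrite rmorph0 -h rmorph_sum; apply: eq_bigr => t _.
  have rC c : (ratr c : R)%:C = ratr c :> R[i].
    exact: (fmorph_eq_rat (real_complex R \o @ratr R : {rmorphism rat -> R[i]}) c).
  rewrite rmorphM /= rC /qnum -expRM; congr (_ * _ %:C).
  by rewrite mulNr -mulrN mulrC expRM_natr.
have E2 (P : {poly R}) : \sum_(t <- s) ratr t.1 * (z t.2 * P.[z t.2]) = 0 :> R.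
  under eq_bigr do rewrite horner_coef mulr_sumr mulr_sumr.
  rewrite exchange_big /= big1 // => i _.
  transitivity (P`_i * \sum_(t <- s) ratr t.1 * z t.2 ^+ i.+1); last by rewrite E1 mulr0.
  by rewrite mulr_sumr; apply: eq_bigr => t _; rewrite exprS; ring.
pose P := \prod_(x <- undup [seq t.2 | t <- s] | x != y) ('X - (z x)%:P).
have Py : P.[z y] != 0.
  rewrite horner_prod prodf_seq_neq0; apply/allP => x _; apply/implyP => xy.
  by rewrite !hornerE subr_eq0; apply: contra xy => /eqP /zinj ->.
have Px t : t \in s -> t.2 != y -> P.[z t.2] = 0.
  move=> ts ty; apply/eqP; rewrite horner_prod prodf_seq_eq0; apply/hasP; exists t.2.
    by rewrite mem_undup map_f.
  by rewrite ty !hornerE subrr eqxx.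
have zy0 : z y * P.[z y] != 0 by rewrite mulf_neq0 // gt_eqF // expR_gt0.
have := E2 P; rewrite (bigID (fun t => t.2 == y)) /= [X in _ + X]big1_seq ?addr0; last first.
  by move=> t /andP [ty ts]; rewrite Px // !mulr0.
move=> e; apply: (fmorph_inj (@ratr R : {rmorphism rat -> R})); rewrite rmorph0 rmorph_sum.
apply: (mulIf zy0); rewrite mul0r -[RHS]e mulr_suml.
by apply: eq_bigr => t /eqP ->.
Qed.

Lemma small_avoiding (l : seq R) (d : R) : 0 < d -> exists t : R, [/\ 0 < t, t < d & t \notin l].
Proof.
move=> d0; suff [u [u0 ud hu]] : exists u : R, [/\ 0 < u, u < d & forall x, x \in l -> 0 < x -> u < x].
  exists u; split => //; apply/negP => /hu h; have := h u0; by rewrite ltxx.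
elim: l => [|x l [u [u0 ud IH]]].
  by exists (d / 2); split => //; [rewrite divr_gt0|rewrite ltr_pdivrMr //; lra].
have [x0|x0] := ltP 0 x; last first.
  by exists u; split => // y; rewrite inE => /orP [/eqP -> |/IH //]; rewrite ltNge x0.
exists (Num.min u (x / 2)); split; first by rewrite lt_min u0 divr_gt0.
  by rewrite gt_min ud.
move=> y; rewrite inE => /orP [/eqP -> _|yl y0]; rewrite gt_min.
  by rewrite orbC ltr_pdivrMr //; lra.
by rewrite IH.
Qed.

End NumericalParameters.

(** * From positive labels and numerical [q] to the given parameters *)

Section SpecializedParameters.
Context {R : realType} {V : vectType R} (D : data V).
Context (K : fieldType) (q : R -> K) (star : K -> K) (k : V * R -> R).
Hypothesis K0 : [pchar K] =i pred0.
Hypothesis qn0 : forall x, q x != 0.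
Hypothesis qD : forall x y, q (x + y) = q x * q y.
Hypothesis Hk : labelling D k.
Local Notation S := (dS D).
Local Notation pterm := (rat * pmonomial (R := R) (V := V))%type.
Local Notation ppolyRV := (ppoly (R := R) (V := V)).

Lemma q_0 : q 0 = 1.
Proof. by apply: (mulfI (qn0 0)); rewrite -qD addr0 mulr1. Qed.

Definition ppmul (p1 p2 : ppolyRV) : ppolyRV :=
  [seq pm_mul x y | x <- p1, y <- p2].

Lemma ppoly_over_mul p1 p2 : ppoly_over S p1 -> ppoly_over S p2 -> ppoly_over S (ppmul p1 p2).
Proof.
move=> h1 h2 c m t /allpairsP [[[c1 m1] [c2 m2]] [/= x1 x2 [_ ->]]] /=.
by rewrite mem_cat => /orP [/(h1 _ _ _ x1)|/(h2 _ _ _ x2)].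
Qed.
Lemma ppoly_over_add p1 p2 : ppoly_over S p1 -> ppoly_over S p2 -> ppoly_over S (p1 ++ p2).
Proof. by move=> h1 h2 c m t; rewrite mem_cat => /orP [/h1 h|/h2 h]; apply: h. Qed.

Section PevalMorph.
Variables (F : fieldType) (qF : R -> F) (k' : V * R -> R).
Hypotheses (F0 : [pchar F] =i pred0) (qFD : forall x y, qF (x + y) = qF x * qF y).

Lemma peval_add p1 p2 : peval qF k' (p1 ++ p2) = peval qF k' p1 + peval qF k' p2.
Proof. exact: big_cat. Qed.

Lemma peval_mul p1 p2 : peval qF k' (ppmul p1 p2) = peval qF k' p1 * peval qF k' p2.
Proof.
have [r rE] := ratr_rmorphism F0.
rewrite /peval big_allpairs_dep mulr_suml; apply: eq_bigr => x _.
rewrite mulr_sumr; apply: eq_bigr => y _.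
exact: (pm_ev_mul k' rE qFD).
Qed.
End PevalMorph.

(* [k] need not be positive; the labels [1 + t (k - 1)] are, for small [t > 0],
   and for almost all [t] they do not identify exponents that differ at [k]. The
   truncation at [M] only matters for labels which do not occur. *)
Definition interp_label (M t : R) (a : V * R) : R :=
  1 + t * (Num.max (- M) (Num.min M (k a)) - 1).

Lemma interp_label_positive M t : 0 <= M -> 0 < t -> t < (M + 1)^-1 ->
  positive_labelling D (interp_label M t).
Proof.
move=> M0 t0 tM; split=> [la w a h1 h2 h3|a Sa]; first by rewrite /interp_label Hk.
rewrite /interp_label; set c := Num.max _ _.
have hc : - M <= c by rewrite le_max lexx.
have : t * (M + 1) < 1 by rewrite -ltr_pdivlMr ?div1r //; lra.
nra.
Qed.

(** For the labels [interp_label M t], [powR_independent] makes the coefficients vanish in groups of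
    equal exponent. By the choice of [t], exponents equal there are also equal at [k], so each group
    contributes 0 at [q] and [k]. *)
Lemma peval_zero_transfer (p : ppolyRV) : ppoly_over S p ->
  (forall q0 k', 0 < q0 < 1 -> positive_labelling D k' -> peval (qnum q0) k' p = 0) ->
  peval q k p = 0.
Proof.
move=> pS H.
pose M := \sum_(x <- p) \sum_(u <- x.2.2) `|k u.2|.
have M0 : 0 <= M by apply: sumr_ge0 => x _; apply: sumr_ge0.
have kM x u : x \in p -> u \in x.2.2 -> Num.max (- M) (Num.min M (k u.2)) = k u.2.
  move=> xp ux; have : `|k u.2| <= M.
    rewrite /M (big_rem x) //= (big_rem u) //= -addrA lerDl.
    by apply: addr_ge0; apply: sumr_ge0 => // y _; apply: sumr_ge0.
  by rewrite ler_norml => /andP [h1 h2]; rewrite min_r // max_r.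
pose A (x : pterm) := pexponent (fun _ : V * R => 1 : R) x.2.
pose E (x : pterm) := pexponent k x.2.
have pe t x : x \in p -> pexponent (interp_label M t) x.2 = A x + t * (E x - A x).
  move=> xp; rewrite /A /E /pexponent opprD addrACA subrr add0r -sumrB mulr_sumr -addrA -big_split.
  congr (_ + _); apply: eq_big_seq => u ux.
  by rewrite /interp_label (kM _ _ xp ux) /=; ring.
(* The values of [t] at which two exponents [A + t (E - A)] coincide. A zero denominator means that
   their difference does not depend on [t] and equals the difference at [k]. *)
pose bad := [seq (A x - A y) / ((A x - A y) - (E x - E y)) | x <- p, y <- p].
have [|t [t0 tM tbad]] := @small_avoiding _ bad (M + 1)^-1; first by rewrite invr_gt0; lra.
pose X (x : pterm) := pexponent (interp_label M t) x.2.
have XE x y : x \in p -> y \in p -> X x = X y -> E x = E y.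
  move=> xp yp; rewrite /X !pe // => e.
  have : (A x - A y) / ((A x - A y) - (E x - E y)) \in bad.
    exact: (allpairs_f (fun x y => (A x - A y) / ((A x - A y) - (E x - E y)))).
  move=> hb; have tne : t != (A x - A y) / ((A x - A y) - (E x - E y)).
    by apply: contraNneq tbad => ->.
  have [z|nz] := eqVneq ((A x - A y) - (E x - E y)) 0.
    nra.
  exfalso; case/eqP: tne; apply: (canRL (mulfK nz)); nra.
pose s := [seq (x.1, X x) | x <- p].
have s0 y : \sum_(u <- s | u.2 == y) u.1 = 0.
  apply: powR_independent => q0 hq.
  rewrite big_map; exact: (H q0 (interp_label M t) hq (interp_label_positive M0 t0 tM)).
have [r rE] := ratr_rmorphism K0.
(* Recovers the exponent at [k] from the one at the interpolated labels; [XE] makes this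
   unambiguous. *)
pose f (y : R) : R := xget 0 [set z | exists2 x, x \in p & X x = y /\ z = E x].
have fE x : x \in p -> f (X x) = E x.
  move=> xp; rewrite /f; case: xgetP => [z _ [y yp [e ->]]|/(_ (E x))]; first exact: XE.
  by case; exists x.
have := sum_by_support (phi := fun c y => r c * q (f y)) _ _ s0.
rewrite big_map => h; rewrite /peval -[RHS]h => [|v|v x y].
- by apply: eq_big_seq => x xp; rewrite rE fE.
- by rewrite rmorph0 mul0r.
by rewrite rmorphD mulrDl.
Qed.

Section CtValues.
Variable T : R -> (V * R -> R) -> R[i].

(* [x] is the value at [q], [k] of the rational function of the parameters which
   computes [I / T]; [ct_value] is an instance. *)
Definition ctv (I : R -> (V * R -> R) -> R[i]) (x : K) : Prop :=
  exists P Q : ppolyRV,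
  [/\ ppoly_over S P, ppoly_over S Q, peval q k Q != 0, x = peval q k P / peval q k Q &
      forall (q0 : R) (k' : V * R -> R), 0 < q0 < 1 -> positive_labelling D k' ->
        peval (qnum q0) k' P * T q0 k' = peval (qnum q0) k' Q * I q0 k'].

Let C0 : [pchar R[i]] =i pred0 := @pchar_num _.
Let qnD (q0 : R) : 0 < q0 < 1 -> forall x y, qnum q0 (x + y) = qnum q0 x * qnum q0 y.
Proof. by case/andP => h _ x y; exact: qnumD. Qed.

Lemma ctv_ext I J x : (forall q0 k', 0 < q0 < 1 -> positive_labelling D k' -> I q0 k' = J q0 k') ->
  ctv I x -> ctv J x.
Proof.
move=> IJ [P [Q [h1 h2 h3 h4 h5]]]; exists P, Q; split => // q0 k' hq hk.
by rewrite -IJ // h5.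
Qed.

Lemma ctv_add I J x y : ctv I x -> ctv J y -> ctv (fun q0 k' => I q0 k' + J q0 k') (x + y).
Proof.
move=> [P [Q [h1 h2 h3 -> h5]]] [P' [Q' [h1' h2' h3' -> h5']]].
exists (ppmul P Q' ++ ppmul P' Q), (ppmul Q Q'); split.
- by apply: ppoly_over_add; exact: ppoly_over_mul.
- exact: ppoly_over_mul.
- by rewrite peval_mul // mulf_neq0.
- by rewrite peval_add !peval_mul // addf_div.
move=> q0 k' hq hk; rewrite peval_add !(peval_mul _ C0 (qnD hq)).
rewrite mulrDl [_ * peval _ _ Q' * _]mulrAC h5 // [_ * peval _ _ Q * _]mulrAC h5' //.
ring.
Qed.

Lemma ctv_scale m I x : (forall u, u \in m.2.2 -> S u.2) -> ctv I x ->
  ctv (fun q0 k' => pm_ev k' (qnum q0) m * I q0 k') (pm_ev k q m * x).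
Proof.
move=> mS [P [Q [h1 h2 h3 -> h5]]].
have e (F : fieldType) (qF : R -> F) k' : peval qF k' [:: m] = pm_ev k' qF m by exact: big_seq1.
exists (ppmul [:: m] P), Q; split => //.
- apply: ppoly_over_mul => // c m' t; rewrite inE => /eqP em.
  by move: mS; rewrite -em => mS /mS.
- by rewrite peval_mul // e mulrA.
move=> q0 k' hq hk; rewrite (peval_mul _ C0 (qnD hq)) e.
by rewrite -mulrA h5 // mulrCA.
Qed.

Lemma ctv_0 : ctv (fun _ _ => 0) 0.
Proof.
have e (F : fieldType) (qF : R -> F) k' : peval qF k' [:: pm_one] = pm_ev k' qF pm_one by exact: big_seq1.
have [r rE] := ratr_rmorphism K0.
exists [::], [:: pm_one]; split => //.
- by move=> c m t; rewrite inE => /eqP [_ ->].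
- by rewrite e (pm_ev_one k rE q_0) oner_eq0.
- by rewrite /peval big_nil mul0r.
by move=> q0 k' hq hk; rewrite {1}/peval big_nil mul0r mulr0.
Qed.

Lemma ctv_sum (s : seq (pterm * V))
    (I : V -> R -> (V * R -> R) -> R[i]) (Y : V -> K) :
  (forall t, t \in s -> (forall u, u \in t.1.2.2 -> S u.2) /\ ctv (I t.2) (Y t.2)) ->
  ctv (fun q0 k' => \sum_(t <- s) pm_ev k' (qnum q0) t.1 * I t.2 q0 k')
      (\sum_(t <- s) pm_ev k q t.1 * Y t.2).
Proof.
elim: s => [|t s IH] h.
  rewrite big_nil; apply: ctv_ext ctv_0 => *; by rewrite big_nil.
rewrite big_cons; have [h1 h2] := h t (mem_head _ _).
have h3 := IH (fun u us => h u (mem_behead (us : u \in behead (t :: s)))).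
by apply: ctv_ext (ctv_add (ctv_scale h1 h2) h3) => *; rewrite big_cons.
Qed.

(** The two representations give [(P Q' - P' Q) T = 0], where [T] is not known to be non-zero. The
    representation of [N] helps: [(P Q' - P' Q) Q0 N = (P Q' - P' Q) P0 T = 0], and here [N] can be
    cancelled. So [(P Q' - P' Q) Q0] vanishes for positive labels, hence at [q] and [k], where [Q0]
    does not vanish. *)
Lemma ctv_unique N x0 I x y :
  (forall q0 k', 0 < q0 < 1 -> positive_labelling D k' -> N q0 k' != 0) ->
  ctv N x0 -> ctv I x -> ctv I y -> x = y.
Proof.
move=> N0 [P0 [Q0 [a1 a2 a3 _ a5]]] [P [Q [h1 h2 h3 -> h5]]] [P' [Q' [h1' h2' h3' -> h5']]].
pose m1 : ppolyRV := [:: ((-1 : rat), ((0 : R), [::]))].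
have e (F : fieldType) (qF : R -> F) k' : [pchar F] =i pred0 -> qF 0 = 1 -> peval qF k' m1 = -1.
  move=> F0 q1; have [r rE] := ratr_rmorphism F0.
  rewrite /peval big_seq1 /pexponent big_nil addr0 q1 mulr1 -rE rmorphN1 //.
have m1S : ppoly_over S m1 by move=> c m t; rewrite inE => /eqP [_ ->].
pose r := ppmul (ppmul P Q' ++ ppmul m1 (ppmul P' Q)) Q0.
have rS : ppoly_over S r.
  by do !apply: ppoly_over_mul => //; apply: ppoly_over_add; do !apply: ppoly_over_mul.
have : peval q k r = 0.
  apply: peval_zero_transfer => // q0 k' hq hk; have qd := qnD hq.
  rewrite /r peval_mul // peval_add !peval_mul // e ?qnum0 //.
  apply: (mulIf (N0 _ _ hq hk)); rewrite mul0r -mulrA -a5 // mulrCA mulrC.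
  set p := peval _ _ P; set t := T _ _; set c := peval _ _ Q'; set d := peval _ _ Q; set p' := peval _ _ P'.
  have E1 : p * t = d * I q0 k' by exact: h5.
  have E2 : p' * t = c * I q0 k' by exact: h5'.
  have -> : (p * c + -1 * (p' * d)) * t = c * (p * t) - d * (p' * t) by ring.
  by rewrite E1 E2; ring.
rewrite /r peval_mul // => /eqP; rewrite mulf_eq0 (negPf a3) orbF peval_add !peval_mul // e ?q_0 //.
rewrite mulN1r subr_eq0 => /eqP E; apply/eqP; by rewrite eqr_div // E.
Qed.
End CtValues.
End SpecializedParameters.

(** * Haar measure on the torus *)

Section ComplexMeasurable.
Context {d} {T : measurableType d} {R : realType}.

Definition cmeasurable (f : T -> R[i]) : Prop :=
  measurable_fun setT (fun x => complex.Re (f x)) /\ measurable_fun setT (fun x => complex.Im (f x)).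

Lemma ReM (x y : R[i]) : complex.Re (x * y) = complex.Re x * complex.Re y - complex.Im x * complex.Im y.
Proof. by case: x; case: y. Qed.
Lemma ImM (x y : R[i]) : complex.Im (x * y) = complex.Re x * complex.Im y + complex.Im x * complex.Re y.
Proof. by case: x; case: y. Qed.
Lemma ReV (x : R[i]) : complex.Re x^-1 = complex.Re x * (complex.Re x ^+ 2 + complex.Im x ^+ 2)^-1.
Proof. by case: x. Qed.
Lemma ImV (x : R[i]) : complex.Im x^-1 = - complex.Im x * (complex.Re x ^+ 2 + complex.Im x ^+ 2)^-1.
Proof. by case: x => a b; rewrite mulNr. Qed.

Lemma cmeas_cst c : cmeasurable (fun=> c).
Proof. by split; exact: measurable_cst. Qed.
Lemma cmeasD f g : cmeasurable f -> cmeasurable g -> cmeasurable (fun x => f x + g x).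
Proof.
move=> [f1 f2] [g1 g2]; split; under eq_fun do rewrite raddfD; exact: measurable_funD.
Qed.
Lemma cmeasM f g : cmeasurable f -> cmeasurable g -> cmeasurable (fun x => f x * g x).
Proof.
move=> [f1 f2] [g1 g2]; split.
  under eq_fun do rewrite ReM.
  by apply: measurable_funB; apply: measurable_funM.
under eq_fun do rewrite ImM.
by apply: measurable_funD; apply: measurable_funM.
Qed.
Lemma cmeasN f : cmeasurable f -> cmeasurable (fun x => - f x).
Proof. by move=> hf; under eq_fun do rewrite -mulN1r; apply: cmeasM => //; exact: cmeas_cst. Qed.
Lemma cmeasB f g : cmeasurable f -> cmeasurable g -> cmeasurable (fun x => f x - g x).
Proof. by move=> hf hg; apply: cmeasD => //; exact: cmeasN. Qed.

(** The power with exponent -1 is measurable and agrees with the inverse at 0 as well. *)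
Lemma measurable_inv_ge0 (h : T -> R) : measurable_fun setT h -> (forall x, 0 <= h x) ->
  measurable_fun setT (fun x => (h x)^-1).
Proof.
move=> mh h0; rewrite (_ : (fun x => _) = (fun x => h x `^ (-1))).
  exact: (measurableT_comp (measurable_powR _)).
by apply/funext => x; rewrite powR_inv1.
Qed.

Lemma cmeasV f : cmeasurable f -> cmeasurable (fun x => (f x)^-1).
Proof.
move=> [f1 f2].
have mi : measurable_fun setT (fun x => (complex.Re (f x) ^+ 2 + complex.Im (f x) ^+ 2)^-1).
  apply: measurable_inv_ge0 => [|x]; last by rewrite addr_ge0 // sqr_ge0.
  by apply: measurable_funD; apply: measurable_funX.
split.
  by under eq_fun do rewrite ReV; apply: measurable_funM.
under eq_fun do rewrite ImV; apply: measurable_funM => //.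
exact: measurable_funN.
Qed.
Lemma cmeasXn f m : cmeasurable f -> cmeasurable (fun x => f x ^+ m).
Proof.
move=> hf; elim: m => [|m IH]; first by under eq_fun do rewrite expr0; exact: cmeas_cst.
by under eq_fun do rewrite exprS; exact: cmeasM.
Qed.
Lemma cmeasXz f (m : int) : cmeasurable f -> cmeasurable (fun x => f x ^ m).
Proof.
by move=> hf; case: m => m; [exact: cmeasXn|apply: cmeasV; exact: cmeasXn].
Qed.
Lemma cmeas_prod I (s : seq I) (f : I -> T -> R[i]) : (forall i, cmeasurable (f i)) ->
  cmeasurable (fun x => \prod_(i <- s) f i x).
Proof.
move=> hf; elim: s => [|i s IH]; first by under eq_fun do rewrite big_nil; exact: cmeas_cst.
by under eq_fun do rewrite big_cons; exact: cmeasM.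
Qed.
Lemma cmeas_sum I (s : seq I) (f : I -> T -> R[i]) : (forall i, cmeasurable (f i)) ->
  cmeasurable (fun x => \sum_(i <- s) f i x).
Proof.
move=> hf; elim: s => [|i s IH]; first by under eq_fun do rewrite big_nil; exact: cmeas_cst.
by under eq_fun do rewrite big_cons; exact: cmeasD.
Qed.
End ComplexMeasurable.

Section TorusMeasure.
Context {R : realType} {n : nat}.
Local Notation B := (borel_torus R n).

Lemma torus_eq (x y : torus R n) : (forall i, x i = y i) -> x = y.
Proof.
case: x y => [x hx] [y hy] /= h; have e : x = y by apply/funext.
by move: hx hy; rewrite e => hx hy; congr Torus; exact: Prop_irrelevance.
Qed.

Lemma measurable_gt_of_le d (T : measurableType d) (f : T -> R) :
  (forall r, measurable [set x | f x <= r]) -> measurable_fun setT f.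
Proof.
move=> h; apply: (measurability _ (RGenOInfty.measurableE R)) => /= _ [_ [r ->] <-].
rewrite setTI (_ : _ @^-1` _ = ~` [set x | f x <= r]); first exact/measurableC.
apply/seteqP; split => x /=; rewrite in_itv /= andbT.
  by rewrite ltNge => /negP.
by move=> /negP; rewrite -ltNge.
Qed.

Lemma cmeas_coord i : @cmeasurable _ B R (fun x => x i).
Proof.
split; apply: measurable_gt_of_le => r; apply: sub_sigma_algebra; exists i, r; [left|right] => //.
Qed.

Lemma measurable_torus d (T : measurableType d) (f : T -> B) :
  (forall i, cmeasurable (fun t => f t i)) -> measurable_fun setT f.
Proof.
move=> h; apply: (@measurability _ _ _ B _ _ (@torus_gen R n)) => //.
move=> _ [_ [i [r [->|->]]] <-]; rewrite setTI.
  have [h1 _] := h i.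
  have := h1 measurableT `]-oo, r]%classic (measurable_itv _); rewrite setTI.
  by rewrite (_ : _ @^-1` _ = f @^-1` [set x : torus R n | complex.Re (x i) <= r]) //;
    apply/seteqP; split => x /=; rewrite in_itv.
have [_ h1] := h i.
have := h1 measurableT `]-oo, r]%classic (measurable_itv _); rewrite setTI.
by rewrite (_ : _ @^-1` _ = f @^-1` [set x : torus R n | complex.Im (x i) <= r]) //;
  apply/seteqP; split => x /=; rewrite in_itv.
Qed.

Lemma cmeas_comp d1 d2 (T1 : measurableType d1) (T2 : measurableType d2) (f : T2 -> R[i]) (g : T1 -> T2) :
  measurable_fun setT g -> cmeasurable f -> cmeasurable (f \o g).
Proof. by move=> mg [f1 f2]; split; [exact: (measurableT_comp f1)|exact: (measurableT_comp f2)]. Qed.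

Lemma measurable_torus_mul : measurable_fun setT (fun p : B * B => torus_mul p.1 p.2 : B).
Proof.
apply: measurable_torus => i /=; apply: cmeasM.
  exact: (cmeas_comp measurable_fst (cmeas_coord i)).
exact: (cmeas_comp measurable_snd (cmeas_coord i)).
Qed.

Lemma torus_mulC (x y : torus R n) : torus_mul x y = torus_mul y x.
Proof. by apply: torus_eq => i /=; rewrite mulrC. Qed.

(* Copies which carry the bundled structures required by the library. *)
Definition unit_mass (mu : {measure set B -> \bar R}) (_ : mu setT = 1%E) : set B -> \bar R := mu.
HB.instance Definition _ mu h := measure_function.Measure.copy (@unit_mass mu h) mu.
HB.instance Definition _ mu h := Measure_isProbability.Build _ _ _ (@unit_mass mu h) h.

(* Integrate the indicator of [x y \in A] for [mu \x nu] in both orders. *)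
Lemma haar_unique (mu nu : {measure set B -> \bar R}) : haar mu -> haar nu ->
  forall A, measurable A -> mu A = nu A.
Proof.
move=> [mu1 muI] [nu1 nuI] A mA.
pose P : probability B R := unit_mass mu1.
pose Q : probability B R := unit_mass nu1.
pose X := (fun p : B * B => torus_mul p.1 p.2 : B) @^-1` A.
have mX : measurable X by rewrite -[X]setTI; exact: measurable_torus_mul.
have E : (P \x Q)%E X = (P \x^ Q)%E X.
  by apply: product_measure_unique => // C C' mC mC'; exact: product_measure2E.
have E1 : (P \x Q)%E X = nu A.
  rewrite /product_measure1 (eq_integral (cst (nu A))).
    by rewrite integral_cst // [X in (_ * X)%E]mu1 mule1.
  move=> x _ /=; rewrite -[RHS](nuI x A mA); congr (nu _).
  by apply/seteqP; split => y; rewrite /xsection /= inE.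
have E2 : (P \x^ Q)%E X = mu A.
  rewrite /product_measure2 (eq_integral (cst (mu A))).
    by rewrite integral_cst // [X in (_ * X)%E]nu1 mule1.
  move=> y _ /=; rewrite -[RHS](muI y A mA); congr (mu _).
  by apply/seteqP; split => x; rewrite /ysection /= inE /X /= torus_mulC.
by rewrite -E1 -E2 E.
Qed.

Definition torus_hom (f : torus R n -> torus R n) : Prop :=
  forall x y, f (torus_mul x y) = torus_mul (f x) (f y).

Definition mfun_of_measurable (f : B -> B) (_ : measurable_fun setT f) : B -> B := f.
HB.instance Definition _ f h := isMeasurableFun.Build _ _ _ _ (@mfun_of_measurable f h) h.

(** The push-forward of [mu] along [f] is again translation invariant, as [f (g x) = x] lifts
    translations along [f]; uniqueness of Haar measure concludes. *)
Lemma haar_automorphism (mu : {measure set B -> \bar R}) (f g : torus R n -> torus R n) :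
  haar mu -> measurable_fun setT (f : B -> B) -> torus_hom f -> cancel g f ->
  forall A : set B, measurable A -> mu (f @^-1` A) = mu A.
Proof.
move=> hm mf hf gf A mA.
pose f' : {mfun B >-> B} := mfun_of_measurable mf.
have h : haar (pushforward mu f' : {measure set B -> \bar R}).
  have [m1 mI] := hm; split; first by rewrite /= /pushforward preimage_setT.
  move=> x C mC; rewrite /= /pushforward.
  have mfC : measurable (f @^-1` C : set B) by have := mf measurableT _ mC; rewrite setTI.
  rewrite -[RHS](mI (g x) _ mfC); congr (mu _).
  by apply/seteqP; split => y /=; rewrite hf gf.
by rewrite -(haar_unique (h mf) hm mA).
Qed.

End TorusMeasure.

Section ComplexModulus.
Context {R : realType}.
Implicit Types x y z : R[i].
Definition cn (z : R[i]) : R := ComplexField.Normc.normc z.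

Lemma cnE z : `|z| = (cn z)%:C. Proof. by []. Qed.
Lemma cnM x y : cn (x * y) = cn x * cn y. Proof. exact: ComplexField.Normc.normcM. Qed.
Lemma cnV x : cn x^-1 = (cn x)^-1. Proof. exact: ComplexField.Normc.normcV. Qed.
Lemma cn1 : cn 1 = 1. Proof. exact: ComplexField.Normc.normc1. Qed.
Lemma cn0 : cn 0 = 0. Proof. exact: ComplexField.Normc.normc0. Qed.
Lemma cn_ge0 x : 0 <= cn x. Proof. by case: x => a b; exact: sqrtr_ge0. Qed.
Lemma cnD x y : cn (x + y) <= cn x + cn y.
Proof. by rewrite -lecR rmorphD -!cnE ler_normD. Qed.
Lemma cnN x : cn (- x) = cn x.
Proof. by apply: (@complexI R); rewrite -!cnE normrN. Qed.
Lemma cnB x y : cn (x - y) <= cn x + cn y.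
Proof. by rewrite -(cnN y) cnD. Qed.
Lemma cn_sub_ge x y : cn x - cn y <= cn (x - y).
Proof. by rewrite lerBlDr -{1}(subrK y x) cnD. Qed.
Lemma cnX x m : cn (x ^+ m) = cn x ^+ m.
Proof. by elim: m => [|m IH]; rewrite ?expr0 ?cn1 // !exprS cnM IH. Qed.
Lemma cn_real (r : R) : cn r%:C = `|r|.
Proof. by rewrite /cn /= expr0n addr0 sqrtr_sqr. Qed.
Lemma Re_cn x : `|complex.Re x| <= cn x.
Proof.
by case: x => a b; rewrite /cn /= -sqrtr_sqr ler_wsqrtr // lerDl sqr_ge0.
Qed.
Lemma Im_cn x : `|complex.Im x| <= cn x.
Proof.
by case: x => a b; rewrite /cn /= -sqrtr_sqr ler_wsqrtr // lerDr sqr_ge0.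
Qed.
Lemma cn_eq1 x : `|x| = 1 -> cn x = 1.
Proof. by rewrite cnE => /complexI. Qed.
Lemma cn_eq0 x : (cn x == 0) = (x == 0).
Proof.
apply/eqP/eqP => [|->]; last exact: cn0.
exact: ComplexField.Normc.eq0_normc.
Qed.
End ComplexModulus.

Section TorusIntegral.
Context {R : realType} {n : nat}.
Local Notation B := (borel_torus R n).
Context (mu : {measure set B -> \bar R}).
Hypothesis Hmu : haar mu.

Definition cbounded (f : B -> R[i]) : Prop := cmeasurable f /\ exists M : R, forall x, cn (f x) <= M.

Lemma bounded_integrable (u : B -> R) M : measurable_fun setT u -> (forall x, `|u x| <= M) ->
  mu.-integrable setT (EFin \o u).
Proof.
move=> mu0 hM; apply: measurable_bounded_integrable => //.
  by have [-> _] := Hmu; rewrite ltry.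
exists M; split; first exact: num_real.
by move=> y My x _; apply: le_trans (ltW My).
Qed.
Lemma cbounded_Re f : cbounded f -> mu.-integrable setT (EFin \o (fun x => complex.Re (f x))).
Proof. by move=> [[m1 _] [M hM]]; apply: bounded_integrable m1 (fun x => le_trans (Re_cn _) (hM x)). Qed.
Lemma cbounded_Im f : cbounded f -> mu.-integrable setT (EFin \o (fun x => complex.Im (f x))).
Proof. by move=> [[_ m2] [M hM]]; apply: bounded_integrable m2 (fun x => le_trans (Im_cn _) (hM x)). Qed.

Lemma cbounded_cst c : cbounded (fun=> c).
Proof. by split; [exact: cmeas_cst|exists (cn c)]. Qed.
Lemma cboundedD f g : cbounded f -> cbounded g -> cbounded (fun x => f x + g x).
Proof.
move=> [f1 [M hM]] [g1 [N hN]]; split; first exact: cmeasD.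
by exists (M + N) => x; apply: le_trans (cnD _ _) _; exact: lerD.
Qed.
Lemma cboundedM f g : cbounded f -> cbounded g -> cbounded (fun x => f x * g x).
Proof.
move=> [f1 [M hM]] [g1 [N hN]]; split; first exact: cmeasM.
by exists (M * N) => x; rewrite cnM; apply: ler_pM => //; exact: cn_ge0.
Qed.
Lemma cbounded_sum I (s : seq I) (f : I -> B -> R[i]) : (forall i, cbounded (f i)) ->
  cbounded (fun x => \sum_(i <- s) f i x).
Proof.
move=> h; elim: s => [|i s IH].
  by under eq_fun do rewrite big_nil; exact: cbounded_cst.
by under eq_fun do rewrite big_cons; exact: cboundedD.
Qed.

Lemma torus_integralD f g : cbounded f -> cbounded g ->
  torus_integral mu (fun x => f x + g x) = torus_integral mu f + torus_integral mu g.
Proof.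
move=> hf hg; rewrite /torus_integral.
under [X in X +i* _ = _]eq_Rintegral do rewrite raddfD.
under [X in _ +i* X = _]eq_Rintegral do rewrite raddfD.
rewrite (RintegralD _ (cbounded_Re hf) (cbounded_Re hg)) //.
by rewrite (RintegralD _ (cbounded_Im hf) (cbounded_Im hg)).
Qed.

Lemma torus_integralZ c f : cbounded f ->
  torus_integral mu (fun x => c * f x) = c * torus_integral mu f.
Proof.
move=> hf; rewrite /torus_integral.
have i1 := cbounded_Re hf; have i2 := cbounded_Im hf.
have Z (r : R) (g : B -> R) : mu.-integrable setT (EFin \o g) ->
    mu.-integrable setT (EFin \o (fun x => r * g x)).
  by move=> h; apply: eq_integrable (integrableZl measurableT r h).
under [X in X +i* _ = _]eq_Rintegral do rewrite ReM.
under [X in _ +i* X = _]eq_Rintegral do rewrite ImM.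
rewrite RintegralB //; [|exact: Z|exact: Z].
rewrite RintegralD //; [|exact: Z|exact: Z].
rewrite !RintegralZl //.
by case: c {Z} => a b.
Qed.

Lemma torus_integral0 : torus_integral mu (fun=> 0) = 0.
Proof. by rewrite /torus_integral /= !Rintegral_cst // !mul0r. Qed.

Lemma torus_integral_sum I (s : seq I) (f : I -> B -> R[i]) : (forall i, cbounded (f i)) ->
  torus_integral mu (fun x => \sum_(i <- s) f i x) = \sum_(i <- s) torus_integral mu (f i).
Proof.
move=> h; elim: s => [|i s IH].
  rewrite big_nil -[RHS]torus_integral0; congr torus_integral.
  by apply/funext => x; rewrite big_nil.
rewrite big_cons -IH -torus_integralD //; last exact: cbounded_sum.
by congr torus_integral; apply/funext => x; rewrite big_cons.
Qed.

Lemma torus_integral_ae f g (N : set B) : cmeasurable f -> cmeasurable g -> mu.-negligible N ->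
  (forall x, ~ N x -> f x = g x) -> torus_integral mu f = torus_integral mu g.
Proof.
move=> [f1 f2] [g1 g2] hN fg; rewrite /torus_integral /Rintegral.
have H (u v : B -> R) : measurable_fun setT u -> measurable_fun setT v ->
   (forall x, ~ N x -> u x = v x) -> (\int[mu]_x (u x)%:E)%E = (\int[mu]_x (v x)%:E)%E.
  move=> mu1 mv1 uv; apply: ae_eq_integral => //; [exact/measurable_EFinP|exact/measurable_EFinP|].
  apply: negligibleS hN => x /= nx; apply: contrapT => nN; apply: nx => _.
  by rewrite uv.
congr (fine _ +i* fine _); apply: H => // x nx; by rewrite fg.
Qed.

Lemma torus_integral_hom f (phi psi : torus R n -> torus R n) : cbounded f ->
  measurable_fun setT (phi : B -> B) -> torus_hom phi -> cancel psi phi ->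
  torus_integral mu (f \o phi) = torus_integral mu f.
Proof.
move=> hf mphi hphi hpsi.
have H (u : B -> R) : mu.-integrable setT (EFin \o (u \o phi)) -> measurable_fun setT u ->
   (\int[mu]_x ((u \o phi) x)%:E)%E = (\int[mu]_x (u x)%:E)%E.
  move=> iu mu'; have := @integral_pushforward _ _ B B R (phi : B -> B) mphi mu setT (EFin \o u).
  rewrite preimage_setT => h.
  rewrite -[LHS]/(\int[mu]_x ((EFin \o u) \o phi) x)%E.
  rewrite -h //; last exact/measurable_EFinP.
  apply: eq_measure_integral => A mA _.
  exact: (haar_automorphism Hmu mphi hphi hpsi).
have [[m1 m2] [M hM]] := hf.
have hfp : cbounded (f \o phi).
  by split; [exact: cmeas_comp mphi (conj m1 m2)|exists M => x; exact: hM].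
rewrite /torus_integral /Rintegral; congr (fine _ +i* fine _).
  exact: (H (fun x => complex.Re (f x)) (cbounded_Re hfp) m1).
exact: (H (fun x => complex.Im (f x)) (cbounded_Im hfp) m2).
Qed.

(** Were the integral zero, the non-negative real part would vanish almost everywhere; since it does
    not vanish off the null set [N], the whole torus would be null. *)
Lemma torus_integral_pos_neq0 f (N : set B) : cbounded f -> mu.-negligible N ->
  (forall x, 0 <= complex.Re (f x)) -> (forall x, ~ N x -> complex.Re (f x) != 0) ->
  torus_integral mu f != 0.
Proof.
move=> hf hN f0 fN; apply/eqP => /(congr1 (@complex.Re R)) /= h.
have [[m1 m2] _] := hf.
have i1 := cbounded_Re hf.
have e : (\int[mu]_x `|(complex.Re (f x))%:E|)%E = 0%E.
  under eq_integral => x _ do rewrite gee0_abs ?lee_fin ?f0 //.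
  rewrite -[LHS]fineK; last exact: (integrable_fin_num _ i1).
  by move: h; rewrite /Rintegral => ->.
have [] := ae_eq_integral_abs mu measurableT (f := fun x => (complex.Re (f x))%:E).
  exact/measurable_EFinP.
move=> /(_ e) hae _.
have : mu.-negligible [set: B].
  apply: negligibleS (negligibleU hN hae) => x _ /=.
  have [nx|nx] := pselect (N x); [by left|right].
  by move=> /(_ I) [] /eqP; rewrite (negPf (fN _ nx)).
move=> hneg; have h0 := measure_negligible measurableT hneg.
have [h1 _] := Hmu; have : (1 : \bar R)%E = 0%E by rewrite -h1 -h0.
by move=> /eqP; rewrite onee_eq0.
Qed.

End TorusIntegral.

(** * Characters, the dual Weyl group action and null sets *)

Section Characters.
Context {R : realType} {V : vectType R} (D : data V).
Hypothesis HD : duality_data D.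
Local Notation L := (dL D).
Local Notation n := (\dim {:V}).
Local Notation bas := (dbasis D).
Local Notation B := (borel_torus R n).

Lemma torus_neq0 (x : torus R n) i : x i != 0.
Proof. by rewrite -normr_eq0 torus_norm oner_eq0. Qed.

Lemma monomial_norm (x : torus R n) v : `|monomial D x v| = 1.
Proof.
rewrite /monomial normr_prod big1 // => i _.
by case: (zcoord D v i) => p; rewrite ?NegzE ?exprnN ?normfV normrX torus_norm expr1n ?invr1.
Qed.

Lemma cn_monomial (x : torus R n) v : cn (monomial D x v) = 1.
Proof. by apply: cn_eq1; exact: monomial_norm. Qed.

Lemma monomial_mul (x y : torus R n) v :
  monomial D (torus_mul x y) v = monomial D x v * monomial D y v.
Proof.
rewrite /monomial -big_split; apply: eq_bigr => i _ /=.
by rewrite exprzMl // unitfE torus_neq0.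
Qed.

Lemma cmeas_monomial v : @cmeasurable _ B R (fun x => monomial D x v).
Proof. by apply: cmeas_prod => i; apply: cmeasXz; exact: cmeas_coord. Qed.

Lemma cbounded_monomial v : @cbounded R n (fun x => monomial D x v).
Proof. by split; [exact: cmeas_monomial|exists 1 => x; rewrite cn_monomial]. Qed.

(** The character [v |-> x(g v)], given by its values on the basis; for [g] in [W0] this is the dual
    of the action on exponents. *)
Definition torus_act (g : V -> V) (x : torus R n) : torus R n :=
  Torus (fun i => monomial_norm x (g (tnth bas i))).

Lemma torus_act_hom g : torus_hom (torus_act g).
Proof. by move=> x y; apply: torus_eq => i /=; rewrite monomial_mul. Qed.

Lemma monomial_torus_act (g : {additive V -> V}) x v : (forall v, L v -> L (g v)) -> L v ->
  monomial D (torus_act g x) v = monomial D x (g v).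
Proof.
move=> hg Lv; rewrite {2}(L_zcoord HD Lv) raddf_sum.
under [in RHS]eq_bigr do rewrite raddfMz.
rewrite monomial_sum //; [exact: torus_neq0|move=> i; apply: hg; exact: L_basis].
Qed.

Lemma measurable_torus_act g : measurable_fun setT (torus_act g : B -> B).
Proof. by apply: measurable_torus => i; exact: cmeas_monomial. Qed.

Lemma torus_act_cancel (g h : {additive V -> V}) : (forall v, L v -> L (g v)) -> (forall v, L v -> L (h v)) ->
  cancel h g -> cancel (torus_act g) (torus_act h).
Proof.
move=> gL hL gh x; apply: torus_eq => i /=.
rewrite monomial_torus_act //; last by apply: hL; exact: L_basis.
rewrite gh -[RHS]expr1z /monomial.
have e : tnth bas i = \sum_j tnth bas j *~ (j == i)%:R.
  rewrite (bigD1 i) //= eqxx big1 ?addr0 //.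
  by move=> j /negPf ->; rewrite mulr0z.
rewrite e zcoordE // (bigD1 i) //= eqxx big1 ?mulr1 //.
by move=> j /negPf ->; rewrite expr0z.
Qed.

Section NullSets.
Context (mu : {measure set B -> \bar R}).
Hypothesis Hmu : haar mu.

Lemma measurable_monomial_eq v c : measurable ([set x : B | monomial D x v = c] : set B).
Proof.
have [h1 h2] := cmeas_monomial v.
have -> : [set x : B | monomial D x v = c] =
   ((fun x : B => complex.Re (monomial D x v)) @^-1` [set complex.Re c]) `&`
   ((fun x : B => complex.Im (monomial D x v)) @^-1` [set complex.Im c]).
  apply/seteqP; split => x /=; first by move=> ->.
  by case: (monomial D x v) => a b; case: c => a' b' /= [-> ->].
apply: measurableI.
  by have := h1 measurableT _ (measurable_set1 (complex.Re c)); rewrite setTI.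
by have := h2 measurableT _ (measurable_set1 (complex.Im c)); rewrite setTI.
Qed.

Lemma unit_circle_seq : exists w : nat -> R[i], (forall j, `|w j| = 1) /\ injective w.
Proof.
pose t (j : nat) : R := j.+1%:R^-1.
have t1 j : t j ^+ 2 <= 1.
  by rewrite -[X in _ <= X](expr1n _ 2) lerXn2r ?nnegrE ?invr_ge0 // invf_le1 // ler1n.
exists (fun j => t j +i* Num.sqrt (1 - t j ^+ 2)); split.
  move=> j; rewrite cnE /cn /= sqr_sqrtr ?subr_ge0 // addrC subrK sqrtr1 //.
by move=> j k [] /invr_inj /eqP; rewrite eqr_nat => /eqP [].
Qed.

(** Some coordinate of [v] is non-zero; there a root of [w] or of its inverse is taken, and 1
    elsewhere. *)
Lemma monomial_surj v (w : R[i]) : L v -> v != 0 -> `|w| = 1 ->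
  exists y : torus R n, monomial D y v = w.
Proof.
move=> Lv v0 w1.
have [i zi] : exists i, zcoord D v i != 0.
  apply: contrapT => h; case/eqP: v0; apply: (zcoord_inj HD) => //; first exact: L0.
  move=> i; rewrite zcoord0 //; apply: contrapT => /eqP z; apply: h; by exists i.
have nz : (0 < `|zcoord D v i|)%N by rewrite absz_gt0.
have [u [u1 uz]] : exists u : R[i], `|u| = 1 /\ u ^ (zcoord D v i) = w.
  have key (p : nat) (c : R[i]) : (0 < p)%N -> `|c| = 1 -> exists u : R[i], `|u| = 1 /\ u ^+ p = c.
    move=> p0 c1; exists (p.-root c); rewrite rootCK //; split => //.
    by apply/eqP; rewrite -(@pexpr_eq1 _ _ p) // -normrX rootCK // c1.
  move: nz; case: (zcoord D v i) => p /= nz; first exact: key.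
  have [|u [h1 h2]] := key p.+1 w^-1 isT; first by rewrite normfV w1 invr1.
  by exists u; split => //; rewrite NegzE -exprnN h2 invrK.
have un j : `|if j == i then u else 1| = 1 :> R[i] by case: eqP => // _; rewrite normr1.
exists (Torus un); rewrite /monomial (bigD1 i) //= eqxx big1 ?mulr1 //.
by move=> j /negPf ->; rewrite exp1rz.
Qed.

(* The torus translates of this set are infinitely many disjoint sets of the
   same measure. *)
Lemma monomial_eq_negligible v c : L v -> v != 0 -> mu.-negligible [set x : B | monomial D x v = c].
Proof.
move=> Lv v0; have mE := measurable_monomial_eq v.
apply/negligibleP; first exact: mE.
have [w [w1 winj]] := unit_circle_seq.
have [mu1 muI] := Hmu.
pose E c : set B := [set x : B | monomial D x v = c].
have wn0 j : w j != 0 by rewrite -normr_eq0 w1 oner_eq0.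
have tr j c' : mu (E (c' / w j)) = mu (E c').
  have [y hy] := monomial_surj Lv v0 (w1 j).
  rewrite -(muI y (E c') (mE _)); congr (mu _); apply/seteqP; split => x; rewrite /E /= monomial_mul hy.
    by move=> ->; rewrite mulrC divfK.
  by move=> <-; rewrite mulrAC divff // mul1r.
have [c0|c0] := eqVneq c 0.
  rewrite (_ : [set _ | _] = set0) ?measure0 //; apply/seteqP; split => x //= e.
  by have := monomial_norm x v; rewrite e c0 normr0 => /eqP; rewrite eq_sym oner_eq0.
have S N : (\sum_(i < N) mu (E c) <= 1)%E.
  have -> : (\sum_(i < N) mu (E c) = \sum_(i < N) mu (E (c / w i)%R))%E.
    by apply: eq_bigr => i _; rewrite tr.
  rewrite -(@measure_semi_additive_ord _ _ _ mu N (fun i => E (c / w i))).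
  - rewrite -mu1; apply: le_measure; rewrite ?inE //.
    by apply: bigsetU_measurable => i _; exact: mE.
  - by move=> i; exact: mE.
  - apply/trivIsetP => i j _ _ ij; apply/seteqP; split => x //= [h1 h2].
    case/eqP: ij; apply: val_inj; apply: winj; apply: invr_inj; apply: (mulfI c0).
    by rewrite -h1 -h2.
  by apply: bigsetU_measurable => i _; exact: mE.
suff : mu (E c) = 0%E by [].
have m1 : (mu (E c) <= 1)%E by have := S 1%N; rewrite big_ord1.
have m0 : (0 <= mu (E c))%E by exact: measure_ge0.
have mfin : mu (E c) \is a fin_num by rewrite ge0_fin_numE // (le_lt_trans m1) // ltry.
rewrite -(fineK mfin); congr (_%:E); set r := fine _.
have r0 : 0 <= r by apply: fine_ge0.
apply/eqP; rewrite eq_le r0 andbT leNgt; apply/negP => rp.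
(* More than [1 / r] disjoint translates of mass [r] exceed the total mass 1. *)
have := S (Num.truncn r^-1).+1.
rewrite -(fineK mfin) -/r sumEFin lee_fin sumr_const card_ord -mulr_natl leNgt.
by rewrite -ltr_pdivrMr // div1r truncnS_gt.
Qed.
End NullSets.
End Characters.

(** * The numerical weight functions *)

Import numFieldNormedType.Exports.

Lemma uniq_sum_le (R : numDomainType) (T : eqType) (s l : seq T) (F : T -> R) :
  (forall x, 0 <= F x) -> uniq s -> {subset s <= l} -> \sum_(x <- s) F x <= \sum_(x <- l) F x.
Proof.
move=> F0; elim: s l => [|x s IH] l /=; first by rewrite big_nil => _ _; exact: sumr_ge0.
move=> /andP [xs us] sl; have xl : x \in l by apply: sl; rewrite mem_head.
rewrite big_cons (big_rem x xl) /= lerD2l; apply: IH => // y ys.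
apply: contraT => yr; have : y \in l by apply: sl; rewrite inE ys orbT.
rewrite (perm_mem (perm_to_rem xl)) inE (negPf yr) orbF => /eqP e.
by rewrite -e ys in xs.
Qed.

Lemma div_sub1 (F : fieldType) (x y : F) : y != 0 -> x / y - 1 = (x - y) / y.
Proof. by move=> y0; rewrite mulrBl divff. Qed.

Lemma inv_div_sub1 (F : fieldType) (x y : F) : x != 0 -> y != 0 -> (x / y)^-1 - 1 = - (x - y) / x.
Proof. by move=> x0 y0; rewrite invf_div opprB div_sub1. Qed.

Lemma rmorph_wfun (F : fieldType) (f : {rmorphism F -> F}) (t a b : F) : f a = a -> f b = b ->
  (1 - f t ^+ 2) / ((1 - a * f t) * (1 + b * f t)) = f ((1 - t ^+ 2) / ((1 - a * t) * (1 + b * t))).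
Proof.
by move=> ea eb; rewrite fmorph_div rmorphB rmorph1 rmorphXn rmorphM rmorphB rmorphD !rmorphM rmorph1 ea eb.
Qed.

(** * Estimates for infinite products and for a single weight factor *)

Section InfiniteProductBounds.
Context {R : realType}.

(** Induction through [z P - 1 = z (P - 1) + (z - 1)] and [1 + c <= exp(c)]. *)
Lemma cn_prod_bound (T : eqType) (s : seq T) (z : T -> R[i]) (c : T -> R) :
  (forall a, a \in s -> cn (z a - 1) <= c a) ->
  cn (\prod_(a <- s) z a) <= expR (\sum_(a <- s) c a) /\
  cn (\prod_(a <- s) z a - 1) <= expR (\sum_(a <- s) c a) - 1.
Proof.
elim: s => [|a s IH] h; first by rewrite !big_nil subrr cn0 cn1 expR0 subrr.
have [|h1 h2] := IH; first by move=> b bs; apply: h; rewrite inE bs orbT.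
have ha := h a (mem_head _ _).
have c0 : 0 <= c a by apply: le_trans ha; exact: cn_ge0.
have hz : cn (z a) <= 1 + c a.
  rewrite -[z a](subrK 1) addrC; apply: le_trans (cnD _ _) _.
  by rewrite cn1 lerD2l.
have he := expR_ge1Dx (c a); have E0 := expR_gt0 (\sum_(a <- s) c a).
rewrite !big_cons expRD; set P := \prod_(b <- s) z b in h1 h2 *; set E := expR (\sum_(b <- s) c b) in h1 h2 E0 *.
have E1 : 1 <= E by rewrite -subr_ge0; apply: le_trans h2; exact: cn_ge0.
split.
  rewrite cnM; apply: ler_pM => //; try exact: cn_ge0.
  exact: le_trans hz he.
have -> : z a * P - 1 = z a * (P - 1) + (z a - 1) by ring.
apply: le_trans (cnD _ _) _; rewrite cnM.
have : cn (z a) * cn (P - 1) <= (1 + c a) * (E - 1).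
  by apply: ler_pM => //; exact: cn_ge0.
have : (1 + c a) * E <= expR (c a) * E by rewrite ler_pM2r.
nra.
Qed.

Lemma expR_sub1_le (y : R) : expR y - 1 <= y * expR y.
Proof.
have := expR_ge1Dx (- y); rewrite expRN => h.
have E0 := expR_gt0 y.
have : (1 - y) * expR y <= 1.
  by rewrite -ler_pdivlMr // div1r.
lra.
Qed.

(* [u + K sg] is nondecreasing. *)
Lemma cvg_of_increments (u sg : nat -> R) (K M : R) : 0 <= K ->
  (forall m, `|u m.+1 - u m| <= K * (sg m.+1 - sg m)) -> (forall m, sg m <= M) ->
  (forall m, `|u m| <= M) -> cvgn u.
Proof.
move=> K0 hu sM uM.
have [K_0|Kp] := eqVneq K 0.
  have e m : u m = u 0%N.
    elim: m => // m <-; apply/eqP; rewrite -subr_eq0 -normr_le0.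
    by rewrite (le_trans (hu m)) // K_0 mul0r.
  have -> : u = (fun=> u 0%N) by apply/funext.
  exact: is_cvg_cst.
have K1 : 0 < K by rewrite lt_def Kp.
have sinc : nondecreasing_seq sg.
  apply/nondecreasing_seqP => m; rewrite -subr_ge0 -(pmulr_rge0 _ K1).
  exact: le_trans (hu m).
have scv : cvgn sg.
  apply: nondecreasing_is_cvgn => //; exists M => _ [m _ <-]; exact: sM.
have vcv : cvgn (fun m => u m + K * sg m).
  apply: nondecreasing_is_cvgn.
    apply/nondecreasing_seqP => m; have := hu m; rewrite ler_norml => /andP [h _].
    by lra.
  exists (M + K * M) => _ [m _ <-]; apply: lerD.
    by apply: le_trans (uM m); exact: ler_norm.
  by rewrite ler_wpM2l.
have -> : u = (fun m => (u m + K * sg m) - K * sg m) by apply/funext => m; ring.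
by apply: is_cvgB => //; apply: is_cvgMr.
Qed.

Definition ccvg (u : nat -> R[i]) : Prop :=
  cvgn (fun N => complex.Re (u N)) /\ cvgn (fun N => complex.Im (u N)).

Lemma climZ (c : R[i]) (u : nat -> R[i]) : ccvg u -> clim (fun N => c * u N) = c * clim u.
Proof.
move=> [h1 h2]; rewrite /clim; apply/eqP; rewrite eq_complex; apply/andP; split; apply/eqP => /=.
  rewrite ReM /=; apply/cvg_lim => //.
  under eq_fun do rewrite ReM.
  by apply: cvgB; apply: cvgMr.
rewrite ImM /=; apply/cvg_lim => //.
under eq_fun do rewrite ImM.
by apply: cvgD; apply: cvgMr.
Qed.

(** The weight factor in the variable [t = e(b)], with [al = q^k(a)] and [be = q^k(2a)]. *)
Definition wfun (al be : R) (t : R[i]) : R[i] :=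
  (1 - t ^+ 2) / ((1 - al%:C * t) * (1 + be%:C * t)).

(** Numerator minus denominator is [t (al - be) + t^2 (al be - 1)], of modulus at most [2 |t|].
    Numerator and denominator both have modulus at least [(1 - th)^2], hence the same constant in
    both bounds. *)
Lemma wfun_estimate (al be th : R) t : 0 <= al <= 1 -> 0 <= be <= 1 -> cn t <= th -> th < 1 ->
  [/\ cn (wfun al be t - 1) <= 2 / (1 - th) ^+ 2 * cn t,
      cn ((wfun al be t)^-1 - 1) <= 2 / (1 - th) ^+ 2 * cn t & wfun al be t != 0].
Proof.
move=> /andP [a0 a1] /andP [b0 b1] tth th1.
have t0 := cn_ge0 t; have th0 : 0 <= th := le_trans t0 tth.
set num := t * (al - be)%:C + t ^+ 2 * (al * be - 1)%:C.
have hnum : cn num <= 2 * cn t.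
  apply: le_trans (cnD _ _) _; rewrite (cnM t) (cnM (t ^+ 2)) cnX !cn_real.
  have h1 : `|al - be| <= 1 by rewrite ler_norml; apply/andP; split; lra.
  have h2 : `|al * be - 1| <= 1 by rewrite ler_norml; apply/andP; split; nra.
  have h3 : cn t ^+ 2 <= cn t by rewrite expr2; apply: ler_piMr => //; lra.
  have : cn t * `|al - be| <= cn t * 1 by rewrite ler_wpM2l.
  have : cn t ^+ 2 * `|al * be - 1| <= cn t ^+ 2 * 1 by rewrite ler_wpM2l // exprn_ge0.
  lra.
set d1 := 1 - al%:C * t; set d2 := 1 + be%:C * t; set d3 := 1 - t ^+ 2.
have k1 : 1 - th <= cn d1.
  have := cn_sub_ge 1 (al%:C * t); rewrite cn1 cnM cn_real ger0_norm // -/d1.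
  have : al * cn t <= 1 * cn t by rewrite ler_wpM2r.
  lra.
have k2 : 1 - th <= cn d2.
  have := cn_sub_ge 1 (- (be%:C * t)); rewrite opprK cnN cn1 cnM cn_real ger0_norm // -/d2.
  have : be * cn t <= 1 * cn t by rewrite ler_wpM2r.
  lra.
have k3 : (1 - th) ^+ 2 <= cn d3.
  have := cn_sub_ge 1 (t ^+ 2); rewrite cn1 cnX -/d3.
  have : cn t ^+ 2 <= th ^+ 2 by rewrite lerXn2r // nnegrE.
  nra.
have g0 : 0 < 1 - th by lra.
have g2 : 0 < (1 - th) ^+ 2 by rewrite exprn_gt0.
have d10 : d1 != 0 by rewrite -cn_eq0 gt_eqF //; lra.
have d20 : d2 != 0 by rewrite -cn_eq0 gt_eqF //; lra.
have d30 : d3 != 0 by rewrite -cn_eq0 gt_eqF //; lra.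
have key (x d : R[i]) : (1 - th) ^+ 2 <= cn d -> cn x <= 2 * cn t ->
    cn (x / d) <= 2 / (1 - th) ^+ 2 * cn t.
  move=> hd hx; rewrite cnM cnV mulrAC; apply: ler_pM => //.
  - exact: cn_ge0.
  - by rewrite invr_ge0 cn_ge0.
  by rewrite lef_pV2 ?posrE //; exact: lt_le_trans hd.
have e0 : d3 - d1 * d2 = num.
  rewrite /d3 /d1 /d2 /num rmorphB rmorphB rmorphM rmorph1; ring.
split; last first.
- by rewrite mulf_neq0 // invr_eq0 mulf_neq0.
- have -> : (wfun al be t)^-1 - 1 = - num / d3.
    by rewrite /wfun -e0; apply: inv_div_sub1 => //; rewrite mulf_neq0.
  by apply: key => //; rewrite cnN.
have -> : wfun al be t - 1 = num / (d1 * d2).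
  by rewrite /wfun -e0; apply: div_sub1; rewrite mulf_neq0.
apply: key => //; rewrite cnM expr2; apply: ler_pM => //; exact: ltW.
Qed.

Lemma wfun_unit_bound (al be : R) : 0 <= al < 1 -> 0 <= be < 1 \/ be = 1 ->
  exists M, forall t : R[i], cn t = 1 -> cn (wfun al be t) <= M.
Proof.
move=> /andP [a0 a1] hbe.
have k1 t : cn t = 1 -> 1 - al <= cn (1 - al%:C * t).
  move=> t1; have := cn_sub_ge 1 (al%:C * t); rewrite cn1 cnM cn_real ger0_norm // t1; lra.
have key (x d : R[i]) (m M : R) : 0 <= M -> 0 < m -> m <= cn d -> cn x <= M -> cn (x / d) <= M / m.
  move=> M0 m0 hm hx; rewrite cnM cnV; apply: ler_pM => //.
  - exact: cn_ge0.
  - by rewrite invr_ge0 cn_ge0.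
  by rewrite lef_pV2 ?posrE //; exact: lt_le_trans hm.
case: hbe => [/andP [b0 b1]|b1].
  exists (2 / ((1 - al) * (1 - be))) => t t1; apply: key => //.
  - by apply: mulr_gt0; lra.
  - rewrite cnM; apply: ler_pM; [lra|lra|exact: k1|].
    have := cn_sub_ge 1 (- (be%:C * t)); rewrite opprK cnN cn1 cnM cn_real ger0_norm // t1; lra.
  by apply: le_trans (cnB _ _) _; rewrite cn1 cnX t1 expr1n.
exists (2 / (1 - al)) => t t1; rewrite /wfun b1 rmorph1 mul1r.
(* At [t = -1] the quotient by 0 is 0, so the bound holds there too; elsewhere [1 + t] cancels. *)
have [e|e] := eqVneq (1 + t) 0.
  rewrite e mulr0 invr0 mulr0 cn0; apply: divr_ge0; lra.
have -> : 1 - t ^+ 2 = (1 - t) * (1 + t) by ring.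
rewrite -mulf_div divff // mulr1; apply: key => //; [lra|exact: k1|].
by apply: le_trans (cnB _ _) _; rewrite cn1 t1.
Qed.

Lemma wfun_unit_neq0 (al be : R) t : 0 <= al < 1 -> 0 <= be <= 1 -> cn t = 1 -> t ^+ 2 != 1 ->
  wfun al be t != 0.
Proof.
move=> /andP [a0 a1] /andP [b0 b1] t1 tn.
have k3 : 1 - t ^+ 2 != 0 by rewrite subr_eq0 eq_sym.
rewrite mulf_neq0 // invr_eq0 mulf_neq0 //.
  rewrite -cn_eq0 gt_eqF //; apply: (@lt_le_trans _ _ (1 - al)); first lra.
  have := cn_sub_ge 1 (al%:C * t); rewrite cn1 cnM cn_real ger0_norm // t1; lra.
have [b1'|b1'] := eqVneq be 1.
  rewrite b1' rmorph1 mul1r; apply: contraNneq tn => h.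
  have -> : t = -1 by rewrite -[t](addKr 1) h addr0.
  by rewrite sqrrN expr1n.
rewrite -cn_eq0 gt_eqF //; apply: (@lt_le_trans _ _ (1 - be)).
  by rewrite subr_gt0 lt_neqAle b1'.
have := cn_sub_ge 1 (- (be%:C * t)); rewrite opprK cnN cn1 cnM cn_real ger0_norm // t1; lra.
Qed.

Lemma conjc_fix (r : R) : conjc r%:C = r%:C.
Proof. by rewrite /conjc /= oppr0. Qed.

Lemma wfun_conj (al be : R) t : wfun al be (conjc t) = conjc (wfun al be t).
Proof.
have := @rmorph_wfun _ (@conjc R : {rmorphism R[i] -> R[i]}) t _ _ (conjc_fix al) (conjc_fix be).
by [].
Qed.

Lemma mul_conjc (z : R[i]) : z * conjc z = (cn z ^+ 2)%:C.
Proof.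
case: z => a b; rewrite /cn /= sqr_sqrtr ?addr_ge0 ?sqr_ge0 //.
by apply/eqP; rewrite eq_complex /= !mulrN opprK -!expr2 eqxx mulrC addNr eqxx.
Qed.

End InfiniteProductBounds.

(** * Conjugate pairs of factors and Weyl invariance *)

Section NumericalDelta.
Context {R : realType} {V : vectType R} (D : data V).
Hypothesis HD : duality_data D.
Local Notation ip := (dip D).
Local Notation L := (dL D).
Local Notation S := (dS D).
Local Notation n := (\dim {:V}).
Local Notation B := (borel_torus R n).
Local Notation mon x v := (monomial D (x : torus R n) v).

Implicit Types x : torus R n.

Lemma mon0 (x : torus R n) : mon x 0 = 1.
Proof. exact: (monomial0 HD). Qed.
Lemma monD (x : torus R n) u v : L u -> L v -> mon x (u + v) = mon x u * mon x v.
Proof. by move=> Lu Lv; apply: (monomialD HD) => // i; exact: torus_neq0. Qed.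

Lemma mon_conj (x : torus R n) v : L v -> mon x (- v) = conjc (mon x v).
Proof.
move=> Lv; rewrite (monomialN HD (torus_neq0 x) Lv).
have h := mul_conjc (mon x v); rewrite cn_monomial expr1n rmorph1 in h.
have m0 := monomial_neq0 D (torus_neq0 x) v.
by apply: (mulfI m0); rewrite divff // h.
Qed.

Variables (q0 : R) (k : V * R -> R).
Hypotheses (hq : 0 < q0 < 1) (hk : positive_labelling D k).

Definition wal (a : V * R) : R := q0 `^ k a.
Definition wbe (a : V * R) : R := q0 `^ k2 D k a.
Definition wt (b : V * R) (x : torus R n) : R[i] := eaff (qnum q0) (monomial D x) b.
Definition wf (a : V * R) (x : torus R n) : R[i] := weight_factor D k (qnum q0) (monomial D x) a a.

Lemma q0_gt0 : 0 < q0. Proof. by case/andP: hq. Qed.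

Lemma powR_q0_lt1 (r : R) : 0 < r -> q0 `^ r < 1.
Proof.
move=> r0; have [h0 h1] := andP hq; rewrite /powR gt_eqF // expR_lt1.
by rewrite pmulr_rlt0 // ln_lt0 // h0 h1.
Qed.

Lemma wal_itv a : S a -> 0 <= wal a < 1.
Proof. by move=> Sa; rewrite powR_ge0 powR_q0_lt1 //; case: hk => _; apply. Qed.

Lemma wbe_cases a : 0 <= wbe a < 1 \/ wbe a = 1.
Proof.
rewrite /wbe /k2; case: asboolP => S2; last by right; rewrite powRr0.
by left; rewrite powR_ge0 powR_q0_lt1 //; case: hk => _; apply.
Qed.

Lemma wbe_itv a : 0 <= wbe a <= 1.
Proof. by case: (wbe_cases a) => [/andP [h1 h2]|->]; rewrite ?h1 ?(ltW h2) ?ler01 ?lexx. Qed.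

Lemma wfE a b x : L b.1 -> weight_factor D k (qnum q0) (monomial D x) a b = wfun (wal a) (wbe a) (wt b x).
Proof.
move=> Lb; rewrite /weight_factor /wfun.
have -> : eaff (qnum q0) (monomial D x) (b *+ 2) = wt b x ^+ 2.
  rewrite /wt /eaff mulr2n_fst mulr2n_snd !mulr2n monD // qnumD ?q0_gt0 // expr2.
  by rewrite mulrACA.
by [].
Qed.

Lemma cn_wt b x : cn (wt b x) = q0 `^ b.2.
Proof. by rewrite /wt /eaff cnM cn_monomial mulr1 cn_real ger0_norm // powR_ge0. Qed.

(** The image of [a] under the reflection in its own gradient, hence a root with the same labels and
    constant term. On the torus the factors of [a] and [flip a] are conjugate. *)
Definition flip (a : V * R) : V * R := (- a.1, a.2).
Lemma flipE a : S a -> flip a = (refl ip a.1 a.1, a.2).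
Proof. by move=> Sa; rewrite refl_self // (S_neq0 HD Sa). Qed.

Lemma wal_W0 w a : W0 D w -> S a -> wal (w a.1, a.2) = wal a.
Proof. by move=> hw Sa; rewrite /wal (k_W0 HD hk.1 hw Sa). Qed.
Lemma wbe_W0 w a : W0 D w -> S a -> wbe (w a.1, a.2) = wbe a.
Proof. by move=> hw Sa; rewrite /wbe (k2_W0 HD hk.1 hw Sa). Qed.

Lemma wf_W0 (w : 'End(V)) a x : W0 D w -> S a -> wf a (torus_act D w x) = wf (w a.1, a.2) x.
Proof.
move=> hw Sa; have La := S_L HD Sa; have Lwa : L (w a.1) by exact: W0_L.
rewrite /wf (@wfE a a _ La) (@wfE (w a.1, a.2) (w a.1, a.2) x Lwa) (wal_W0 hw Sa) (wbe_W0 hw Sa).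
congr wfun.
rewrite /wt /eaff; congr (_ * _).
by apply: (monomial_torus_act HD) => // v; exact: W0_L.
Qed.

Lemma wt_flip a x : S a -> wt (flip a) x = conjc (wt a x).
Proof.
move=> Sa; rewrite /wt /eaff /= mon_conj; last exact: S_L.
rewrite [RHS]rmorphM; congr (_ * _); exact/esym/conjc_fix.
Qed.

Lemma wf_flip a x : S a -> wf (flip a) x = conjc (wf a x).
Proof.
move=> Sa; have La := S_L HD Sa; have hw := W0_refl_S HD Sa.
have Lf : L (flip a).1 by exact: (LN HD).
have e1 : wal (flip a) = wal a by rewrite (flipE Sa) (wal_W0 hw Sa).
have e2 : wbe (flip a) = wbe a by rewrite (flipE Sa) (wbe_W0 hw Sa).
by rewrite /wf (@wfE _ _ x Lf) (@wfE a a x La) (wt_flip x Sa) e1 e2 wfun_conj.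
Qed.

Variable x0 : V.
Hypothesis x0reg : forall al, dR D al -> ip al x0 != 0.
Hypothesis x0pos : forall al, dRp D al <-> dR D al /\ 0 < ip al x0.

Section Layers.
Variables (Q : R -> Prop) (Bd : R).
Hypothesis QB : forall r, Q r -> 0 <= r <= Bd.

(** [W0] changes gradients only, so it permutes the indivisible roots whose constant term satisfies
    [Q]. The layers in use are the constant term 0 and the constant terms in the interval from 0,
    excluded, to [N]. *)
Definition layer : set (V * R) := [set a | [/\ S a, indivisible D a & Q a.2]].
Lemma layer_finite : finite_set layer.
Proof. by apply: sub_finite_set (S_bounded_finite HD Bd) => a [Sa _ /QB]. Qed.
Definition layer_seq : seq (V * R) := fset_set layer.
Lemma layer_seqP a : a \in layer_seq <-> layer a.
Proof. by rewrite /layer_seq (in_fset_set layer_finite) inE. Qed.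
Lemma layer_uniq : uniq layer_seq. Proof. exact: fset_uniq. Qed.
Lemma layer_S a : a \in layer_seq -> S a.
Proof. by move=> /layer_seqP []. Qed.

Lemma layer_W0 w : W0 D w -> perm_eq [seq (w a.1, a.2) | a <- layer_seq] layer_seq.
Proof.
move=> hw; have [w' [hw' h1 h2]] := W0_inv hw.
apply: uniq_perm; rewrite ?layer_uniq //.
  rewrite map_inj_uniq ?layer_uniq // => a b [e1 e2].
  by rewrite [a]surjective_pairing [b]surjective_pairing e2 (W0_inj hw e1).
have st v a : W0 D v -> a \in layer_seq -> (v a.1, a.2) \in layer_seq.
  move=> hv /layer_seqP [Sa ia Qa]; apply/layer_seqP; split => //.
    exact: S_W0.
  exact: indivisible_W0.
move=> a; apply/mapP/idP => [[b bl ->]|al]; first exact: st.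
by exists (w' a.1, a.2); rewrite /= ?h2 -?surjective_pairing //; exact: st.
Qed.

Lemma layer_prod_W0 (w : 'End(V)) x : W0 D w ->
  \prod_(a <- layer_seq) wf a (torus_act D w x) = \prod_(a <- layer_seq) wf a x.
Proof.
move=> hw; rewrite -[RHS](perm_big _ (layer_W0 hw)) /= big_map; apply: eq_big_seq => a /layer_S Sa.
exact: wf_W0.
Qed.

Definition pos_layer_seq : seq (V * R) := [seq a <- layer_seq | 0 < ip a.1 x0].

Lemma layer_perm : perm_eq (pos_layer_seq ++ [seq flip a | a <- pos_layer_seq]) layer_seq.
Proof.
have flip_inj : injective flip by move=> [a r] [b s] [/oppr_inj -> ->].
have flip_in a : a \in layer_seq -> flip a \in layer_seq.
  move=> /layer_seqP [Sa ia Qa]; apply/layer_seqP; rewrite flipE //; split => //.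
    exact: (S_W0 HD (W0_refl_S HD Sa) Sa).
  exact: (indivisible_W0 HD (W0_refl_S HD Sa) ia).
apply: uniq_perm; rewrite ?layer_uniq //.
  rewrite cat_uniq map_inj_uniq // !filter_uniq ?layer_uniq // andbT /=.
  apply/hasPn => b /mapP [a]; rewrite mem_filter => /andP [pa _] ->.
  rewrite mem_filter /= ipNl oppr_gt0; apply/negP => /andP [h _].
  by have := lt_trans pa h; rewrite ltxx.
move=> a; rewrite mem_cat; apply/orP/idP => [[|/mapP [b hb ->]]|al].
- by rewrite mem_filter => /andP [].
- by move: hb; rewrite mem_filter => /andP [_]; exact: flip_in.
have := S_regular HD x0reg (layer_S al); rewrite neq_lt => /orP [l|l].
  right; apply/mapP; exists (flip a); last by rewrite /flip /= opprK -surjective_pairing.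
  by rewrite mem_filter flip_in //= ipNl oppr_gt0 l.
by left; rewrite mem_filter l.
Qed.

(** The sign of [<a, x0>] selects one root of each pair [a], [flip a], and a pair contributes a
    squared modulus. *)
Lemma layer_prod_real x :
  \prod_(a <- layer_seq) wf a x = (\prod_(a <- pos_layer_seq) cn (wf a x) ^+ 2)%:C.
Proof.
rewrite -(perm_big _ layer_perm) /= big_cat big_map /= -big_split rmorph_prod /=.
apply: eq_big_seq => a; rewrite mem_filter => /andP [_ /layer_S Sa].
by rewrite wf_flip // mul_conjc.
Qed.
End Layers.

Let Qz (r : R) : Prop := r = 0.
Let Qp (N : nat) (r : R) : Prop := 0 < r <= N%:R.
Let Qz0 r : Qz r -> 0 <= r <= 0. Proof. by move=> ->; rewrite lexx. Qed.
Let QpB N r : Qp N r -> 0 <= r <= N%:R. Proof. by move=> /andP [/ltW -> ->]. Qed.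

Definition zero_seq := layer_seq Qz.
Definition pos_seq N := layer_seq (Qp N).

Lemma pos_seqP N a : a \in pos_seq N <-> [/\ S a, indivisible D a & 0 < a.2 <= N%:R].
Proof. exact: (layer_seqP (@QpB N)). Qed.

Lemma pos_seq_uniq N : uniq (pos_seq N). Proof. exact: layer_uniq. Qed.

Definition pN (N : nat) (x : torus R n) : R[i] := \prod_(a <- pos_seq N) wf a x.
Definition cz (x : torus R n) : R[i] := \prod_(a <- Delta0_seq D) wf a x.
Definition dz (x : torus R n) : R[i] := Delta0 D k (qnum q0) (monomial D x).

Lemma Delta0_seq_perm : perm_eq (pos_layer_seq Qz) (Delta0_seq D).
Proof.
apply: uniq_perm; [by rewrite filter_uniq // layer_uniq|exact: Delta0_seq_uniq|] => a.
rewrite mem_filter; apply/andP/idP => [[pa /(layer_seqP Qz0) [Sa ia a0]]|/(Delta0_seqP HD) [/(SposP HD x0reg x0pos) [Sa da] ia a0]].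
  by apply/(Delta0_seqP HD); split => //; apply/(SposP HD x0reg x0pos); split => //; right.
split; last exact/(layer_seqP Qz0).
by case: da => [|[]//]; rewrite a0 ltxx.
Qed.

Lemma Delta_partialE N x : Delta_partial D k (qnum q0) (monomial D x) N = cz x * pN N x.
Proof.
rewrite /Delta_partial; set A := (X in \big[_/_]_(a \in X) _).
have fA : finite_set A.
  apply: sub_finite_set (S_bounded_finite HD N%:R) => a [/(SposP HD x0reg x0pos) [Sa da] ia aN].
  by split => //; rewrite aN andbT; case: da => [/ltW //|[-> _]].
rewrite (fsbig_finite _ _ fA) /=.
rewrite (perm_big (Delta0_seq D ++ pos_seq N)) /=; first by rewrite big_cat.
apply: uniq_perm; first exact: fset_uniq.
  rewrite cat_uniq Delta0_seq_uniq pos_seq_uniq andbT /=.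
  apply/hasPn => a /pos_seqP [Sa ia /andP [a0 _]]; apply/negP => /(Delta0_seqP HD) [_ _ e].
  by rewrite e ltxx in a0.
move=> a; rewrite (in_fset_set fA) mem_cat; apply/idP/orP.
  rewrite inE => -[/(SposP HD x0reg x0pos) [Sa da] ia aN]; case: da => [a0|[a0 pa]].
    by right; apply/pos_seqP; rewrite a0 aN.
  left; apply/(Delta0_seqP HD); split => //; apply/(SposP HD x0reg x0pos); split => //; by right.
rewrite inE => -[/(Delta0_seqP HD) [sa ia a0]|/pos_seqP [Sa ia /andP [a0 aN]]].
  by split => //; rewrite a0.
by split => //; apply/(SposP HD x0reg x0pos); split => //; left.
Qed.

Lemma dzE x : dz x = \prod_(a <- Delta0_seq D) conjc (wf a x).
Proof.
rewrite /dz /Delta0 -/(Delta0_set D) (fsbig_finite _ _ (Delta0_set_finite HD)) /=.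
apply: eq_big_seq => a /(Delta0_seq_S HD) [Sa a0].
have ea : - a = flip a by rewrite [LHS]surjective_pairing /flip /= a0 oppr0.
have La : L (flip a).1 by apply: (LN HD); exact: S_L.
by rewrite ea (@wfE a (flip a) x La) (wt_flip x Sa) wfun_conj /wf (@wfE a a x (S_L HD Sa)).
Qed.

(** [Delta0] consists of the factors at [-a], the conjugates of those at [a]; the two products
    together run over all linear indivisible roots. From this come the invariance and the sign of
    [nabla]. *)
Lemma cz_dz x : cz x * dz x = \prod_(a <- zero_seq) wf a x.
Proof.
rewrite dzE /cz -big_split -(perm_big _ (layer_perm Qz0)) /= big_cat big_map /= -big_split.
rewrite -(perm_big _ Delta0_seq_perm) /=; apply: eq_big_seq => a.
by rewrite mem_filter => /andP [_ /(layer_S Qz0) Sa]; rewrite /= wf_flip.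
Qed.

Lemma cz_dz_W0 (w : 'End(V)) x : W0 D w -> cz (torus_act D w x) * dz (torus_act D w x) = cz x * dz x.
Proof. by move=> hw; rewrite !cz_dz; exact: (layer_prod_W0 Qz0). Qed.
Lemma pN_W0 N (w : 'End(V)) x : W0 D w -> pN N (torus_act D w x) = pN N x.
Proof. by move=> hw; exact: (layer_prod_W0 (@QpB N)). Qed.

Lemma cmeas_wf a b : @cmeasurable _ B R (fun x => weight_factor D k (qnum q0) (monomial D x) a b).
Proof.
have m c : @cmeasurable _ B R (fun x => eaff (qnum q0) (monomial D x) c).
  by apply: cmeasM; [exact: cmeas_cst|exact: cmeas_monomial].
apply: cmeasM; first by apply: cmeasB; [exact: cmeas_cst|exact: m].
apply: cmeasV; apply: cmeasM.
  by apply: cmeasB; [exact: cmeas_cst|apply: cmeasM; [exact: cmeas_cst|exact: m]].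
by apply: cmeasD; [exact: cmeas_cst|apply: cmeasM; [exact: cmeas_cst|exact: m]].
Qed.

Lemma cbounded_prod_seq (T : eqType) (s : seq T) (f : T -> B -> R[i]) :
  (forall a, a \in s -> cbounded (f a)) -> cbounded (fun x => \prod_(a <- s) f a x).
Proof.
elim: s => [|a s IH] h; first by under eq_fun do rewrite big_nil; exact: cbounded_cst.
under eq_fun do rewrite big_cons; apply: cboundedM; first by apply: h; rewrite mem_head.
by apply: IH => b bs; apply: h; rewrite inE bs orbT.
Qed.

Lemma cbounded_wf0 a b : S a -> L b.1 -> b.2 = 0 ->
  @cbounded R n (fun x => weight_factor D k (qnum q0) (monomial D x) a b).
Proof.
move=> Sa Lb b0; split; first exact: cmeas_wf.
have [M hM] := wfun_unit_bound (wal_itv Sa) (wbe_cases a).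
by exists M => x; rewrite wfE //; apply: hM; rewrite cn_wt b0 powRr0.
Qed.

Lemma cbounded_cz : @cbounded R n cz.
Proof.
apply: cbounded_prod_seq => a /(Delta0_seq_S HD) [Sa a0].
by apply: cbounded_wf0 => //; exact: S_L.
Qed.
Lemma cbounded_dz : @cbounded R n dz.
Proof.
have -> : dz = (fun x : B => \prod_(a <- Delta0_seq D) weight_factor D k (qnum q0) (monomial D x) a (- a)).
  by apply/funext => x; rewrite /dz /Delta0 -/(Delta0_set D) (fsbig_finite _ _ (Delta0_set_finite HD)).
apply: cbounded_prod_seq => a /(Delta0_seq_S HD) [Sa a0].
by apply: cbounded_wf0 => //=; [apply/(LN HD)/S_L|rewrite a0 oppr0].
Qed.

(** The square covers [1 - e(v)] and [1 + e(v)] at once, so that off this set the linear factors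
    neither vanish nor involve a division by 0. *)
Definition singular_set : set B := [set x | exists2 v, S (v, 0) & mon x v ^+ 2 = 1].

Lemma singular_W0 (w : 'End(V)) x : W0 D w -> singular_set (torus_act D w x) -> singular_set x.
Proof.
move=> hw [v Sv e]; exists (w v); first exact: (S_W0 HD hw Sv).
by rewrite -e (monomial_torus_act HD) //; [move=> u; exact: W0_L|exact: (S_L HD Sv)].
Qed.

Lemma wf_neq0_regular a x : S a -> a.2 = 0 -> ~ singular_set x -> wf a x != 0.
Proof.
move=> Sa a0 nx; rewrite /wf (@wfE a a x (S_L HD Sa)).
apply: wfun_unit_neq0; [exact: wal_itv|exact: wbe_itv|by rewrite cn_wt a0 powRr0|].
apply/eqP => e; apply: nx; exists a.1; first by rewrite -a0 -surjective_pairing.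
by rewrite -e /wt /eaff a0 qnum0 mul1r.
Qed.

Lemma cz_neq0 x : ~ singular_set x -> cz x != 0.
Proof.
move=> nx; rewrite prodf_seq_neq0; apply/allP => a /(Delta0_seq_S HD) [Sa a0].
by apply/implyP => _; exact: wf_neq0_regular.
Qed.
Lemma dz_neq0 x : ~ singular_set x -> dz x != 0.
Proof.
move=> nx; rewrite dzE prodf_seq_neq0; apply/allP => a /(Delta0_seq_S HD) [Sa a0].
by apply/implyP => _; rewrite fmorph_eq0; exact: wf_neq0_regular.
Qed.

Lemma cz_dz_ge0 x : exists2 r : R, 0 <= r & cz x * dz x = r%:C.
Proof.
rewrite cz_dz /zero_seq (layer_prod_real Qz0); eexists; last by [].
by apply: prodr_ge0 => a _; exact: sqr_ge0.
Qed.

Lemma singular_negligible (mu : {measure set B -> \bar R}) : haar mu -> mu.-negligible singular_set.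
Proof.
move=> Hmu.
have fin : finite_set [set v | S (v, 0)].
  apply: sub_finite_set (finite_image fst (S_bounded_finite HD 0)) => v Sv.
  by exists (v, 0) => //; split => //=; rewrite lexx.
have /finite_seqP [s hs] := fin.
have : mu.-negligible [set x : B | exists2 v, v \in s & mon x (v *+ 2) = 1].
  have : forall v, v \in s -> L v /\ v != 0.
    move=> v vs; have Sv : S (v, 0) by have : [set` s] v by []; rewrite -hs.
    by split; [exact: (S_L HD Sv)|exact: (S_neq0 HD Sv)].
  elim: s {hs} => [|v s IH] h.
    apply: negligibleS (negligible_set0 mu) => x [v]; by rewrite in_nil.
  have [Lv v0] := h v (mem_head _ _).
  have h1 : mu.-negligible [set x : B | mon x (v *+ 2) = 1].
    apply: (monomial_eq_negligible HD Hmu); first exact: (Lmn HD).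
    by rewrite -scaler_nat scaler_eq0 negb_or v0 pnatr_eq0.
  apply: negligibleS (negligibleU h1 (IH _)); last by move=> u us; apply: h; rewrite inE us orbT.
  by move=> x [u]; rewrite inE => /orP [/eqP -> e|us e]; [left|right; exists u].
apply: negligibleS => x [v Sv e]; exists v.
  by have : [set v | S (v, 0)] v by []; rewrite hs.
by rewrite mulr2n monD -?expr2 //; exact: (S_L HD Sv).
Qed.

End NumericalDelta.

Lemma cancel_divisor (F : fieldType) (u v d : F) : d != 0 -> u * v = v * d * (u / d).
Proof. by move=> d0; rewrite -mulrA [d * _]mulrC divfK // mulrC. Qed.

(** * Convergence of the infinite product and integration against [nabla] *)

Section NumericalLimit.
Context {R : realType} {V : vectType R} (D : data V).
Hypothesis HD : duality_data D.
Local Notation ip := (dip D).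
Local Notation L := (dL D).
Local Notation S := (dS D).
Local Notation n := (\dim {:V}).
Local Notation B := (borel_torus R n).
Variables (q0 : R) (k : V * R -> R).
Hypotheses (hq : 0 < q0 < 1) (hk : positive_labelling D k).
Implicit Types x : torus R n.
Local Notation wfD := (wf D q0 k).
Local Notation pND := (pN D q0 k).
Local Notation czD := (cz D q0 k).
Local Notation dzD := (dz D q0 k).
Local Notation pos_seqD := (pos_seq D).

(** The least step among the progressions of [S_enum]. It provides one [th = q0 ^ r < 1] for all
    factors with positive constant term. *)
Lemma positive_gap : exists2 r : R, 0 < r & forall a, S a -> 0 < a.2 -> r <= a.2.
Proof.
have [G [G0 hG]] := S_enum HD.
have [r r0 hr] : exists2 r : R, 0 < r & forall g, g \in G -> r <= g.2.
  elim: G G0 {hG} => [|g G IH] G0; first by exists 1.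
  have [|r r0 hr] := IH; first by move=> u uG; apply: G0; rewrite inE uG orbT.
  exists (Num.min r g.2); first by rewrite lt_min r0 G0 // mem_head.
  by move=> u; rewrite inE => /orP [/eqP ->|/hr h]; rewrite ge_min ?lexx ?orbT ?h.
exists r => // a Sa a0; have [g [gG [j ea]]] := hG _ Sa (ltW a0).
apply: le_trans (hr _ gG) _; move: a0; rewrite ea /=.
case: j {ea} => [|j]; first by rewrite mulr0 ltxx.
by move=> _; rewrite ler_peMr ?ler1n // ltW // G0.
Qed.

Lemma geometric_sum_le (z : R) m : 0 <= z < 1 -> \sum_(j <- iota 0 m) z ^+ j <= (1 - z)^-1.
Proof.
move=> /andP [z0 z1].
have z1' : 0 < 1 - z by rewrite subr_gt0.
have e : (1 - z) * \sum_(j <- iota 0 m) z ^+ j = 1 - z ^+ m.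
  elim: m => [|m IH]; first by rewrite big_nil mulr0 expr0 subrr.
  rewrite -addn1 iotaD big_cat big_seq1 mulrDr IH add0n addn1 exprS; ring.
rewrite -(ler_pM2l z1') e divff ?gt_eqF // lerBlDr lerDl exprn_ge0 //.
Qed.

Definition sigma N : R := \sum_(a <- pos_seqD N) q0 `^ a.2.

(** Independently of [N], each progression contributes at most a geometric series of ratio
    [q0 ^ g.2]. *)
Lemma sigma_bounded : exists2 M : R, 0 <= M & forall N, sigma N <= M.
Proof.
have [G [G0 hG]] := S_enum HD.
have z1 g : g \in G -> 0 <= q0 `^ g.2 < 1 by move=> gG; rewrite powR_ge0 (powR_q0_lt1 hq) ?G0.
exists (\sum_(g <- G) (1 - q0 `^ g.2)^-1).
  rewrite big_seq; apply: sumr_ge0 => g /z1 /andP [_ h]; rewrite invr_ge0; lra.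
move=> N.
have [m hm] : exists m : nat, forall a, a \in pos_seqD N -> exists g, g \in G /\
    exists j : nat, (j < m)%N /\ a = (g.1, g.2 * j%:R).
  have : forall a, a \in pos_seqD N -> exists g, g \in G /\ exists j : nat, a = (g.1, g.2 * j%:R).
    by move=> a /(pos_seqP HD) [Sa _ /andP [a0 _]]; apply: hG => //; exact: ltW.
  elim: (pos_seqD N) => [|a s IH] h; first by exists 0%N.
  have [|m hm] := IH; first by move=> b bs; apply: h; rewrite inE bs orbT.
  have [g [gG [j e]]] := h a (mem_head _ _).
  exists (maxn m j.+1) => b; rewrite inE => /orP [/eqP ->|/hm [g' [g'G [j' [jm e']]]]].
    by exists g; split => //; exists j; rewrite leq_max leqnn orbT.
  by exists g'; split => //; exists j'; rewrite leq_max jm.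
apply: (@le_trans _ _ (\sum_(a <- [seq (g.1, g.2 * j%:R) | g <- G, j <- iota 0 m]) q0 `^ a.2)).
  apply: uniq_sum_le => //; first by move=> a; exact: powR_ge0.
    exact: pos_seq_uniq.
  move=> a /hm [g [gG [j [jm ->]]]].
  by apply: (allpairs_f (fun (g : V * R) (j : nat) => (g.1, g.2 * j%:R))); rewrite // mem_iota add0n.
rewrite big_allpairs_dep /= big_seq [leRHS]big_seq; apply: ler_sum => g gG.
apply: le_trans _ (geometric_sum_le m (z1 g gG)).
apply: ler_sum => j _; by rewrite powRrM powR_mulrn // powR_ge0.
Qed.

Lemma pos_seq_sub N : {subset pos_seqD N <= pos_seqD N.+1}.
Proof.
move=> a /(pos_seqP HD) [Sa ia /andP [a0 aN]]; apply/(pos_seqP HD); split => //.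
by rewrite a0 (le_trans aN) // ler_nat.
Qed.

Lemma wf_estimate : exists2 C : R, 0 <= C & forall a x, S a -> 0 < a.2 ->
  [/\ cn (wfD a x - 1) <= C * q0 `^ a.2, cn ((wfD a x)^-1 - 1) <= C * q0 `^ a.2 & wfD a x != 0].
Proof.
have [r r0 hr] := positive_gap.
have th1 := powR_q0_lt1 hq r0.
exists (2 / (1 - q0 `^ r) ^+ 2); first by rewrite divr_ge0 // sqr_ge0.
move=> a x Sa a0; have La := S_L HD Sa.
rewrite /wf (wfE HD k hq a x La).
have ha : 0 <= wal q0 k a <= 1 by case/andP: (wal_itv hq hk Sa) => -> /ltW ->.
have ht : cn (wt D q0 a x) <= q0 `^ r.
  rewrite cn_wt /powR gt_eqF ?(q0_gt0 hq) // ler_expR.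
  have [h0 h1] := andP hq; have l0 : ln q0 < 0 by rewrite ln_lt0 // h0 h1.
  by rewrite ler_wnM2r ?hr // ltW.
by have := wfun_estimate ha (wbe_itv hq hk a) ht th1; rewrite cn_wt.
Qed.

(** The estimate also holds for the inverses of the factors; applied to them it yields the lower
    bound, which keeps the limit away from 0. *)
Lemma pN_bounds : exists2 M : R, 0 < M & forall N x, cn (pND N x) <= M /\ M^-1 <= cn (pND N x).
Proof.
have [C C0 hC] := wf_estimate; have [Mb M0 hM] := sigma_bounded.
exists (expR (C * Mb)); first exact: expR_gt0.
move=> N x.
have hs a : a \in pos_seqD N -> S a /\ 0 < a.2 by move=> /(pos_seqP HD) [Sa _ /andP []].
have e1 : \sum_(a <- pos_seqD N) C * q0 `^ a.2 = C * sigma N by rewrite /sigma mulr_sumr.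
have le1 : expR (C * sigma N) <= expR (C * Mb) by rewrite ler_expR ler_wpM2l.
split.
  have [|h _] := @cn_prod_bound _ _ (pos_seqD N) (fun a => wfD a x) (fun a => C * q0 `^ a.2).
    by move=> a /hs [Sa a0]; have [] := hC a x Sa a0.
  by apply: le_trans h _; rewrite e1.
have [|h _] := @cn_prod_bound _ _ (pos_seqD N) (fun a => (wfD a x)^-1) (fun a => C * q0 `^ a.2).
  by move=> a /hs [Sa a0]; have [] := hC a x Sa a0.
rewrite prodfV cnV e1 in h; have {}h := le_trans h le1.
have pn0 : 0 < cn (pND N x).
  rewrite lt_def cn_ge0 andbT cn_eq0 prodf_seq_neq0; apply/allP => a /hs [Sa a0].
  by apply/implyP => _; have [] := hC a x Sa a0.
by rewrite -[leRHS]invrK lef_pV2 ?posrE ?invr_gt0 ?expR_gt0.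
Qed.

(** The increment is [pN N x * (P - 1)], with [P] the product of the new factors, and [|P - 1| <=
    exp(C dl) - 1 <= C dl exp(C Mb)], where [dl] is the increment of [sigma]. *)
Lemma pN_increment : exists2 K : R, 0 <= K & forall N x,
  cn (pND N.+1 x - pND N x) <= K * (sigma N.+1 - sigma N).
Proof.
have [C C0 hC] := wf_estimate; have [Mb Mb0 hMb] := sigma_bounded; have [M M0 hM] := pN_bounds.
exists (M * C * expR (C * Mb)).
  by rewrite !mulr_ge0 ?expR_ge0 // ltW.
move=> N x; pose rest := [seq a <- pos_seqD N.+1 | a \notin pos_seqD N].
have sub := @pos_seq_sub N; have U := pos_seq_uniq D N; have U' := pos_seq_uniq D N.+1.
have e1 : pND N.+1 x = pND N x * \prod_(a <- rest) wfD a x.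
  by rewrite /pN (big_sub_split U U' sub) big_filter.
pose dl := \sum_(a <- rest) q0 `^ a.2.
have e2 : sigma N.+1 - sigma N = dl.
  by rewrite /sigma (big_sub_split U U' sub) /dl big_filter /= addrAC subrr add0r.
have dl0 : 0 <= dl by apply: sumr_ge0 => a _; exact: powR_ge0.
have dlM : dl <= Mb.
  rewrite -e2; have := hMb N.+1.
  have : 0 <= sigma N by apply: sumr_ge0 => a _; exact: powR_ge0.
  lra.
have hs a : a \in rest -> S a /\ 0 < a.2.
  by rewrite mem_filter => /andP [_ /(pos_seqP HD) [Sa _ /andP []]].
have [|_ h] := @cn_prod_bound _ _ rest (fun a => wfD a x) (fun a => C * q0 `^ a.2).
  by move=> a /hs [Sa a0]; have [] := hC a x Sa a0.
rewrite -mulr_sumr -/dl in h.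
rewrite e2 e1; have -> : pND N x * \prod_(a <- rest) wfD a x - pND N x =
  pND N x * (\prod_(a <- rest) wfD a x - 1) by rewrite mulrBr mulr1.
rewrite cnM -!mulrA; apply: ler_pM; [exact: cn_ge0|exact: cn_ge0|by case: (hM N x)|].
apply: le_trans h _; apply: le_trans (expR_sub1_le _) _.
rewrite -mulrA ler_wpM2l // mulrC ler_wpM2r // ler_expR ler_wpM2l //.
Qed.

Variable x0 : V.
Hypothesis x0reg : forall al, dR D al -> ip al x0 != 0.
Hypothesis x0pos : forall al, dRp D al <-> dR D al /\ 0 < ip al x0.

Lemma pN_real N x : pND N x = (cn (pND N x))%:C.
Proof.
have [r r0 e] : exists2 r : R, 0 <= r & pND N x = r%:C.
  have QB (r : R) : 0 < r <= N%:R -> 0 <= r <= N%:R by move=> /andP [/ltW -> ->].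
  rewrite /pN /pos_seq (layer_prod_real HD hq hk x0reg QB); eexists; last by [].
  by apply: prodr_ge0 => a _; exact: sqr_ge0.
by rewrite e cn_real ger0_norm.
Qed.

Lemma pN_ccvg x : ccvg (fun N => pND N x).
Proof.
have [K K0 hK] := pN_increment; have [M M0 hM] := pN_bounds; have [Mb Mb0 hMb] := sigma_bounded.
have sM m : sigma m <= M + Mb by apply: le_trans (hMb m) _; rewrite lerDr ltW.
split.
  apply: (cvg_of_increments (sg := sigma) (M := M + Mb) K0) => // m.
    by rewrite -raddfB; apply: le_trans (Re_cn _) (hK _ _).
  by apply: le_trans (Re_cn _) _; have [h _] := hM m x; apply: le_trans h _; rewrite lerDl.
apply: (cvg_of_increments (sg := sigma) (M := M + Mb) K0) => // m.
  by rewrite -raddfB; apply: le_trans (Im_cn _) (hK _ _).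
by apply: le_trans (Im_cn _) _; have [h _] := hM m x; apply: le_trans h _; rewrite lerDl.
Qed.

Definition plim x : R[i] := clim (fun N => pND N x).

Lemma plim_real : exists2 M : R, 0 < M & forall x, exists r : R, [/\ M^-1 <= r, r <= M & plim x = r%:C].
Proof.
have [M M0 hM] := pN_bounds; exists M => // x.
have [h1 _] := pN_ccvg x.
exists (lim ((fun N => complex.Re (pND N x)) @ \oo)); split.
- apply: limr_ge => //; near=> N; rewrite pN_real /=; by case: (hM N x).
- apply: limr_le => //; near=> N; rewrite pN_real /=; by case: (hM N x).
rewrite /plim /clim; congr (_ +i* _).
under eq_fun do rewrite pN_real /=.
by apply/cvg_lim => //; exact: cvg_cst.
Unshelve. all: by end_near. Qed.

Lemma cbounded_plim : @cbounded R n plim.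
Proof.
have [M M0 hM] := plim_real; split; last first.
  exists M => x; have [r [r1 r2 ->]] := hM x; rewrite cn_real ger0_norm //.
  by apply: le_trans r1; rewrite invr_ge0 ltW.
have mp N : @cmeasurable _ B R (pND N) by apply: cmeas_prod => a; exact: cmeas_wf.
split.
  apply: (@measurable_fun_cvg _ B R setT (fun N x => complex.Re (pND N x)) (fun x => complex.Re (plim x))) => [N|x _].
    by case: (mp N).
  by have [h _] := pN_ccvg x; exact: h.
apply: (@measurable_fun_cvg _ B R setT (fun N x => complex.Im (pND N x)) (fun x => complex.Im (plim x))) => [N|x _].
  by case: (mp N).
by have [_ h] := pN_ccvg x; exact: h.
Qed.

Lemma Delta_numE x : Delta_num D q0 k x = czD x * plim x.
Proof.
rewrite /Delta_num -(climZ _ (pN_ccvg x)); congr clim; apply/funext => N.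
exact: (Delta_partialE HD q0 k x0reg x0pos).
Qed.

Lemma nabla_numE x : nabla_num D q0 k x = czD x * dzD x * plim x.
Proof. by rewrite /nabla_num Delta_numE mulrAC. Qed.

Lemma cbounded_Delta : @cbounded R n (Delta_num D q0 k).
Proof.
have -> : Delta_num D q0 k = (fun x => czD x * plim x) by apply/funext => x; exact: Delta_numE.
by apply: cboundedM; [exact: cbounded_cz|exact: cbounded_plim].
Qed.

Lemma cbounded_nabla : @cbounded R n (nabla_num D q0 k).
Proof.
have -> : nabla_num D q0 k = (fun x => czD x * dzD x * plim x) by apply/funext => x; exact: nabla_numE.
by apply: cboundedM; [apply: cboundedM; [exact: cbounded_cz|exact: cbounded_dz]|exact: cbounded_plim].
Qed.

Lemma nabla_W0 (w : 'End(V)) x : W0 D w -> nabla_num D q0 k (torus_act D w x) = nabla_num D q0 k x.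
Proof.
move=> hw; rewrite nabla_numE [RHS]nabla_numE.
have e : (fun N => pND N (torus_act D w x)) = (fun N => pND N x) by apply/funext => N; exact: pN_W0.
exact: (f_equal2 *%R (cz_dz_W0 HD hq hk x0reg x0pos x hw) (congr1 clim e)).
Qed.

Lemma nabla_nonneg x : 0 <= complex.Re (nabla_num D q0 k x).
Proof.
have [M M0 hM] := plim_real; have [r [r1 _ e]] := hM x.
have [s s0 e'] := cz_dz_ge0 HD hq hk x0reg x0pos x.
rewrite nabla_numE e e' ReM /= mulr0 subr0 mulr_ge0 //.
by apply: le_trans r1; rewrite invr_ge0 ltW.
Qed.

Lemma nabla_regular x : ~ singular_set D x -> complex.Re (nabla_num D q0 k x) != 0.
Proof.
move=> nx; have [M M0 hM] := plim_real; have [r [r1 _ e]] := hM x.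
have [s s0 e'] := cz_dz_ge0 HD hq hk x0reg x0pos x.
have : czD x * dzD x != 0.
  by rewrite mulf_neq0 // ?(cz_neq0 HD hq hk nx) // (dz_neq0 HD hq hk nx).
rewrite e' fmorph_eq0 => sn; rewrite nabla_numE e e' ReM /= mulr0 subr0 mulf_neq0 //.
by rewrite gt_eqF // (lt_le_trans _ r1) // invr_gt0.
Qed.

Section Integrals.
Context (mu : {measure set B -> \bar R}).
Hypothesis Hmu : haar mu.

Lemma nabla_integral_neq0 : torus_integral mu (nabla_num D q0 k) != 0.
Proof.
exact: (torus_integral_pos_neq0 Hmu cbounded_nabla (singular_negligible HD Hmu) nabla_nonneg nabla_regular).
Qed.

(** Needed because the character of [torus_act D w x] is compared with [monomial D x \o w] only on
    [L]. *)
Lemma Delta0_ext (e e' : V -> R[i]) : (forall v, L v -> e v = e' v) ->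
  Delta0 D k (qnum q0) e = Delta0 D k (qnum q0) e'.
Proof.
move=> h; rewrite /Delta0 -/(Delta0_set D) !(fsbig_finite _ _ (Delta0_set_finite HD)) /=.
apply: eq_big_seq => a /(Delta0_seq_S HD) [Sa _].
have La : L (- a.1) by apply: (LN HD); exact: S_L.
have L2 : L ((- a).1 *+ 2) by exact: (Lmn HD).
by rewrite /weight_factor /eaff mulr2n_fst (h _ La) (h _ L2).
Qed.

Lemma Delta_integral (T : plist) la : L la -> pl_over D T ->
  (forall (e : V -> R[i]), e 0 = 1 -> (forall u v, L u -> L v -> e (u + v) = e u * e v) ->
    (forall v, S (v, 0) -> e v ^+ 2 != 1) ->
    \sum_(w <- W0_seq D) e (w la) / Delta0 D k (qnum q0) (e \o w) = pl_ev k (qnum q0) e T) ->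
  (card_W0 D)%:R * torus_integral mu (fun x => monomial D x la * Delta_num D q0 k x) =
  \sum_(t <- T) pm_ev k (qnum q0) t.1 *
    torus_integral mu (fun x => monomial D x t.2 * nabla_num D q0 k x).
Proof.
move=> Lla TL hT; pose G x := monomial D x la * Delta_num D q0 k x.
have gG : cbounded (G : B -> R[i]) by apply: cboundedM; [exact: cbounded_monomial|exact: cbounded_Delta].
have gGw (w : 'End(V)) : cbounded ((fun x => G (torus_act D w x)) : B -> R[i]).
  have [m [M hM]] := gG; split; last by exists M => x; exact: hM.
  exact: (cmeas_comp (measurable_torus_act D w) m).
transitivity (\sum_(w <- W0_seq D) torus_integral mu (fun x => G (torus_act D w x))).
  transitivity (\sum_(w <- W0_seq D) torus_integral mu G).
    by rewrite big_const_seq count_predT size_W0_seq // iter_addr_0 mulr_natl.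
  apply: eq_big_seq => w /(W0_seqP HD) hw; apply: esym.
  have [w' [hw' h1 h2]] := W0_inv hw.
  apply: (torus_integral_hom Hmu gG (measurable_torus_act D w) (torus_act_hom D w) (psi := torus_act D w')).
  by apply: (torus_act_cancel HD) => // v; exact: W0_L.
rewrite -(torus_integral_sum Hmu) //.
have gN v : cbounded ((fun x => monomial D x v * nabla_num D q0 k x) : B -> R[i]).
  by apply: cboundedM; [exact: cbounded_monomial|exact: cbounded_nabla].
under [RHS]eq_bigr do rewrite -(torus_integralZ Hmu _ (gN _)).
have gT t : cbounded ((fun x => pm_ev k (qnum q0) t.1 * (monomial D x t.2 * nabla_num D q0 k x)) : B -> R[i]).
  by apply: cboundedM; [exact: cbounded_cst|exact: gN].
rewrite -(torus_integral_sum Hmu T gT).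
apply: (torus_integral_ae (N := singular_set D)).
- by apply: cmeas_sum => w; case: (gGw w).
- by apply: cmeas_sum => t; case: (gT t).
- exact: singular_negligible.
move=> x nx.
have reg v : S (v, 0) -> monomial D x v ^+ 2 != 1 by move=> Sv; apply/eqP => e; apply: nx; exists v.
have h := hT (monomial D x) (mon0 HD x) (fun u v Lu Lv => monD HD x Lu Lv) reg.
transitivity (nabla_num D q0 k x * pl_ev k (qnum q0) (monomial D x) T); last first.
  rewrite /pl_ev mulr_sumr; apply: eq_bigr => t _.
  by rewrite mulrC -mulrA.
rewrite -h mulr_sumr; apply: eq_big_seq => w /(W0_seqP HD) hw.
have ext v : L v -> monomial D (torus_act D w x) v = (monomial D x \o w) v.
  by move=> Lv; apply: (monomial_torus_act HD) => // u; exact: W0_L.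
have d0 : dzD (torus_act D w x) != 0.
  by apply: (dz_neq0 HD hq hk) => h'; apply: nx; exact: (singular_W0 HD hw h').
(* [Delta = nabla / Delta0] is used at the point [torus_act D w x]: there [nabla] has its value at
   [x], and [Delta0] is that of the twisted character [monomial D x \o w]. *)
rewrite -(nabla_W0 x hw) -(Delta0_ext ext) /G ext // /nabla_num.
exact: cancel_divisor.
Qed.
End Integrals.
End NumericalLimit.

(** * Comparison of the constant terms *)

Section TwistedAverage.
Variables (F : fieldType) (I : eqType) (s : seq I) (act : I -> F -> F) (N d : F).
Hypothesis actD : forall i, i \in s -> {morph act i : x y / x + y}.
Hypothesis actM : forall i, i \in s -> {morph act i : x y / x * y}.

(** In the application [act] is the action of [W0] on [K(L)], [N] is [1 / #W0] and [d] is [Delta0].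
    The morphism laws are asked for [i] in [s] because [KLact] is shown to be a ring morphism for
    elements of [W0]. *)
Definition twisted_avg (h : F) : F := N * \sum_(i <- s) act i (h / d).

Lemma act_0 i : i \in s -> act i 0 = 0.
Proof. by move=> si; apply: (addrI (act i 0)); rewrite -actD // !addr0. Qed.

Lemma twisted_avg0 : twisted_avg 0 = 0.
Proof. by rewrite /twisted_avg big_seq big1 ?mulr0 // => i si; rewrite mul0r act_0. Qed.

Lemma twisted_avg_linear c x y : (forall i, i \in s -> act i c = c) ->
  twisted_avg (c * x + y) = c * twisted_avg x + twisted_avg y.
Proof.
move=> hc; rewrite /twisted_avg mulrCA -mulrDr [c * \sum_(i <- s) _]mulr_sumr -big_split /=.
congr (N * _); apply: eq_big_seq => i si.
by rewrite mulrDl actD // -mulrA actM // hc.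
Qed.

Lemma twisted_avg_sum (J : eqType) (r : seq J) (c x : J -> F) :
  (forall j i, j \in r -> i \in s -> act i (c j) = c j) ->
  twisted_avg (\sum_(j <- r) c j * x j) = \sum_(j <- r) c j * twisted_avg (x j).
Proof.
elim: r => [|j r IH] h; first by rewrite !big_nil twisted_avg0.
rewrite !big_cons twisted_avg_linear => [|i]; last by apply: h; rewrite mem_head.
by rewrite IH // => j' i jr; apply: h; rewrite inE jr orbT.
Qed.

(** Invariant coefficients move out of the average. For the entries of [M] this turns the matrix
    form into the average of a single product over [Delta0]. *)
Lemma twisted_avg_bilinear (J : eqType) (r : seq J) (a b u v : J -> F) :
  (forall j i, j \in r -> i \in s -> act i (a j) = a j) ->
  (forall j i, j \in r -> i \in s -> act i (b j) = b j) ->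
  \sum_(j <- r) \sum_(j' <- r) a j * twisted_avg (u j * v j') * b j' =
  twisted_avg ((\sum_(j <- r) a j * u j) * (\sum_(j <- r) b j * v j)).
Proof.
move=> ha hb; rewrite mulr_suml.
under [in RHS]eq_bigr do rewrite -mulrA.
rewrite twisted_avg_sum //; apply: eq_bigr => j _.
rewrite mulr_sumr; under [in RHS]eq_bigr do rewrite mulrCA.
rewrite twisted_avg_sum // mulr_sumr; apply: eq_bigr => j' _.
by rewrite -mulrA [X in a j * X]mulrC.
Qed.
End TwistedAverage.

Lemma weight_factor_rmorph (R : realType) (V : vectType R) (D : data V) (k : V * R -> R)
    (F F' : fieldType) (P : {rmorphism F -> F'}) (qF : R -> F) (qF' : R -> F')
    (e : V -> F) (e' : V -> F') (a b : V * R) :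
  (forall r, P (qF r) = qF' r) -> P (e b.1) = e' b.1 -> P (e (b *+ 2).1) = e' (b *+ 2).1 ->
  P (weight_factor D k qF e a b) = weight_factor D k qF' e' a b.
Proof.
move=> h1 h2 h3; rewrite /weight_factor /eaff fmorph_div rmorphM !rmorphB rmorphD.
by rewrite !rmorphM rmorph1 !h1 h2 h3.
Qed.

(** * The Weyl group and the involution on [K(L)] *)

Section FractionFieldAction.
Context {R : realType} {V : vectType R} (D : data V) (K : fieldType).
Hypothesis HD : duality_data D.
Local Notation L := (dL D).
Local Notation n := (\dim {:V}).
Local Notation KLe := (KLe D K).
Local Notation tofrac := (@FracField.tofrac (mpoly.mpoly n K)).

Lemma in_A_exp x m : in_A D x -> in_A D (x ^+ m : KL V K).
Proof.
move=> Ax; elim: m => [|m IH]; first by rewrite expr0; exact: in_A1.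
by rewrite exprS; apply: in_AM.
Qed.

Lemma in_A_tofrac p : in_A D (tofrac p : KL V K).
Proof.
rewrite [p]mpolyE rmorph_sum; apply: in_A_sum => // m _.
rewrite -mul_mpolyC rmorphM; apply: in_AM => //; first exact: (in_A_C HD).
rewrite mpolyXE_id rmorph_prod; apply: in_A_prod => // i _.
rewrite rmorphXn; apply: in_A_exp.
by have := in_A_e K (L_basis HD i); rewrite (KLe_basis K HD).
Qed.

Lemma eq_on_in_A (P Q : {rmorphism KL V K -> KL V K}) :
  (forall c, P (KLC V c) = Q (KLC V c)) -> (forall v, L v -> P (KLe v) = Q (KLe v)) ->
  forall x, in_A D x -> P x = Q x.
Proof.
move=> h1 h2 x [s [sL ->]]; rewrite !rmorph_sum; apply: eq_big_seq => t /sL Lt.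
by rewrite !rmorphM h1 h2.
Qed.

Lemma eq_rmorph_KL (P Q : {rmorphism KL V K -> KL V K}) :
  (forall c, P (KLC V c) = Q (KLC V c)) -> (forall v, L v -> P (KLe v) = Q (KLe v)) -> P =1 Q.
Proof.
move=> h1 h2 x; have [p [r [_ ->]]] := KLfracP x.
by rewrite !fmorph_div; congr (_ / _); apply: eq_on_in_A => //; exact: in_A_tofrac.
Qed.

Lemma KLact_comp (v w : 'End(V)) x : W0 D v -> W0 D w ->
  KLact D v (KLact D w x : KL V K) = KLact D (v \o w)%VF x.
Proof.
move=> hv hw; have hvw := W0_comp hv hw.
have [P [P1 P2 P3]] := KLact_rmorphism K HD hv.
have [Q [Q1 Q2 Q3]] := KLact_rmorphism K HD hw.
have [T [T1 T2 T3]] := KLact_rmorphism K HD hvw.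
rewrite T1 P1 Q1; apply: (eq_rmorph_KL (P := P \o Q)) => [c|u Lu] /=.
  by rewrite Q2 P2 T2.
by rewrite Q3 // P3 ?T3 ?comp_lfunE //; exact: (W0_L HD hw).
Qed.

Lemma KLact_star (star : {rmorphism K -> K}) (w : 'End(V)) x : W0 D w -> in_A D x ->
  KLact D w (KLstar D star x : KL V K) = KLstar D star (KLact D w x).
Proof.
move=> hw Ax; have [P [P1 P2 P3]] := KLact_rmorphism K HD hw.
have [Q [Q1 Q2 Q3]] := KLstar_rmorphism HD star.
rewrite P1 !Q1 P1; apply: (eq_on_in_A (P := P \o Q) (Q := Q \o P)) => // [c|u Lu] /=.
  by rewrite Q2 P2 P2 Q2.
have LNu : L (- u) by exact: (LN HD).
have Lwu : L (w u) by exact: (W0_L HD hw).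
by rewrite Q3 // P3 // P3 // Q3 // linearN.
Qed.

Lemma in_A_star (star : {rmorphism K -> K}) x : in_A D x -> in_A D (KLstar D star x : KL V K).
Proof.
have [Q [Q1 Q2 Q3]] := KLstar_rmorphism HD star.
by rewrite Q1; apply: (in_A_map HD Q2 Q3) => v; exact: (LN HD).
Qed.

Lemma min_reps_finite J : finite_set (min_reps D J).
Proof. by apply: sub_finite_set (W0_finite HD) => v [s [hs -> _]]; exists s. Qed.

End FractionFieldAction.

(** * From numerical integrals to constant terms in [K] *)

Section ConstantTermIdentity.
Context (R : realType) (V : vectType R) (D : data V).
Hypothesis HD : duality_data D.
Context (K : fieldType) (q : R -> K) (star : {rmorphism K -> K}).
Hypothesis Hq : coefficient_data q star.
Variable k : V * R -> R.
Hypothesis Hk : labelling D k.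
Variable mu : {measure set (borel_torus R (\dim {:V})) -> \bar R}.
Hypothesis Hmu : haar mu.
Hypotheses (HDelta : ct_defined D mu q k (Delta_num D))
  (Hnabla : ct_defined D mu q k (nabla_num D)).
Local Notation L := (dL D).
Local Notation KLe := (KLe D K).
Local Notation T0 := (fun q0 k' => torus_integral mu (Delta_num D q0 k')).
Local Notation I Theta la :=
  (fun q0 k' => torus_integral mu (fun y => monomial D y la * Theta q0 k' y)).

Let K0 : [pchar K] =i pred0. Proof. by case: Hq. Qed.
Let qn0 : forall x, q x != 0. Proof. by case: Hq => _ []. Qed.
Let qD : forall x y, q (x + y) = q x * q y. Proof. by case: Hq => _ []. Qed.
Let q00 : q 0 = 1. Proof. exact: q_0. Qed.

Lemma ct_value_chosen Theta la : ct_defined D mu q k Theta -> L la ->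
  ctv D q k T0 (I Theta la) (xget 0 (ct_value D mu q k Theta la)).
Proof. by move=> h Lla; exact: xgetPex (h la Lla). Qed.

(** The value for [nabla] at [la = 0], supplied by [Hnabla], is the auxiliary representation in
    [ctv_unique]; the integral of [nabla] is what gets cancelled. *)
Lemma ct_value_unique J x y : ctv D q k T0 J x -> ctv D q k T0 J y -> x = y.
Proof.
have [x0 h0] := Hnabla (L0 HD).
apply: (ctv_unique K0 qn0 qD Hk _ h0) => q0 k' hq hk.
have -> : (fun y : torus R (\dim {:V}) => monomial D y 0 * nabla_num D q0 k' y) = nabla_num D q0 k'.
  by apply/funext => x1; rewrite (mon0 HD) mul1r.
have [z [zreg zpos]] := positive_vector HD.
exact: (nabla_integral_neq0 HD hq hk zreg zpos Hmu).
Qed.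

(** [ct] reads its value off some expansion of [F]. Two expansions differ by a relation among the
    independent [KLe], so any list may be used. *)
Lemma ctE (F : KL V K) Theta (s : seq (K * V)) : (forall t, t \in s -> L t.2) ->
  F = \sum_(t <- s) KLC V t.1 * KLe t.2 ->
  ct D mu q k F Theta = \sum_(t <- s) t.1 * xget 0 (ct_value D mu q k Theta t.2).
Proof.
move=> sL eF; rewrite /ct; set X := (X in xget _ X).
have [|s' [s'L eF' ->]] := @xgetPex _ 0 X; first by eexists; exists s; split.
apply/eqP; rewrite -subr_eq0; apply/eqP.
pose s2 := s' ++ [seq (- t.1, t.2) | t <- s].
have s2L t : t \in s2 -> L t.2.
  rewrite mem_cat => /orP [/s'L //|/mapP [u us ->]]; exact: (sL u us).
have := KLe_functional HD (fun v => xget 0 (ct_value D mu q k Theta v)) s2L.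
rewrite big_cat [X in _ + X = _ -> _]big_map -eF'.
under eq_bigr do rewrite -KLCmE rmorphN mulNr KLCmE.
rewrite sumrN -eF subrr big_cat big_map => /(_ erefl) h; apply: etrans h; congr (_ + _).
by rewrite -sumrN; apply: eq_bigr => t _; rewrite /= mulNr.
Qed.

Local Notation Dl := (Delta0_KL D q k).
Local Notation avgA :=
  (twisted_avg (W0_seq D) (@KLact R V D K) ((card_W0 D)%:R^-1 : KL V K) Dl).

Lemma KLact_add w : w \in W0_seq D -> {morph (KLact D w : KL V K -> KL V K) : x y / x + y}.
Proof.
move=> /(W0_seqP HD) hw x y; have [P [P1 _ _]] := KLact_rmorphism K HD hw.
by rewrite !P1 rmorphD.
Qed.
Lemma KLact_mul w : w \in W0_seq D -> {morph (KLact D w : KL V K -> KL V K) : x y / x * y}.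
Proof.
move=> /(W0_seqP HD) hw x y; have [P [P1 _ _]] := KLact_rmorphism K HD hw.
by rewrite !P1 rmorphM.
Qed.
Lemma KLact_C w (c : K) : w \in W0_seq D -> KLact D w (KLC V c) = KLC V c.
Proof.
by move=> /(W0_seqP HD) hw; have [P [P1 P2 _]] := KLact_rmorphism K HD hw; rewrite P1 P2.
Qed.

Lemma KLact_Delta0 w : W0 D w ->
  KLact D w Dl = Delta0 D k (fun r => KLC V (q r)) (KLe \o w).
Proof.
move=> hw; have [P [P1 P2 P3]] := KLact_rmorphism K HD hw.
rewrite P1 /Delta0_KL /Delta0 -/(Delta0_set D) !(fsbig_finite _ _ (Delta0_set_finite HD)) /=.
rewrite rmorph_prod; apply: eq_big_seq => a /(Delta0_seq_S HD) [Sa _].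
have La : L (- a).1 by apply: (LN HD); exact: S_L.
apply: weight_factor_rmorph => [r||]; [exact: P2|exact: P3|apply: P3].
by rewrite mulr2n_fst; exact: (Lmn HD).
Qed.

Lemma KLe_regular v : dS D (v, 0) -> KLe v ^+ 2 != 1.
Proof.
move=> Sv; have Lv := S_L HD Sv.
rewrite expr2 -(KLeD K HD Lv Lv) -subr_eq0 -opprB oppr_eq0.
apply: KLe_neq1 => //; first exact: (LD HD).
by rewrite -mulr2n -scaler_nat scaler_eq0 negb_or pnatr_eq0 (S_neq0 HD Sv).
Qed.

(* The same list of monomials expands the average in [K(L)] and, at each
   numerical point, the integrand: this is what links [ct(e(la) Delta)] to the
   constant terms against [nabla]. *)
Lemma avg_monomial la : L la -> exists s : seq (K * V),
  [/\ forall t, t \in s -> L t.2,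
      avgA (KLe la) = \sum_(t <- s) KLC V t.1 * KLe t.2 &
      xget 0 (ct_value D mu q k (Delta_num D) la) =
        \sum_(t <- s) t.1 * xget 0 (ct_value D mu q k (nabla_num D) t.2)].
Proof.
move=> Lla; have [T TL hT] := avg_Delta0 HD Lla.
have [rK rKE] := ratr_rmorphism K0.
have card0 : (card_W0 D)%:R != 0 :> rat by rewrite pnatr_eq0 -lt0n card_W0_gt0.
(* The factor [1 / #W0], as a monomial in the parameters with exponent 0. *)
pose c0 : rat * pmonomial (R := R) (V := V) := ((card_W0 D)%:R^-1, (0, [::])).
pose T' : plist := [seq (pm_mul c0 t.1, t.2) | t <- T].
have pe0 k' : pexponent k' (0, [::]) = 0 :> R by rewrite /pexponent big_nil addr0.
have ratN (F : fieldType) (r : {rmorphism rat -> F}) : r =1 ratr ->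
    ratr (card_W0 D)%:R^-1 = (card_W0 D)%:R^-1 :> F.
  by move=> rE; rewrite -rE fmorphV rmorph_nat.
exists [seq (pm_ev k q t.1, t.2) | t <- T']; split.
- by move=> t /mapP [u /mapP [v /TL [Lv _] ->] ->].
- rewrite !big_map /=.
  have h := hT k (KL V K) (@KLCm R V K \o rK) (fun r => KLC V (q r)) KLe.
  rewrite /twisted_avg (eq_big_seq (fun w : 'End(V) => KLe (w la) / Delta0 D k (fun r => KLC V (q r)) (KLe \o w))); last first.
    move=> w /(W0_seqP HD) hw; have [P [P1 P2 P3]] := KLact_rmorphism K HD hw.
    by rewrite -(KLact_Delta0 hw) !P1 fmorph_div P3.
  rewrite h; first last.
  + exact: KLe_regular.
  + by move=> u v; exact: (KLeD K HD).
  + exact: (KLe0 K HD).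
  + by move=> x y; rewrite qD -!KLCmE rmorphM.
  + by rewrite q00 -KLCmE rmorph1.
  + by move=> x; rewrite /= rKE; exact: (fmorph_rat (@KLCm R V K)).
  rewrite /pl_ev mulr_sumr; apply: eq_bigr => t _; rewrite mulrA; congr (_ * _).
  rewrite (pm_ev_mul k rKE qD) -KLCmE rmorphM; congr (_ * _).
    have -> : pm_ev k q c0 = (card_W0 D)%:R^-1 by rewrite /pm_ev /c0 /= pe0 q00 mulr1 (ratN _ _ rKE).
    by rewrite fmorphV rmorph_nat.
  by rewrite /pm_ev rmorphM (fmorph_rat (@KLCm R V K)).
rewrite big_map.
(* By uniqueness the right-hand side need only be a value for the integrals of [e(la) Delta].
   [ctv_sum] makes it a value for the sum of integrals against [nabla], which [Delta_integral]
   identifies with them. *)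
apply: (ct_value_unique (ct_value_chosen HDelta Lla)).
have hs t : t \in T' -> (forall u, u \in t.1.2.2 -> dS D u.2) /\
    ctv D q k T0 (I (nabla_num D) t.2) (xget 0 (ct_value D mu q k (nabla_num D) t.2)).
  move=> /mapP [u /TL [Lu Su] ->]; split => //=; exact: ct_value_chosen.
have := ctv_sum K0 qn0 qD (I := fun la' => I (nabla_num D) la')
  (Y := fun la' => xget 0 (ct_value D mu q k (nabla_num D) la')) hs.
apply: ctv_ext => q0 k' hq hk.
have [rC rCE] := ratr_rmorphism (pchar_num R[i]).
have [z [zreg zpos]] := positive_vector HD.
have qDn x y : qnum q0 (x + y) = qnum q0 x * qnum q0 y by exact: qnumD (q0_gt0 hq).
have := Delta_integral HD hq hk zreg zpos Hmu Lla TL.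
move=> /(_ (fun e e0 eD er => hT k' _ rC (qnum q0) e rCE (qnum0 q0) qDn e0 eD er)) h.
rewrite big_map /=.
have card0C : (card_W0 D)%:R != 0 :> R[i] by rewrite pnatr_eq0 -lt0n card_W0_gt0.
apply: (mulfI card0C); rewrite h mulr_sumr; apply: eq_bigr => t _.
have c0E : pm_ev k' (qnum q0) c0 = (card_W0 D)%:R^-1.
  by rewrite /pm_ev /c0 /= pe0 qnum0 mulr1 (ratN _ _ rCE).
by rewrite (pm_ev_mul k' rCE qDn) c0E -mulrA mulVKf.
Qed.

Lemma avg_in_A_ct F (s : seq (K * V)) : (forall t, t \in s -> L t.2) ->
  F = \sum_(t <- s) KLC V t.1 * KLe t.2 ->
  in_A D (avgA F) /\ ct D mu q k F (Delta_num D) = ct D mu q k (avgA F) (nabla_num D).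
Proof.
move=> sL eF.
suff [s' [s'L e1 e2]] : exists s' : seq (K * V), [/\ forall t, t \in s' -> L t.2,
    avgA F = \sum_(t <- s') KLC V t.1 * KLe t.2 &
    \sum_(t <- s) t.1 * xget 0 (ct_value D mu q k (Delta_num D) t.2) =
    \sum_(t <- s') t.1 * xget 0 (ct_value D mu q k (nabla_num D) t.2)].
  split; first by exists s'.
  by rewrite (ctE _ sL eF) e2 (ctE _ s'L e1).
rewrite {}eF (twisted_avg_sum _ _ KLact_add KLact_mul); last by move=> t w _; exact: KLact_C.
elim: s sL => [|t s IH] sL; first by exists [::]; rewrite !big_nil.
have [|s1 [L1 e1 e2]] := IH; first by move=> u us; apply: sL; rewrite inE us orbT.
have [s2 [L2 e3 e4]] := avg_monomial (sL t (mem_head _ _)).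
exists ([seq (t.1 * u.1, u.2) | u <- s2] ++ s1); split.
- move=> u; rewrite mem_cat => /orP [/mapP [v vs ->]|]; [exact: (L2 v vs)|exact: L1].
- rewrite big_cons e1 e3 big_cat big_map mulr_sumr; congr (_ + _); apply: eq_bigr => u _.
  by rewrite mulrA; congr (_ * _); exact/esym/(rmorphM (@KLCm R V K)).
rewrite big_cons e2 e4 big_cat big_map mulr_sumr; congr (_ + _); apply: eq_bigr => u _.
by rewrite mulrA.
Qed.

Lemma m_entryE e v v' :
  m_entry D q star k e v v' = avgA (e v * KLstar D star (e v')).
Proof. by rewrite /m_entry (fsbig_finite _ _ (W0_finite HD)). Qed.

Lemma m_entry_invariant e v v' : W_invariant D (W0 D) (m_entry D q star k e v v').
Proof.
move=> w hw; rewrite m_entryE /twisted_avg; set h := (_ / _).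
have [P [P1 _ _]] := KLact_rmorphism K HD hw.
rewrite P1 rmorphM fmorphV rmorph_nat rmorph_sum; congr (_ * _).
rewrite -[RHS](perm_big _ (W0_seq_mul HD hw)) /= big_map; apply: eq_big_seq => u /(W0_seqP HD) hu.
by rewrite -P1 KLact_comp.
Qed.

(** The coordinates lie in [A0], hence are fixed by [W0]; those of [g] stay fixed after the
    involution, which commutes with the action. So both leave the average. *)
Lemma m_formE J (e fc gc : 'End(V) -> KL V K) f g : A0_basis D J e ->
  coordinates D J e f fc -> coordinates D J e g gc ->
  m_form D q star k J e fc gc = avgA (f * KLstar D star g).
Proof.
move=> [_ _ _] [hf ->] [hg ->].
have fin := min_reps_finite HD J; pose r := enum_fset (fset_set (min_reps D J)).
have rP v : v \in r -> min_reps D J v by rewrite /r (in_fset_set fin) inE.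
have [Q [Q1 _ _]] := KLstar_rmorphism HD star.
have eg : KLstar D star (\sum_(v <- r) gc v * e v) =
    \sum_(v <- r) KLstar D star (gc v) * KLstar D star (e v).
  by rewrite Q1 rmorph_sum; apply: eq_bigr => v _; rewrite rmorphM !Q1.
rewrite /m_form !(fsbig_finite _ _ fin) -/r eg.
rewrite -(twisted_avg_bilinear _ _ KLact_add KLact_mul) => [|v w vr|v w vr].
- apply: eq_bigr => v _; rewrite (fsbig_finite _ _ fin); apply: eq_bigr => v' _.
  by rewrite m_entryE.
- by move=> /(W0_seqP HD) hw; case: (hf v (rP v vr)) => _; apply.
move=> /(W0_seqP HD) hw; case: (hg v (rP v vr)) => Ag inv.
by rewrite KLact_star // inv.
Qed.

Lemma pairing_m_form J (e fc gc : 'End(V) -> KL V K) f g : A0_basis D J e ->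
  A_ D J f -> A_ D J g -> coordinates D J e f fc -> coordinates D J e g gc ->
  in_A D (m_form D q star k J e fc gc) /\
  pairing D mu q star k f g = ct D mu q k (m_form D q star k J e fc gc) (nabla_num D).
Proof.
move=> He [Af _] [Ag _] hf hg; rewrite (m_formE He hf hg) /pairing.
have [s [sL eF]] : in_A D (f * KLstar D star g) by apply: in_AM => //; exact: in_A_star.
exact: avg_in_A_ct sL eF.
Qed.

End ConstantTermIdentity.

Theorem lemma6p1 (R : realType) (V : vectType R) (D : data V)
    (HD : duality_data D)
    (K : fieldType) (q : R -> K) (star : {rmorphism K -> K})
    (Hq : coefficient_data q star)
    (k : V * R -> R) (Hk : labelling D k)
    (mu : {measure set (borel_torus R (\dim {:V})) -> \bar R}) (Hmu : haar mu)
    (HDelta : ct_defined D mu q k (Delta_num D))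
    (Hnabla : ct_defined D mu q k (nabla_num D))
    (J : set V) (HJ : J `<=` simple_roots D)
    (e : 'End(V) -> KL V K) (He : A0_basis D J e) :
  (forall v v', min_reps D J v -> min_reps D J v' ->
     W_invariant D (W0 D) (m_entry D q star k e v v')) /\
  (forall (f g : KL V K) (fc gc : 'End(V) -> KL V K),
     A_ D J f -> A_ D J g ->
     coordinates D J e f fc -> coordinates D J e g gc ->
     in_A D (m_form D q star k J e fc gc) /\
     pairing D mu q star k f g =
     ct D mu q k (m_form D q star k J e fc gc) (nabla_num D)).
Proof.
split=> [v v' _ _|f g fc gc Af Ag hf hg]; first exact: m_entry_invariant.
exact: (pairing_m_form HD Hq Hk Hmu HDelta Hnabla He Af Ag hf hg).
Qed.
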